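(* Let $(x_0,u_0)$ be a Pareto optimal solution of the multiobjective Mayer problem $(\mathcal M)$. Assume: (a) $f$ is continuous on $[0,T]\times\Omega\times U$; $D_{G,2}f(t,\xi,\zeta)$ exists for all $(t,\xi,\zeta)\in[0,T]\times\Omega\times U$; $D_{F,2}f(t,x_0(t),\zeta)$ exists for all $(t,\zeta)\in[0,T]\times U$; and $(t,\zeta)\mapsto D_{F,2}f(t,x_0(t),\zeta)$ is continuous from $[0,T]\times U$ to $\mathcal L(E,E)$; (b) for all non-empty compact $K\subset\Omega$, $M\subset U$, $\sup_{(t,\xi,\zeta)\in[0,T]\times K\times M}\|D_{G,2}f(t,\xi,\zeta)\|_{\mathcal L}<+\infty$; (c) all $g_i^0$ and all $g^\alpha$ are Hadamard differentiable at $x_0(T)$; (d) each $h^\beta$ is continuous on a neighborhood of $x_0(T)$ and Hadamard differentiable at $x_0(T)$; (e) whenever $(c_\alpha)_{1\le\alpha\le m}\in\mathbb R_+^m$ and $(d_\beta)_{1\le\beta\le q}\in\mathbb R^q$ satisfy $c_\alpha g^\alpha(x_0(T))=0$ for all $\alpha$ and $\sum_{\alpha=1}^mc_\alpha D_Hg^\alpha(x_0(T))+\sum_{\beta=1}^qd_\beta D_Hh^\beta(x_0(T))=0$, then $c_\alpha=0$ for all $\alpha$ and $d_\beta=0$ for all $\beta$; (f) $U$ is a subset of a real normed vector space $Y$, and there exists $\hat t\in[0,T]$ such that $U$ is a neighborhood of $u_0(\hat t)$ in $Y$, $D_{G,3}f(\hat t,x_0(\hat t),u_0(\hat t))$ exists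 and is surjective. Then there exist $((\theta_i)_{1\le i\le l},(\lambda_\alpha)_{1\le\alpha\le m},(\mu_\beta)_{1\le\beta\le q},p)\in\mathbb R^l\times\mathbb R^m\times\mathbb R^q\times PC^1([0,T],E^* )$ satisfying the Pontryagin conditions (NN), (Si), (S$\ell$), (TC), (AE.M), (MP.M), (CH.M) listed in the context, and for every such tuple, $(\theta_i)_{1\le i\le l}\ne0$.
   Context: Function spaces. Fix $T\in(0,+\infty)$. Let $Y$ be a Hausdorff space. A function $u:[0,T]\to Y$ is piecewise continuous if there is a subdivision $0=\tau_0<\tau_1<\dots<\tau_{k+1}=T$ such that $u$ is continuous on each $(\tau_i,\tau_{i+1})$, the right limits $u(\tau_i+)$ exist in $Y$ for $0\le i\le k$ and the left limits $u(\tau_i-)$ exist in $Y$ for $1\le i\le k+1$. $NPC^0([0,T],Y)$ is the set of piecewise continuous $u$ that are right continuous on $[0,T)$ and satisfy $u(T-)=u(T)$. If $Y$ is a real Banach space, $PC^1([0,T],Y)$ is the set of continuous $x:[0,T]\to Y$ for which there is a subdivision as before such that $x$ is continuously differentiable on each $(\tau_i,\tau_{i+1})$ and the one-sided limits $x'(\tau_i+)$ ($0\le i\le k$), $x'(\tau_i-)$ ($1\le i\le k+1$) exist in $Y$; for open $G\subset Y$, $PC^1([0,T],G)=\{x\in PC^1([0,T],Y): x([0,T])\subset G\}$. The extended derivative $\underline{d}x:[0,T]\to Y$ of such $x$ is $\underline{d}x(t)=x'(t)$ if $t\notin\{\tau_0,\dots,\tau_{k+1}\}$, $\underline{d}x(\tau_i)=x'(\tau_i+)$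 for $0\le i\le k$, $\underline{d}x(T)=x'(T-)$. Differentials. For real normed spaces $X,Y$, $\mathcal L(X,Y)$ is the space of bounded linear maps with operator norm $\|\cdot\|_{\mathcal L}$ and $X^*=\mathcal L(X,\mathbb R)$. Let $G\subset X$ be non-empty open (or a neighborhood of the point considered), $\mathfrak f:G\to Y$, $x\in G$. $\mathfrak f$ is Gâteaux differentiable at $x$ if there is $D_G\mathfrak f(x)\in\mathcal L(X,Y)$ with $\lim_{t\to0+}\frac{\mathfrak f(x+th)-\mathfrak f(x)}{t}=D_G\mathfrak f(x)\cdot h$ for all $h\in X$; it is Hadamard differentiable at $x$ if there is $D_H\mathfrak f(x)\in\mathcal L(X,Y)$ such that for each compact $K\subset X$, $\lim_{t\to0+}\sup_{h\in K}\|\frac{\mathfrak f(x+th)-\mathfrak f(x)}{t}-D_H\mathfrak f(x)\cdot h\|=0$. $D_F\mathfrak f(x)$ is the Fréchet differential. $D_{G,k}$, $D_{F,k}$ denote partial Gâteaux/Fréchet differentials with respect to the $k$-th variable ($D_{G,3}f(t,\xi,\zeta)$ is the Gâteaux differential at $\zeta$ of $f(t,\xi,\cdot)$). Problem. $E$ is a real Banach space, $\Omega\subset E$ a non-empty open subset, $U$ a Hausdorff topological space, $\xi_0\in\Omega$, $l,m,q$ positive integers, $f:[0,T]\times\Omega\times U\to E$, and $g_i^0,g^\alpha,h^\beta:\Omega\to\mathbb R$ ($1\le i\le l$, $1\le\alpha\le m$, $1\le\beta\le q$). The multiobjective Mayer problem $(\mathcal M)$ is: maximize $(J_1(x,u),\dots,J_l(x,u))$,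 $J_i(x,u)=g_i^0(x(T))$, over $x\in PC^1([0,T],\Omega)$, $u\in NPC^0([0,T],U)$ subject to $\underline{d}x(t)=f(t,x(t),u(t))$ for all $t\in[0,T]$, $x(0)=\xi_0$, $g^\alpha(x(T))\ge0$ for all $\alpha$, $h^\beta(x(T))=0$ for all $\beta$. Pairs $(x,u)$ satisfying these constraints are admissible. An admissible $(\overline x,\overline u)$ is a Pareto optimal solution if there is no admissible $(x,u)$ with $J_i(x,u)\ge J_i(\overline x,\overline u)$ for all $i$ and $J_{i_0}(x,u)>J_{i_0}(\overline x,\overline u)$ for some $i_0$. Hamiltonian: $H_M:[0,T]\times\Omega\times U\times E^*\to\mathbb R$, $H_M(t,x,u,p)=p\cdot f(t,x,u)$. Pontryagin conditions for $((\theta_i),(\lambda_\alpha),(\mu_\beta),p)$ at $(x_0,u_0)$: (NN) $((\theta_i)_i,(\lambda_\alpha)_\alpha,(\mu_\beta)_\beta)\ne 0$; (Si) $\theta_i\ge0$ for all $i$ and $\lambda_\alpha\ge 0$ for all $\alpha$; (S$\ell$) $\lambda_\alpha g^\alpha(x_0(T))=0$ for all $\alpha$; (TC) $\sum_{i=1}^l\theta_iD_Hg_i^0(x_0(T))+\sum_{\alpha=1}^m\lambda_\alpha D_Hg^\alpha(x_0(T))+\sum_{\beta=1}^q\mu_\beta D_Hh^\beta(x_0(T))=p(T)$; (AE.M) $\underline{d}p(t)=-D_{F,2}H_M(t,x_0(t),u_0(t),p(t))$ for all $t\in[0,T]$; (MP.M) $H_M(t,x_0(t),u_0(t),p(t))\ge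 H_M(t,x_0(t),\zeta,p(t))$ for all $t\in[0,T]$, $\zeta\in U$; (CH.M) $t\mapsto H_M(t,x_0(t),u_0(t),p(t))$ is continuous on $[0,T]$. *)

(* Defs.v *)
From HB Require Import structures.
From mathcomp Require Import all_boot all_order all_algebra.
From mathcomp Require Import all_classical all_reals all_analysis.

Set Implicit Arguments.
Unset Strict Implicit.
Unset Printing Implicit Defensive.

Import Order.TTheory GRing.Theory Num.Theory.
Import numFieldNormedType.Exports.

Local Open Scope classical_set_scope.
Local Open Scope ring_scope.

Section BoundedLinearMaps.
Context {R : realType} (X Y : normedModType R).

Definition clinear_pred : {pred X -> Y} :=
  mem [set f : X -> Y | linear f /\ continuous f].

Lemma clinear_submod_closed : submod_closed clinear_pred.
Proof.
split.
  by rewrite inE; split => [a u v|x]; [rewrite /= scaler0 addr0|exact: cvg_cst].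
move=> a f g; rewrite !inE => -[lf cf] [lg cg]; split => [b u v|x].
  rewrite !fctE /= lf lg !scalerDr !scalerA (mulrC a b) -!addrA; congr (_ + _).
  by rewrite addrCA.
rewrite !fctE; apply: cvgD; last exact: cg.
by apply: cvgZ; [exact: cvg_cst|exact: cf].
Qed.

HB.instance Definition _ :=
  GRing.isSubmodClosed.Build R (X -> Y) clinear_pred clinear_submod_closed.

Record blin := Blin { blin_fun :> X -> Y; _ : blin_fun \in clinear_pred }.

HB.instance Definition _ := [isSub for blin_fun].
HB.instance Definition _ := [Choice of blin by <:].
HB.instance Definition _ := [SubChoice_isSubLmodule of blin by <:].

Lemma blin_linear (D : blin) : linear D.
Proof. by case: D => f /=; rewrite inE => -[]. Qed.

Lemma blin_continuous (D : blin) : continuous D.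
Proof. by case: D => f /=; rewrite inE => -[]. Qed.

Definition opnorm (D : blin) : R := sup [set `|D x| | x in [set x | `|x| <= 1]].

HB.instance Definition _ (D : blin) :=
  GRing.isLinear.Build R X Y *:%R D (blin_linear D).

Lemma opnorm_has_sup (D : blin) : has_sup [set `|D x| | x in [set x | `|x| <= 1]].
Proof.
split; first by exists `|D 0|, 0 => //=; rewrite normr0.
have /linear_bounded_continuous/bounded_funP/(_ 1)[M DM] := @blin_continuous D.
by exists M => _ [x /= x1 <-]; exact: DM.
Qed.

Lemma opnorm_ub (D : blin) x : `|x| <= 1 -> `|D x| <= opnorm D.
Proof. by move=> x1; apply: ub_le_sup; [case: (opnorm_has_sup D)|exists x]. Qed.

Lemma opnorm_le (D : blin) c : (forall x, `|x| <= 1 -> `|D x| <= c) -> opnorm D <= c.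
Proof.
move=> Dc; apply: ge_sup; first by case: (opnorm_has_sup D).
by move=> _ [x /= x1 <-]; exact: Dc.
Qed.

Lemma opnorm_ge0 D : 0 <= opnorm D.
Proof. by apply: le_trans (opnorm_ub D (x := 0) _); rewrite ?normr0. Qed.

Lemma opnormD (D D' : blin) : opnorm (D + D') <= opnorm D + opnorm D'.
Proof.
apply: opnorm_le => x x1; apply: le_trans (ler_normD _ _) _.
by apply: lerD; exact: opnorm_ub.
Qed.

Lemma opnormZ_le (a : R) (D : blin) : opnorm (a *: D) <= `|a| * opnorm D.
Proof.
apply: opnorm_le => x x1.
by rewrite [X in `|X|]/(_ *: _) normrZ ler_wpM2l// opnorm_ub.
Qed.

Lemma opnormZ (a : R) (D : blin) : opnorm (a *: D) = `|a| * opnorm D.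
Proof.
have [->|a0] := eqVneq a 0.
  apply/le_anti/andP; split; first exact: opnormZ_le.
  by rewrite normr0 mul0r opnorm_ge0.
apply/le_anti; rewrite opnormZ_le /= -ler_pdivlMl ?normr_gt0//.
rewrite -normfV; apply: le_trans (opnormZ_le _ _).
by rewrite scalerA mulVf// scale1r.
Qed.

Lemma opnorm_le_bound (D : blin) x : `|D x| <= opnorm D * `|x|.
Proof.
have [->|x0] := eqVneq x 0; first by rewrite linear0 !normr0 mulr0.
rewrite -ler_pdivrMr ?normr_gt0// mulrC -[X in X * _]gtr0_norm ?invr_gt0 ?normr_gt0//.
by rewrite -normrZ -linearZ opnorm_ub// normrZV// unitfE normr_eq0.
Qed.

Lemma opnorm0_eq0 (D : blin) : opnorm D = 0 -> D = 0.
Proof.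
move=> D0; apply/val_inj/funext => x; apply/eqP; rewrite -normr_le0.
by rewrite (le_trans (opnorm_le_bound _ _))// D0 mul0r.
Qed.

HB.instance Definition _ :=
  @Lmodule_isNormed.Build R blin opnorm opnormD opnormZ opnorm0_eq0.

End BoundedLinearMaps.

Notation dual X := (blin X (GRing.regular _)).

(* A map defined on a subset of a space is represented by a total function;
   every notion below only depends on its values on that subset.
   Differentials are unique; [DG], [DH] and [DF] are 0 when there is none. *)

Section Differentials.
Context {R : realType} {X Y : normedModType R}.
Implicit Types (f : X -> Y) (x : X) (D : blin X Y).

Definition is_gateaux f x D :=
  forall h, t^-1 *: (f (x + t *: h) - f x) @[t --> (0 : R)^'+] --> D h.

Definition gateaux_differentiable f x := exists D, is_gateaux f x D.

Definition DG f x : blin X Y := xget 0 [set D | is_gateaux f x D].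

(* The supremum is taken in the extended reals because [sup] is 0 on unbounded
   sets; [K] is non-empty because [ereal_sup set0] is -oo. *)
Definition is_hadamard f x D :=
  forall K : set X, compact K -> K !=set0 ->
    ereal_sup [set `|t^-1 *: (f (x + t *: h) - f x) - D h|%:E | h in K]
      @[t --> (0 : R)^'+] --> 0%:E.

Definition hadamard_differentiable f x := exists D, is_hadamard f x D.

Definition DH f x : blin X Y := xget 0 [set D | is_hadamard f x D].

(* The library's Fréchet differential ['d f x], as an element of L(X, Y). *)
Definition DF f x : blin X Y :=
  xget 0 [set D : blin X Y | differentiable f x /\ 'd f x = D :> (X -> Y)].

End Differentials.

(* A subdivision 0 = tau_0 < ... < tau_(k+1) = T is encoded as the sequence
   s = [:: tau_1; ...; tau_(k+1)] with [itv_partition 0 T s];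
   [node s i] is tau_i. *)

Definition node {R : realType} (s : seq R) (i : nat) : R := nth 0 (0 :: s) i.

Section NPC0.
Context {R : realType} {Z : topologicalType}.

(* The one-sided limits are required to lie in [U]. *)
Definition piecewise_continuous (T : R) (U : set Z) (u : R -> Z) :=
  exists2 s, itv_partition 0 T s & forall i, (i < size s)%N ->
    [/\ {within `]node s i, node s i.+1[, continuous u},
        exists2 z, U z & u t @[t --> (node s i)^'+] --> z &
        exists2 z, U z & u t @[t --> (node s i.+1)^'-] --> z].

Definition NPC0 (T : R) (U : set Z) (u : R -> Z) :=
  [/\ forall t, t \in `[0, T] -> U (u t),
      piecewise_continuous T U u,
      forall t, t \in `[0, T[ -> u r @[r --> t^'+] --> u t &
      u r @[r --> T^'-] --> u T].

End NPC0.

Section PC1.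
Context {R : realType} {Y : normedModType R}.
Implicit Types (T : R) (s : seq R) (x : R -> Y).

Definition C1_along T s x :=
  itv_partition 0 T s /\ forall i, (i < size s)%N ->
    [/\ forall t, t \in `]node s i, node s i.+1[ -> derivable x t 1,
        {within `]node s i, node s i.+1[, continuous (derive1 x)},
        cvg (derive1 x t @[t --> (node s i)^'+]) &
        cvg (derive1 x t @[t --> (node s i.+1)^'-])].

Definition PC1 T (G : set Y) x :=
  [/\ {within `[0, T], continuous x},
      forall t, t \in `[0, T] -> G (x t) &
      exists s, C1_along T s x].

Definition ext_deriv_along T s x (t : R) : Y :=
  if t \notin 0 :: s then derive1 x t
  else if t < T then lim (derive1 x r @[r --> t^'+])
  else lim (derive1 x r @[r --> t^'-]).

(* The choice of the subdivision is irrelevant: see [ext_derivE]. *)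
Definition ext_deriv T x : R -> Y :=
  ext_deriv_along T (xget [::] [set s | C1_along T s x]) x.

Lemma C1_along_itv T s x t : C1_along T s x -> t \in `[0, T] ->
  t \notin 0 :: s -> exists2 i, (i < size s)%N & t \in `]node s i, node s i.+1[.
Proof.
move=> [[+ /eqP + _]]; rewrite in_itv /= => + + /andP[+ +].
suff: forall a, path <%O a s -> last a s = T -> a <= t -> t <= T ->
    t \notin a :: s -> exists2 i, (i < size s)%N &
      t \in `](nth 0 (a :: s) i), (nth 0 (a :: s) i.+1)[.
  exact.
elim: s => [|b s IHs] a /=.
  by move=> _ -> Tt tT; rewrite inE (@le_anti _ _ t T) ?eqxx// Tt tT.
move=> /andP[ab bs] sT at_ tT; rewrite inE negb_or => /andP[ta ts].
have [bt|tb] := leP b t.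
  by have [i si ti] := IHs b bs sT bt tT ts; exists i.+1.
by exists 0%N => //=; rewrite in_itv /= tb lt_neqAle eq_sym ta at_.
Qed.

Lemma ext_deriv_alongE T s s' x t : C1_along T s x -> C1_along T s' x ->
  t \in `[0, T] -> ext_deriv_along T s x t = ext_deriv_along T s' x t.
Proof.
have key s1 : C1_along T s1 x -> t \in `[0, T] -> t \notin 0 :: s1 ->
    t < T /\ lim (derive1 x r @[r --> t^'+]) = derive1 x t.
  move=> xs1 t0T ts1; have [i si ti] := C1_along_itv xs1 t0T ts1.
  have [[p1 /eqP lT] /(_ i si)[_ xc _ _]] := xs1.
  split.
    move: t0T; rewrite in_itv /= => /andP[_]; rewrite le_eqVlt => /orP[/eqP tT|//].
    by move: ts1; rewrite tT -lT mem_last.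
  apply: cvg_lim => //; apply: cvg_within_filter.
  rewrite continuous_open_subspace in xc; last exact: interval_open.
  by apply: xc; rewrite inE.
move=> xs xs' t0T; rewrite /ext_deriv_along.
have [ts|ts] := boolP (t \notin 0 :: s);
  have [ts'|ts'] := boolP (t \notin 0 :: s') => //.
- by have [-> ->] := key _ xs t0T ts.
- by have [-> ->] := key _ xs' t0T ts'.
Qed.

Lemma ext_derivE T s x t : C1_along T s x -> t \in `[0, T] ->
  ext_deriv T x t = ext_deriv_along T s x t.
Proof.
by move=> xs; apply: ext_deriv_alongE => //;
  apply: (@xgetPex _ _ [set s | C1_along T s x]); exists s.
Qed.

End PC1.

Section Mayer.
Context {R : realType} {E : completeNormedModType R} {Z : topologicalType}.
Context {l m q : nat}.
Variables (T : R) (Omega : set E) (U : set Z) (xi0 : E) (f : R -> E -> Z -> E).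
Variables (g0 : 'I_l -> E -> R) (g : 'I_m -> E -> R) (h : 'I_q -> E -> R).

Definition admissible (x : R -> E) (u : R -> Z) :=
  [/\ PC1 T Omega x /\ NPC0 T U u,
      forall t, t \in `[0, T] -> ext_deriv T x t = f t (x t) (u t),
      x 0 = xi0,
      forall a, 0 <= g a (x T) &
      forall b, h b (x T) = 0].

Definition pareto_optimal (x : R -> E) (u : R -> Z) :=
  admissible x u /\
  ~ exists x' u', [/\ admissible x' u',
      forall i, g0 i (x T) <= g0 i (x' T) &
      exists i0, g0 i0 (x T) < g0 i0 (x' T)].

Definition hamiltonian (t : R) (xi : E) (z : Z) (p : dual E) : R :=
  p (f t xi z).

Definition pontryagin (x0 : R -> E) (u0 : R -> Z)
    (theta : {ffun 'I_l -> R}) (lambda : {ffun 'I_m -> R})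
    (mu : {ffun 'I_q -> R}) (p : R -> dual E) :=
  [/\ (theta, lambda, mu) <> 0,
      (forall i, 0 <= theta i) /\ (forall a, 0 <= lambda a),
      forall a, lambda a * g a (x0 T) = 0,
      \sum_i theta i *: DH (g0 i : E -> R^o) (x0 T)
        + \sum_a lambda a *: DH (g a : E -> R^o) (x0 T)
        + \sum_b mu b *: DH (h b : E -> R^o) (x0 T) = p T &
   [/\ forall t, t \in `[0, T] ->
        ext_deriv T p t =
        - DF (fun xi => hamiltonian t xi (u0 t) (p t) : R^o) (x0 t),
      forall t z, t \in `[0, T] -> U z ->
        hamiltonian t (x0 t) z (p t) <= hamiltonian t (x0 t) (u0 t) (p t) &
      {within `[0, T], continuous
        (fun t => hamiltonian t (x0 t) (u0 t) (p t))}]].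

End Mayer.

(* Main.v *)
(* Let x0 be optimal, with control u0, and let A(t) be the differential of
   f(t, ., u0(t)) at x0(t). Replacing u0 by other values of U on finitely many
   intervals of length proportional to e > 0 moves the endpoint x0(T) by
   e v + o(e), where v ranges over the convex cone V spanned by the vectors
   S(T) S(s)^-1 (f(s, x0(s), z) - f(s, x0(s), u0(s))), with S' = A S.
   Consider the set C of the vectors which are dominated by the image of some v
   in V under the differentials of the objectives and active inequalities, and
   equal to it under those of the equalities. If C is the whole space, then each
   direction d of the cube [-1,1]^q is realised by a family of needle variations
   which improves every objective; the Poincare-Miranda theorem produces a d for
   which the equality constraints hold exactly, contradicting optimality. So a
   nonzero functional is nonpositive on C. Its coordinates are the multipliers,
   and, ell being the functional that they define on E, the adjoint state is
   p(t) = ell S(T) S(t)^-1; that ell is nonpositive on V is the maximum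
   principle for t < T. If all theta_i vanish, then surjectivity of the partial
   differential at t^ forces p(t^) = 0, hence p(T) = 0 by Gronwall's inequality,
   which contradicts hypothesis (e). *)

(* Three weaknesses of the hypotheses shape the proof. The equality constraints are only continuous
   near the endpoint and Hadamard differentiable at it, so no implicit function theorem applies; a
   topological zero theorem replaces it, which requires endpoints depending continuously on [d] and
   expansions uniform over the cube. Hadamard differentiability carries such expansions over to the
   constraints once the difference quotients of the endpoint lie in one compact set. Next, [f] is
   Frechet differentiable in the state at each time separately, so its remainder need not be small
   uniformly in [t]. Its supremum over small increments is lower semicontinuous in [t] off finitely
   many times, hence measurable, and it is bounded; dominated convergence makes its integral small,
   which is enough for Gronwall's inequality. Finally, controls jump. Being right continuous, they
   give the state a right derivative at every time of [[0, T)], so equations and estimates are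
   written with right derivatives and have no exceptional times; piecewise C^1 functions are
   translated from and into this form. *)
From HB Require Import structures.
Require Import Defs.
From mathcomp Require Import all_boot all_order all_algebra.
From mathcomp Require Import fingroup perm.
From mathcomp Require Import all_classical all_reals all_analysis.
From mathcomp Require Import measurable_realfun ring lra.
Set Implicit Arguments.
Unset Strict Implicit.
Unset Printing Implicit Defensive.
Import Order.TTheory GRing.Theory Num.Theory.
Import numFieldNormedType.Exports.
Local Open Scope classical_set_scope.
Local Open Scope ring_scope.

(** * The Poincare-Miranda theorem *)

Section GridStokes.
Variables (F : numFieldType) (p n : nat).
Local Notation q := p.+1.
Implicit Types (c : 'I_q -> nat) (s : 'S_q) (d : 'I_q).

(* The vertices of the simplex [s] of the Kuhn triangulation of the cube [c]. *)
Definition vtx c s (k : nat) : 'I_q -> nat :=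
  fun d => (c d + (s^-1%g d < k))%N.

Definition facet c s (k : 'I_q.+1) : 'I_q -> 'I_q -> nat :=
  fun j => vtx c s (lift k j).

(** Exchanging two consecutive directions of the monotone path changes only the vertex between them,
    which is the one that this facet omits. *)
Lemma facet_swap c s (k : 'I_q.+1) (a b : 'I_q) :
  k = a.+1 :> nat -> b = a.+1 :> nat ->
  facet c (tperm a b * s)%g k = facet c s k.
Proof.
move=> ka ba; apply/funext => j; apply/funext => d.
rewrite /facet /vtx invMg permM tpermV /=.
have jk : bump k j != k by rewrite eq_sym neq_bump.
congr (_ + _)%N; congr (nat_of_bool _).
case: tpermP => [->|->|//]; move: jk; rewrite ka ba => jk.
  by rewrite [RHS]leq_eqVlt eq_sym (negbTE jk).
by rewrite [LHS]leq_eqVlt eq_sym (negbTE jk).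
Qed.

(** The transposition of [facet_swap] pairs simplices that share this facet and have opposite
    signs. *)
Lemma sum_facet_interior (G : ('I_q -> 'I_q -> nat) -> F) c (k : 'I_q.+1) :
  (0 < k)%N -> (k < q)%N ->
  \sum_(s : 'S_q) (-1) ^+ s * G (facet c s k) = 0.
Proof.
case: k => -[//|k] /= kq1 _ kq.
pose a : 'I_q := Ordinal (ltnW kq); pose b : 'I_q := Ordinal kq.
have ab : a != b by rewrite -val_eqE /= neq_ltn ltnSn.
set S := LHS.
suff : S = - S by move/eqP; rewrite -addr_eq0 -mulr2n mulrn_eq0 /= => /eqP.
rewrite {1}/S (reindex_inj (mulgI (tperm a b))) /= -sumrN.
apply: eq_bigr => s _.
by rewrite odd_permM odd_tperm ab (facet_swap _ _ (a := a) (b := b))//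
  signr_addb mulN1r mulNr.
Qed.

(** The cyclic shift: [rot_perm * s] lists the directions of [s] with the first one moved to the
    end. *)
Definition rot_perm : 'S_q := lift_perm ord_max ord0 1%g.

Lemma rot_permE (j : 'I_q) :
  rot_perm j = (if j == p :> nat then 0 else j.+1)%N :> nat.
Proof.
case: (unliftP ord_max j) => [k ->|->]; rewrite /rot_perm.
  rewrite lift_perm_lift perm1 /= /bump [(p <= k)%N]leqNgt ltn_ord leq0n add1n /=.
  by rewrite add0n ltn_eqF.
by rewrite lift_perm_id /= eqxx.
Qed.

Lemma odd_rot_perm : rot_perm = odd p :> bool.
Proof. by rewrite odd_lift_perm odd_perm1 /= !addbF. Qed.

Definition bump_at d c : 'I_q -> nat := fun i => (c i + (i == d))%N.

(** Without its base vertex, the path of [s] starts after the step in direction [s ord0]. In the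
    neighbouring cube on that side it is the path with this step moved to the end, without its last
    vertex. *)
Lemma facet_rot c s : facet c s ord0 =
  facet (bump_at (s ord0) c) (rot_perm * s)%g ord_max.
Proof.
apply/funext => j; apply/funext => d; rewrite /facet /vtx /bump_at.
rewrite -addnA; congr (_ + _)%N.
have jp := ltn_ord j; rewrite lift0 lift_max.
rewrite invMg permM.
set e := (s^-1)%g d; have -> : (d == s ord0) = (e == 0 :> nat)%N.
  by rewrite -(inj_eq (@perm_inj _ (s^-1)%g)) permK -val_eqE.
set e' := (rot_perm^-1)%g e.
have : rot_perm e' = e by rewrite /e' permKV.
move=> /(congr1 val) /=; rewrite rot_permE.
have [e'p <-|e'p <-] := eqVneq (e' : nat) p.
  by rewrite e'p eqxx /= [(p < j)%N]ltnNge -ltnS jp.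
by rewrite ltnS.
Qed.

(** The cyclic shift of the coordinate [d] is a bijection of the grid, and the layer where it wraps
    around contributes zero on both sides. *)
Lemma sum_bump (H : ('I_q -> nat) -> F) d :
  (forall c, c d = 0%N -> H c = 0) -> (forall c, c d = n -> H c = 0) ->
  \sum_(c : {ffun 'I_q -> 'I_n}) H (bump_at d (fun i => c i)) =
  \sum_(c : {ffun 'I_q -> 'I_n}) H (fun i => c i).
Proof.
case: n => [H0 Hn|n' H0 Hn].
  by apply: eq_bigr => c _; case: (c ord0).
pose r (c : {ffun 'I_q -> 'I_n'.+1}) : {ffun 'I_q -> 'I_n'.+1} :=
  [ffun i => if i == d then ordS (c i) else c i].
pose r' (c : {ffun 'I_q -> 'I_n'.+1}) : {ffun 'I_q -> 'I_n'.+1} :=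
  [ffun i => if i == d then ord_pred (c i) else c i].
have rK : cancel r r'.
  by move=> c; apply/ffunP => i; rewrite !ffunE; case: eqP => // _; rewrite ordSK.
rewrite [RHS](reindex_inj (can_inj rK)) /=.
apply: eq_bigr => c _.
have [cd|cd] := eqVneq (c d : nat) n'.
  rewrite Hn ?H0//; first by rewrite ffunE eqxx /= cd modnn.
  by rewrite /bump_at eqxx cd addn1.
congr H; apply/funext => i; rewrite /bump_at ffunE.
case: (eqVneq i d) => [->|_]; last by rewrite addn0.
by rewrite addn1 /= modn_small// ltnS ltn_neqAle cd -ltnS ltn_ord.
Qed.

(** A discrete Stokes formula: facets inside a cube cancel by [sum_facet_interior], facets common to
    two neighbouring cubes cancel by [facet_rot], and [G] vanishes on those in the boundary of the
    grid. *)
Lemma grid_stokes (G : ('I_q -> 'I_q -> nat) -> F) :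
  (forall y d, (forall j, y j d = 0%N) -> G y = 0) ->
  (forall y d, (forall j, y j d = n) -> G y = 0) ->
  \sum_(c : {ffun 'I_q -> 'I_n}) \sum_(s : 'S_q) (-1) ^+ s *
    \sum_(k < q.+1) (-1) ^+ k * G (facet (fun i => c i) s k) = 0.
Proof.
move=> G0 Gn.
under eq_bigr => c _.
  under eq_bigr => s _ do rewrite mulr_sumr.
  rewrite exchange_big /= big_ord_recl big_ord_recr /= [X in _ + (X + _)]big1 => [|k _]; last first.
    under eq_bigr => s _ do rewrite mulrCA.
    by rewrite -mulr_sumr sum_facet_interior ?mulr0//=
      /bump leq0n add1n ltnS ltn_ord.
  rewrite add0r.
over.
rewrite big_split /= addrC.
rewrite exchange_big [X in _ + X]exchange_big /=.
have -> : \sum_(s : 'S_q) \sum_(c : {ffun 'I_q -> 'I_n})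
      (-1) ^+ s * ((-1) ^+ 0 * G (facet (fun i => c i) s ord0)) =
    \sum_(s : 'S_q) \sum_(c : {ffun 'I_q -> 'I_n})
      (-1) ^+ s * G (facet (fun i => c i) (rot_perm * s)%g ord_max).
  apply: eq_bigr => s _; rewrite -!mulr_sumr expr0 mul1r; congr (_ * _).
  under eq_bigr => c _ do rewrite facet_rot.
  apply: (@sum_bump (fun c => G (facet c (rot_perm * s)%g ord_max)) (s ord0)).
    move=> c c0; apply: (G0 _ (s ord0)) => j.
    rewrite /facet /vtx c0 add0n invMg permM permK.
    have -> : (rot_perm^-1)%g ord0 = ord_max.
      by apply: (@perm_inj _ rot_perm); rewrite permKV; apply/val_inj;
        rewrite /= rot_permE eqxx.
    by rewrite lift_max /= ltnNge -ltnS ltn_ord.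
  move=> c cn; apply: (Gn _ (s ord0)) => j.
  rewrite /facet /vtx cn invMg permM permK.
  have -> : (rot_perm^-1)%g ord0 = ord_max.
    by apply: (@perm_inj _ rot_perm); rewrite permKV; apply/val_inj;
      rewrite /= rot_permE eqxx.
  by rewrite lift_max /= ltnNge -ltnS ltn_ord addn0.
rewrite (reindex_inj (mulgI rot_perm)) /= -big_split /=.
apply: big1 => s _; rewrite -big_split big1 //= => c _.
have -> : lift ord0 (ord_max : 'I_q) = ord_max by exact/val_inj.
rewrite odd_permM odd_rot_perm signr_addb signr_odd /bump leq0n add1n exprS.
(* The rotation has sign [e] and the last facet has sign [- e]; their product [-1] opposes the sign
   of the first facet. *)
set e := (-1) ^+ p; set e' := (-1) ^+ s; set g := G _.
rewrite [LHS](_ : _ = (1 - e ^+ 2) * (e' * g)); last by ring.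
by rewrite sqrr_sign subrr mul0r.
Qed.

(** The labels in homogeneous coordinates: with the row of ones on top, the determinant is, up to a
    factorial, the oriented volume of the simplex of label vectors. *)
Definition label_row (l : 'I_q -> ('I_q -> nat) -> F) (i : 'I_q.+1) v : F :=
  if unlift ord0 i is Some j then l j v else 1.

Definition label_mx m k (l : 'I_q -> ('I_q -> nat) -> F) (f : 'I_m -> 'I_q.+1)
    (y : 'I_k -> 'I_q -> nat) : 'M[F]_(m, k) :=
  \matrix_(i, j) label_row l (f i) (y j).

(* The facets shared by two simplices cancel, so that this sum only depends on the
   labels of the boundary of the grid, which allows to compute it for one labelling. *)
Definition grid_degree (l : 'I_q -> ('I_q -> nat) -> F) : F :=
  \sum_(c : {ffun 'I_q -> 'I_n}) \sum_(s : 'S_q) (-1) ^+ s *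
    \det (label_mx l id (fun k : 'I_q.+1 => vtx (fun i => c i) s k)).

(** Expand along the row of label [r] and write the label of the omitted vertex as the total minus
    the sum over the facet. The total drops out: its coefficient is the determinant with row [r]
    replaced by ones, which has two equal rows. *)
Lemma det_label_facets (l : 'I_q -> ('I_q -> nat) -> F) (r : 'I_q) c s :
  \det (label_mx l id (fun k : 'I_q.+1 => vtx c s k)) =
  (-1) ^+ r * \sum_(k < q.+1) (-1) ^+ k *
    ((\sum_j l r (facet c s k j)) *
     \det (label_mx l (lift (lift ord0 r)) (facet c s k))).
Proof.
set A := label_mx l id _; set i0 := lift ord0 r.
pose t k := l r (vtx c s k).
have Ai0 k : A i0 k = t k by rewrite mxE /label_row liftK.
have minorE k : \det (label_mx l (lift i0) (facet c s k)) =
    \det (row' i0 (col' k A)).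
  by congr (\det _); apply/matrixP => i j; rewrite !mxE.
have minor0 : \sum_(k < q.+1) (-1) ^+ (i0 + k) * \det (row' i0 (col' k A)) = 0.
  pose B := \matrix_(i, k) (if i == i0 then 1 else A i k).
  have B0 : \det B = 0.
    apply: (@determinant_alternate _ _ _ i0 ord0) => [|k].
      by rewrite eq_sym neq_lift.
    by rewrite !mxE eqxx /= /label_row; case: unliftP.
  rewrite -[RHS]B0 (expand_det_row _ i0); apply: eq_bigr => k _.
  rewrite mxE eqxx mul1r /cofactor; congr (_ * \det _).
  by apply/matrixP => i j; rewrite !mxE [lift _ i == _]eq_sym (negbTE (neq_lift _ _)).
rewrite (expand_det_row _ i0) mulr_sumr.
pose Tt := \sum_(k < q.+1) t k.
transitivity (\sum_(k < q.+1) ((-1) ^+ r * ((-1) ^+ k *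
   (Tt * \det (row' i0 (col' k A)))) + t k * cofactor A i0 k)).
  rewrite big_split /= [X in X + _](_ : _ = 0) ?add0r.
    by apply: eq_bigr => k _; rewrite Ai0.
  rewrite (eq_bigr (fun k : 'I_q.+1 => - Tt * ((-1) ^+ (i0 + k) *
    \det (row' i0 (col' k A))))) => [|k _].
    by rewrite -mulr_sumr minor0 mulr0.
  by rewrite /i0 lift0 addSn exprS exprD; ring.
apply: eq_bigr => k _; rewrite minorE /cofactor.
have -> : \sum_j l r (facet c s k j) = Tt - t k.
  by apply/(canRL (addrK _)); rewrite /Tt (bigD1_ord k)//= addrC.
by rewrite lift0 addSn exprS exprD; ring.
Qed.

(** The row of [l d] is [a] times the row of ones, and both survive the deletion of row [r]. *)
Lemma det_label_const_row (l : 'I_q -> ('I_q -> nat) -> F) (r d : 'I_q)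
    (y : 'I_q -> 'I_q -> nat) a : d != r -> (forall j, l d (y j) = a) ->
  \det (label_mx l (lift (lift ord0 r)) y) = 0.
Proof.
move=> dr lda.
have [i1 i1E] : exists i1 : 'I_q, lift (lift ord0 r) i1 = lift ord0 d.
  case: (unliftP (lift ord0 r) (lift ord0 d)) => [i1 ->|]; first by exists i1.
  by move=> /lift_inj dr'; rewrite dr' eqxx in dr.
have [i0 i0E] : exists i0 : 'I_q, lift (lift ord0 r) i0 = ord0.
  case: (unliftP (lift ord0 r) ord0) => [i0 e|e]; first by exists i0; rewrite -e.
  by have := neq_lift ord0 r; rewrite -e eqxx.
have i10 : i1 != i0.
  by apply/eqP => e; have := neq_lift ord0 d; rewrite -i1E e i0E eqxx.
apply/eqP/det0P; exists (delta_mx 0 i1 - a *: delta_mx 0 i0).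
  apply/eqP => /matrixP/(_ 0 i1); rewrite !mxE !eqxx (negbTE i10) mulr0 subr0.
  by move/eqP; rewrite oner_eq0.
rewrite mulmxBl -scalemxAl -!rowE; apply/rowP => j; rewrite !mxE /label_row.
by rewrite i1E i0E liftK unlift_none lda mulr1 subrr.
Qed.

Definition grid_boundary (l : 'I_q -> ('I_q -> nat) -> F) :=
  forall j v, (v j = 0%N -> l j v = 0) /\ (v j = n -> l j v = 1).

(** By [det_label_facets] the degree is a sum over facets, so [grid_stokes] applies once boundary
    facets contribute nothing: on the faces orthogonal to [r] the label [r] vanishes, on the others
    some other label is constant. *)
Lemma grid_degree_eq0 (l : 'I_q -> ('I_q -> nat) -> F) (r : 'I_q) :
  (forall v, v r = 0%N -> l r v = 0) -> (forall v, v r = n -> l r v = 0) ->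
  (forall j v, j != r -> (v j = 0%N -> l j v = 0) /\ (v j = n -> l j v = 1)) ->
  grid_degree l = 0.
Proof.
move=> lr0 lrn lb; rewrite /grid_degree.
under eq_bigr => c _ do under eq_bigr => s _ do
  rewrite (det_label_facets l r) mulrCA.
under eq_bigr => c _ do rewrite -mulr_sumr.
rewrite -mulr_sumr.
pose G (y : 'I_q -> 'I_q -> nat) := (\sum_j l r (y j)) *
  \det (label_mx l (lift (lift ord0 r)) y).
rewrite (grid_stokes (G := G)) ?mulr0// => y d yd; rewrite /G.
  have [dr|dr] := eqVneq d r.
    by rewrite big1 ?mul0r// => j _; rewrite lr0// -dr.
  by rewrite (@det_label_const_row _ _ d _ 0) ?mulr0// => j; have [+ _] := lb d (y j) dr; exact.
have [dr|dr] := eqVneq d r.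
  by rewrite big1 ?mul0r// => j _; rewrite lrn// -dr.
by rewrite (@det_label_const_row _ _ d _ 1) ?mulr0// => j; have [_ +] := lb d (y j) dr; exact.
Qed.

(** The determinant is additive in row [r], so the difference of the degrees is the degree of the
    labelling by [l r - l' r], which vanishes on both faces orthogonal to [r]. *)
Lemma grid_degree_homotopy (l l' : 'I_q -> ('I_q -> nat) -> F) (r : 'I_q) :
  grid_boundary l -> grid_boundary l' -> (forall j, j != r -> l j = l' j) ->
  grid_degree l = grid_degree l'.
Proof.
move=> bl bl' ll'; apply/eqP; rewrite -subr_eq0; apply/eqP.
pose t j v := if j == r then l j v - l' j v else l j v.
rewrite -[RHS](@grid_degree_eq0 t r); first last.
- by move=> j v jr; rewrite /t (negbTE jr).
- by move=> v vr; rewrite /t eqxx (bl r v).2// (bl' r v).2// subrr.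
- by move=> v vr; rewrite /t eqxx (bl r v).1// (bl' r v).1// subrr.
rewrite /grid_degree -sumrB; apply: eq_bigr => c _; rewrite -sumrB.
apply: eq_bigr => s _; rewrite -mulrBr; congr (_ * _).
apply/eqP; rewrite subr_eq; apply/eqP; rewrite -[X in X + _]mul1r -[X in _ + X]mul1r.
have rowE (k k' : 'I_q -> ('I_q -> nat) -> F) : (forall j, j != r -> k j = k' j) ->
    row' (lift ord0 r) (label_mx k id (fun k0 : 'I_q.+1 => vtx (fun i => c i) s k0)) =
    row' (lift ord0 r) (label_mx k' id (fun k0 : 'I_q.+1 => vtx (fun i => c i) s k0)).
  move=> kk'; apply/matrixP => i j; rewrite !mxE /label_row.
  case: unliftP => // m im; rewrite kk'//.
  by apply/eqP => mr; have := neq_lift (lift ord0 r) i; rewrite im mr eqxx.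
apply: (@determinant_multilinear _ _ _ _ _ (lift ord0 r)).
- by apply/rowP => k; rewrite !mxE /label_row liftK /t eqxx !mul1r subrK.
- apply: rowE => j jr; apply/funext => v.
  by rewrite /t (negbTE jr).
- by apply: rowE => j jr; rewrite ll'.
Qed.

Definition coord_label (j : 'I_q) (v : 'I_q -> nat) : F := (v j)%:R / n%:R.

(** Every simplex has the same signed determinant [n%:R ^- q], so the degree is a positive multiple
    of it. *)
Lemma grid_degree_coord : (0 < n)%N -> grid_degree coord_label != 0.
Proof.
move=> n0; rewrite /grid_degree.
have detE c s : (-1) ^+ s * \det (label_mx coord_label id
    (fun k : 'I_q.+1 => vtx c s k)) = n%:R ^- q.
  (* The first column of [P] is the base vertex and the others are the successive steps of the path;
     multiplication by [U] forms the partial sums, which are the vertices. *)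
  pose U : 'M[F]_q.+1 := \matrix_(i, k) (i <= k)%:R.
  pose P : 'M[F]_q.+1 := \matrix_(i, k)
    match unlift ord0 i, unlift ord0 k with
    | None, None => 1 | None, Some _ => 0
    | Some j, None => (c j)%:R / n%:R
    | Some j, Some k' => (s k' == j)%:R / n%:R end.
  have -> : label_mx coord_label id (fun k : 'I_q.+1 => vtx c s k) = P *m U.
    apply/matrixP => i k; rewrite !mxE big_ord_recl !mxE /label_row unlift_none.
    case: unliftP => [j ->|->].
      rewrite /coord_label /vtx natrD mulrDl leq0n mulr1; congr (_ + _).
      rewrite (bigD1 ((s^-1)%g j))//= big1 ?addr0 => [|j' j'j].
        by rewrite !mxE !liftK permKV eqxx mul1r lift0 mulrC.
      rewrite !mxE !liftK -(inj_eq (@perm_inj _ (s^-1)%g)) permK (negbTE j'j).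
      by rewrite !mul0r.
    rewrite mul1r leq0n big1 ?addr0// => j _.
    by rewrite !mxE unlift_none liftK mul0r.
  have detU : \det U = 1.
    rewrite -det_tr det_trig; first by rewrite big1// => i _; rewrite !mxE leqnn.
    by apply/is_trig_mxP => i k ik; rewrite !mxE leqNgt ik.
  rewrite det_mulmx detU mulr1 (expand_det_row _ ord0) big_ord_recl big1 ?addr0.
    rewrite mxE !unlift_none mul1r /cofactor expr0 mul1r.
    have -> : row' ord0 (col' ord0 P) = n%:R^-1 *: perm_mx (s^-1)%g.
      apply/matrixP => i k; rewrite !mxE !liftK mulrC; congr (_ * _%:R).
      by rewrite -(inj_eq (@perm_inj _ (s^-1)%g)) permK eq_sym.
    by rewrite detZ det_perm odd_permV mulrCA -expr2 sqrr_sign mulr1 exprVn.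
  by move=> k _; rewrite !mxE unlift_none liftK mul0r.
under eq_bigr => c _ do under eq_bigr => s _ do rewrite detE.
rewrite !sumr_const -!mulrnA mulrn_eq0 negb_or invr_neq0 ?andbT; last first.
  by rewrite expf_neq0// pnatr_eq0 -lt0n.
rewrite muln_eq0 negb_or -!lt0n; apply/andP; split; apply/card_gt0P.
  by exists 1%g.
by exists [ffun=> Ordinal n0].
Qed.

(** The labels are exchanged for the coordinates one at a time; all intermediate labellings satisfy
    the same boundary conditions, so the degree never changes. *)
Lemma grid_degree_neq0 (l : 'I_q -> ('I_q -> nat) -> F) : (0 < n)%N ->
  grid_boundary l -> grid_degree l != 0.
Proof.
move=> n0 bl.
pose h (k : nat) (j : 'I_q) := if (j < k)%N then l j else coord_label j.
have bh k : grid_boundary (h k).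
  move=> j v; rewrite /h; case: ifP => _; first exact: bl.
  split=> vj; rewrite /coord_label vj ?mul0r// divff// pnatr_eq0 -lt0n//.
have hE k : (k <= q)%N -> grid_degree (h k) = grid_degree coord_label.
  elim: k => [_|k IHk kq]; first by [].
  rewrite -IHk; last exact: ltnW.
  apply: (@grid_degree_homotopy _ _ (Ordinal kq)) => // j.
  rewrite /h ltnS leq_eqVlt -val_eqE /= => /negbTE -> //.
suff -> : l = h q by rewrite hE// grid_degree_coord.
by apply/funext => j; rewrite /h ltn_ord.
Qed.

(* A cell on which some label is constant contributes nothing to the degree. *)
Lemma grid_full_cell (l : 'I_q -> ('I_q -> nat) -> bool) : (0 < n)%N ->
  (forall j v, v j = 0%N -> l j v = false) ->
  (forall j v, v j = n -> l j v = true) ->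
  exists c : 'I_q -> nat, (forall i, (c i < n)%N) /\
    forall j, exists v v', [/\ l j v = false, l j v' = true,
      forall i, (c i <= v i <= (c i).+1)%N &
      forall i, (c i <= v' i <= (c i).+1)%N].
Proof.
move=> n0 l0 ln.
have : grid_degree (fun j v => (l j v)%:R) != 0.
  by apply: grid_degree_neq0 => // j v; split=> vj; rewrite ?(l0 j v vj) ?(ln j v vj).
rewrite /grid_degree => S0.
have [c /eqP Sc0] : exists c : {ffun 'I_q -> 'I_n}, \sum_(s : 'S_q) (-1) ^+ s *
    \det (label_mx (fun j v => (l j v)%:R) id
      (fun k : 'I_q.+1 => vtx (fun i => c i) s k)) <> 0.
  apply: contrapT => /forallNP h; move/eqP: S0; apply.
  by apply: big1 => c _; exact: contrapT (h c).
have [s ds] : exists s : 'S_q, \det (label_mx (fun j v => (l j v)%:R) id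
      (fun k : 'I_q.+1 => vtx (fun i => c i) s k)) <> 0.
  apply: contrapT => /forallNP h; move/eqP: Sc0; apply.
  by apply: big1 => s _; rewrite (contrapT (h s)) mulr0.
exists (fun i => c i); split => [i|j]; first exact: ltn_ord.
have vb (k : 'I_q.+1) i : (c i <= vtx (fun i => c i) s k i <= (c i).+1)%N.
  by rewrite /vtx leq_addr /= -[(c i).+1]addn1 leq_add2l leq_b1.
have hb b : exists k : 'I_q.+1, l j (vtx (fun i => c i) s k) = b.
  apply: contrapT => /forallNP h; apply: ds.
  apply/eqP/det0P; exists (delta_mx 0 (lift ord0 j) - (~~ b)%:R *: delta_mx 0 ord0).
    apply/eqP => /matrixP/(_ 0 (lift ord0 j)); rewrite !mxE !eqxx /=.
    by rewrite mulr0 subr0; move/eqP; rewrite oner_eq0.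
  rewrite mulmxBl -scalemxAl -!rowE; apply/rowP => k; rewrite !mxE /label_row.
  rewrite liftK unlift_none mulr1.
  by have := h k; case: (l j _) => //; case: b {h} => //= _; rewrite subrr.
have [k kE] := hb false; have [k' k'E] := hb true.
by exists (vtx (fun i => c i) s k), (vtx (fun i => c i) s k').
Qed.

End GridStokes.

Definition unit_cube {R : realType} (q : nat) : set 'rV[R]_q :=
  [set d | forall j, d ord0 j \in `[-1, 1]].

Arguments unit_cube {R} q _.

Lemma unit_cube_compact {R : realType} q : compact (@unit_cube R q).
Proof.
exact: (@rV_compact R q (fun=> `[-1, 1]%classic) (fun=> @segment_compact _ _ _)).
Qed.

(** Sign labels on finer and finer grids produce cells on which every [phi j] takes a value of each
    weak sign. A cluster point of these cells is a common zero by continuity. *)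
Lemma poincare_miranda {R : realType} (q : nat) (phi : 'I_q -> 'rV[R]_q -> R) :
  (0 < q)%N ->
  (forall j, {within unit_cube q, continuous (phi j)}) ->
  (forall j d, unit_cube q d -> d ord0 j = -1 -> phi j d <= 0) ->
  (forall j d, unit_cube q d -> d ord0 j = 1 -> 0 <= phi j d) ->
  exists2 d, unit_cube q d & forall j, phi j d = 0.
Proof.
case: q phi => // p phi _ cphi phi0 phi1; set q := p.+1.
pose pt (n : nat) (v : 'I_q -> nat) : 'rV[R]_q :=
  \row_j (-1 + 2 * (v j)%:R / n.+1%:R).
have ptc n v : (forall i, (v i <= n.+1)%N) -> unit_cube q (pt n v).
  move=> vn i; rewrite mxE in_itv /=.
  have n0 : (0 : R) < n.+1%:R by rewrite ltr0n.
  have h0 : 0 <= (v i)%:R / n.+1%:R :> R by rewrite divr_ge0// ltW.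
  have h1 : (v i)%:R / n.+1%:R <= 1 :> R by rewrite ler_pdivrMr// mul1r ler_nat.
  by rewrite -mulrA; move: (_ / _) h0 h1 => x h0 h1; lra.
have cell (n : nat) : exists c : 'I_q -> nat, (forall i, (c i <= n)%N) /\
    forall j, exists v v', [/\ phi j (pt n v) <= 0, 0 <= phi j (pt n v'),
      forall i, (c i <= v i <= (c i).+1)%N &
      forall i, (c i <= v' i <= (c i).+1)%N].
  (* The label is the sign of [phi j], but prescribed on the two faces orthogonal to [j], where
     [phi j] may vanish; the hypotheses on the faces keep it consistent with the weak sign. *)
  pose l j v := (0 < v j)%N && ((v j == n.+1) || (0 <= phi j (pt n v))).
  have [|||c [cn cl]] := @grid_full_cell R p n.+1 l.
  - by [].
  - by move=> j v vj; rewrite /l vj.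
  - by move=> j v vj; rewrite /l vj eqxx.
  exists c; split => // j; have [v [v' [lv lv' cv cv']]] := cl j.
  have vn i : (v i <= n.+1)%N by have /andP[_ h] := cv i; apply: leq_trans h _.
  have vn' i : (v' i <= n.+1)%N by have /andP[_ h] := cv' i; apply: leq_trans h _.
  exists v, v'; split => //.
    move: lv => /negbT; rewrite negb_and -leqNgt leqn0 negb_or => /orP[/eqP v0|].
      by apply: phi0; [exact: ptc|rewrite mxE v0 mulr0 mul0r addr0].
    by rewrite -ltNge => /andP[_ /ltW].
  move: lv' => /andP[_ /orP[/eqP v1|//]].
  apply: phi1; [exact: ptc|rewrite mxE v1 mulfK ?pnatr_eq0//].
  by rewrite addrC; apply/eqP; rewrite subr_eq.
have [c cP] := choice cell.
have : cluster (pt n (c n) @[n --> \oo]) `&` unit_cube q !=set0.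
  rewrite setIC; apply: unit_cube_compact.
  exists 0%N => // n _ /=; apply: ptc => i; have [cn _] := cP n; exact: leq_trans (cn i) _.
move=> [d [cd qd]]; exists d => // j.
have near0 (P : set R) : nbhs (phi j d) P ->
    exists n, forall v, (forall i, (c n i <= v i <= (c n i).+1)%N) -> P (phi j (pt n v)).
  have /subspace_continuousP/(_ d qd) := cphi j; move=> /[apply].
  rewrite /within/= => /nbhs_ballP[e /= e0 de].
  (* For [n >= N] the mesh [2 / n.+1] is below [e / 2]; a cell whose corner is within [e / 2] of [d]
     then lies within [e] of [d]. *)
  have [N N0] : exists N : nat, 4 / e < N.+1%:R.
    by exists (Num.truncn (4 / e)); rewrite Num.Theory.truncnS_gt.
  have [||_ [[n /= Nn <-] dn]] := cd [set pt n (c n) | n in [set n | (N <= n)%N]] (ball d (e / 2)).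
  - by exists N => // n /= Nn; exists n.
  - by apply: nbhsx_ballx; rewrite divr_gt0.
  exists n => v vc.
  have n0 : (0 : R) < n.+1%:R by rewrite ltr0n.
  have [cn _] := cP n.
  apply: de; last first.
    by apply: ptc => i; have /andP[_ h] := vc i; apply: (leq_trans h); rewrite ltnS.
  apply: (@ball_splitr _ _ (pt n (c n))); first exact: ball_sym.
  split=> [|i k]; first by rewrite divr_gt0.
   rewrite !mxE /ball /=.
  have /andP[v1 v2] := vc k.
  rewrite (_ : _ - _ = 2 / n.+1%:R * ((c n k)%:R - (v k)%:R)); last by field; rewrite lt0r_neq0.
  rewrite normrM gtr0_norm ?divr_gt0//.
  have h1 : `|(c n k)%:R - (v k)%:R| <= 1 :> R.
    rewrite ler_norml; apply/andP; split; last first.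
      by rewrite lerBlDr nat1r ler_nat leqW.
    by rewrite lerBrDr addrC lerBlDr natr1 ler_nat.
  have h2 : 2 / n.+1%:R < e / 2.
    rewrite ltr_pdivrMr// mulrAC ltr_pdivlMr//.
    have : 4 < N.+1%:R * e by rewrite -ltr_pdivrMr.
    have : N.+1%:R * e <= n.+1%:R * e :> R by rewrite ler_pM2r// ler_nat.
    lra.
  apply: le_lt_trans h2; rewrite -[leRHS]mulr1 ler_wpM2l// ltW// divr_gt0//.
apply/eqP; rewrite eq_le; apply/andP; split; rewrite leNgt; apply/negP => hj.
  have [|n hn] := near0 [set x | 0 < x]; first exact: lt_nbhsr.
  have [_ /(_ j)[v [v' [hv _ vc _]]]] := cP n.
  by have /= := hn v vc; rewrite ltNge hv.
have [|n hn] := near0 [set x | x < 0]; first exact: lt_nbhsl.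
have [_ /(_ j)[v [v' [_ hv' _ vc]]]] := cP n.
by have /= := hn v' vc; rewrite ltNge hv'.
Qed.

(** * Separation of convex cones *)

Definition convex_cone {R : realType} {V : lmodType R} (C : set V) :=
  [/\ C 0, forall x y, C x -> C y -> C (x + y) &
      forall (a : R) x, 0 <= a -> C x -> C (a *: x)].

Section ConeSeparation.
Context {R : realType} {V : lmodType R}.
Implicit Types (C : set V) (x y w v : V).

Definition cone_add_line C v : set V := [set x | exists a : R, C (x - a *: v)].

Lemma cone_add_lineP C v : convex_cone C ->
  [/\ convex_cone (cone_add_line C v), C `<=` cone_add_line C v,
      cone_add_line C v v & cone_add_line C v (- v)].
Proof.
move=> [C0 CD CZ]; split.
- split.
  + by exists 0; rewrite scale0r subr0.
  + move=> x y [a xa] [b yb]; exists (a + b).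
    by rewrite scalerDl opprD addrACA; exact: CD.
  + move=> c x c0 [a xa]; exists (c * a).
    by rewrite -scalerA -scalerBr; exact: CZ.
- by move=> x Cx; exists 0; rewrite scale0r subr0.
- by exists 1; rewrite scale1r subrr.
- by exists (-1); rewrite scaleN1r subrr.
Qed.

Lemma cone_sum C (I : Type) (r : seq I) (P : pred I) (x : I -> V) : convex_cone C ->
  (forall i, P i -> C (x i)) -> C (\sum_(i <- r | P i) x i).
Proof. by move=> [C0 CD _] Cx; elim/big_ind : _. Qed.

(* [w + C] meets no line parallel to [v] only if [v] can be tilted by a multiple
   of [w]: the admissible tilts form the interval between two suprema. *)
Lemma cone_tilt_line C w v : convex_cone C -> ~ C w ->
  (forall x, exists a : R, C (x + a *: w)) ->
  exists s : R, ~ cone_add_line C (v + s *: w) w.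
Proof.
move=> [C0 CD CZ] Cw Cs.
have pos a : C (a *: w) -> a <= 0.
  move=> Ca; rewrite leNgt; apply/negP => a0; apply: Cw.
  have -> : w = a^-1 *: (a *: w) by rewrite scalerA mulVf ?lt0r_neq0// scale1r.
  by apply: CZ => //; rewrite invr_ge0 ltW.
pose S := [set s : R | C (v + s *: w)].
have sum s s' : S s -> C (- v + s' *: w) -> s <= - s'.
  move=> Ss Cs'; rewrite -subr_le0 opprK; apply: pos.
  by have := CD _ _ Ss Cs'; rewrite addrACA subrr add0r -scalerDl.
have [s0 Ss0] := Cs v; have [s1 Cs1] := Cs (- v).
have hS : has_sup S by split; [exists s0|exists (- s1) => s Ss; exact: sum Ss Cs1].
exists (sup S) => -[a Ca].
have [a0|a0|a0] := ltgtP a 0.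
- have a0' : 0 <= - a^-1 by rewrite oppr_ge0 invr_le0 ltW.
  have Sa : S (sup S - a^-1).
    rewrite /S /=; have := CZ _ _ a0' Ca.
    rewrite scalerBr scalerA scalerDr mulNr mulVf ?lt_eqF// !scaleNr !scale1r.
    by rewrite opprD !opprK scalerBl addrC addrA.
  by have := ub_le_sup hS.2 Sa; rewrite gerDl oppr_le0 invr_ge0 leNgt a0.
- have a0' : 0 <= a^-1 by rewrite invr_ge0 ltW.
  have := CZ _ _ a0' Ca.
  rewrite scalerBr scalerA mulVf ?gt_eqF// scale1r opprD addrCA -scalerBl => Cv.
  have : sup S <= - (a^-1 - sup S).
    by apply: ge_sup; [exists s0|move=> s Ss; exact: sum Ss Cv].
  by rewrite opprB lerDl oppr_ge0 invr_le0 leNgt a0.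
- by apply: Cw; rewrite a0 scale0r subr0 in Ca.
Qed.

(** Modulo lines contained in [C'], each [e i] becomes a multiple of [w]. The coefficients of these
    multiples are those of the separating functional. *)
Lemma cone_tilt_lines C w (I : eqType) (r : seq I) (e : I -> V) :
  convex_cone C -> ~ C w -> (forall x, exists a : R, C (x + a *: w)) ->
  exists C', [/\ convex_cone C', C `<=` C', ~ C' w &
    forall i, i \in r -> exists s : R, C' (e i + s *: w) /\ C' (- (e i + s *: w))].
Proof.
move=> cC Cw Cs; elim: r => [|i r [C' [cC' CC' Cw' IH]]]; first by exists C; split.
have Cs' x : exists a : R, C' (x + a *: w) by have [a xa] := Cs x; exists a; exact: CC'.
have [s sw] := cone_tilt_line (e i) cC' Cw' Cs'.
have [c1 c2 c3 c4] := cone_add_lineP (e i + s *: w) cC'.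
exists (cone_add_line C' (e i + s *: w)); split => //.
  by move=> x /CC' /c2.
move=> j; rewrite inE => /orP[/eqP ->|jr]; first by exists s.
by have [s' [? ?]] := IH j jr; exists s'; split; exact: c2.
Qed.

End ConeSeparation.

(** A finite and purely algebraic form of the Hahn-Banach extension: enlarge [C] by lines, always
    avoiding a vector [w], until it fills the space modulo [w]. *)
Lemma cone_separation {R : realType} (I : finType) (C : set (I -> R^o)) :
  convex_cone C -> C <> setT ->
  exists2 nu : I -> R, (exists i, nu i != 0) &
    forall x, C x -> \sum_i nu i * x i <= 0.
Proof.
move=> cC CT; pose e (i : I) : I -> R^o := fun j => (j == i)%:R.
have ZNN (a : R) (u : I -> R^o) : a *: u = (- a) *: (- u) by rewrite scaleNr scalerN opprK.
have xE (x : I -> R^o) : x = \sum_i x i *: e i.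
  apply/funext => j; rewrite fct_sumE (bigD1 j)//= big1 ?addr0.
    by rewrite scalrfctE /e eqxx [_ *: _]mulr1.
  by move=> i ij; rewrite scalrfctE /e eq_sym (negbTE ij) scaler0.
(* The lines along the basis vectors are added one by one until the cone is everything; [C1] is the
   last proper cone and [e i] the direction that completes it. *)
have [C1 [i [cC1 CC1 C1T C1s]]] : exists (C1 : set (I -> R^o)) (i : I),
    [/\ convex_cone C1, C `<=` C1, C1 <> setT & forall x, exists a : R, C1 (x + a *: e i)].
  pose D := foldr (fun i C' => cone_add_line C' (e i)) C.
  have cD r : convex_cone (D r).
    by elim: r => //= i r /(cone_add_lineP (e i))[].
  have CD r : C `<=` D r.
    elim: r => //= i r IH x /IH; have [_ + _ _] := cone_add_lineP (e i) (cD r); exact.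
  have DT : D (enum I) = setT.
    apply/seteqP; split => // x _; rewrite (xE x).
    have De r i : i \in r -> D r (e i) /\ D r (- e i).
      elim: r => //= j r IH; rewrite inE; have [_ c2 c3 c4] := cone_add_lineP (e j) (cD r).
      by move=> /orP[/eqP ->//|/IH[? ?]]; split; exact: c2.
    apply: cone_sum => [|i _]; first exact: cD.
    have [De1 De2] := De _ i (mem_enum I i); have [_ _ DZ] := cD (enum I).
    have [x0|x0] := leP 0 (x i); first exact: DZ.
    by rewrite ZNN; apply: DZ => //; rewrite oppr_ge0 ltW.
  elim: (enum I) DT => [//|i r IH DT].
  have [/IH//|DrT] := pselect (D r = setT).
  exists (D r), i; split => // x.
  have : D (i :: r) x by rewrite DT.
  by move=> [a xa]; exists (- a); rewrite scaleNr.
(* If both [e i] and [- e i] belonged to [C1], then [C1] would be the whole space. *)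
have [w [C1w C1w']] : exists w, ~ C1 w /\ forall x, exists a : R, C1 (x + a *: w).
  have [Ce|Ce] := pselect (C1 (e i)); last by exists (e i).
  exists (- e i); split => [Ce'|x].
    apply: C1T; apply/seteqP; split => // x _; have [a xa] := C1s x.
    have [_ CD CZ] := cC1; rewrite -[x](addrK (a *: e i)); apply: CD => //.
    have [a0|a0] := leP 0 a; first by rewrite -scalerN; exact: CZ.
    by rewrite -scaleNr; apply: CZ => //; rewrite oppr_ge0 ltW.
  by have [a xa] := C1s x; exists (- a); rewrite scaleNr scalerN opprK.
have [C2 [cC2 CC2 C2w C2l]] := cone_tilt_lines (enum I) e cC1 C1w C1w'.
have {}C2l j : exists s : R, C2 (e j + s *: w) /\ C2 (- (e j + s *: w)).
  by apply: C2l; rewrite mem_enum.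
have [s sP] := choice C2l; have [_ CD CZ] := cC2.
(* Removing from [x] its components along the lines of [C2] leaves a multiple of [w] which is still
   in [C2]. *)
have nuP x : C2 x -> C2 ((- \sum_j s j * x j) *: w).
  move=> Cx.
  have -> : (- \sum_j s j * x j) *: w = x + \sum_j x j *: - (e j + s j *: w).
    rewrite [X in _ = X + _](xE x) -big_split /= scaleNr scaler_suml -sumrN; apply: eq_bigr => j _.
    by rewrite opprD scalerDr !scalerN addrA subrr add0r scalerA mulrC.
  apply: CD => //; apply: cone_sum => // j _; have [s1 s2] := sP j.
  have [x0|x0] := leP 0 (x j); first exact: CZ.
  by rewrite scalerN -scaleNr; apply: CZ => //; rewrite oppr_ge0 ltW.
exists (fun j => - s j).
  (* If all tilts were zero, [C2] would contain all vectors [e j] and their opposites, hence [w]. *)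
  apply: contrapT => /forallNP s0; apply: C2w.
  have {}s0 j : s j = 0.
    by apply/eqP; rewrite -oppr_eq0; apply/negPn/negP; exact: s0.
  rewrite (xE w); apply: cone_sum => // j _; have := sP j.
  rewrite s0 scale0r addr0 => -[s1 s2].
  have [x0|x0] := leP 0 (w j); first exact: CZ.
  by rewrite ZNN; apply: CZ => //; rewrite oppr_ge0 ltW.
move=> x Cx; have := nuP x (CC2 _ (CC1 _ Cx)).
have -> : \sum_j - s j * x j = - \sum_j s j * x j.
  by rewrite -sumrN; apply: eq_bigr => j _; rewrite mulNr.
set a := - _ => Ca.
rewrite leNgt; apply/negP => a0; apply: C2w.
have -> : w = a^-1 *: (a *: w) by rewrite scalerA mulVf ?lt0r_neq0// scale1r.
by apply: CZ => //; rewrite invr_ge0 ltW.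
Qed.

(** * Right derivatives and Gronwall's inequality *)

Section RightDerivatives.
Context {R : realType}.

Lemma real_induction (P : R -> Prop) (a b : R) : a <= b -> P a ->
  (forall t, a <= t < b -> (forall s, a <= s <= t -> P s) ->
     exists2 e, 0 < e & forall s, t < s < t + e -> P s) ->
  (forall t, a < t <= b -> (forall s, a <= s < t -> P s) -> P t) ->
  forall t, a <= t <= b -> P t.
Proof.
move=> ab Pa Pr Pl.
pose S := [set t | a <= t <= b /\ forall s, a <= s <= t -> P s].
have Sa : S a by split; [rewrite lexx|move=> s /le_anti <-].
have hS : has_sup S by split; [exists a|exists b => t [/andP[]]].
have ac : a <= sup S by exact: ub_le_sup hS.2 _ Sa.
have cb : sup S <= b by apply: ge_sup; [exists a|move=> t [/andP[]]].
have Pc s : a <= s < sup S -> P s.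
  move=> /andP[as_ sc]; have [t [_ tP] st] := sup_adherent (ltr0Sn _ 0 : 0 < 1) hS.
  have [t' [_ t'P] st'] := sup_adherent (etrans (subr_gt0 _ _) sc) hS.
  by apply: t'P; rewrite as_ /= ltW//; move: st'; rewrite opprB addrC subrK.
have Pc' s : a <= s <= sup S -> P s.
  move=> /andP[as_]; rewrite le_eqVlt => /orP[/eqP sE|sc]; last by apply: Pc; rewrite as_.
  have [->//|sa] := eqVneq s a.
  by apply: Pl; [rewrite lt_neqAle eq_sym sa as_ sE cb|rewrite sE].
suff cE : sup S = b by rewrite -cE.
apply/eqP; rewrite eq_le cb leNgt; apply/negP => cb'.
have [|e e0 eP] := Pr (sup S) _ Pc'; first by rewrite ac.
pose d := Num.min (e / 2) (b - sup S).
have d0 : 0 < d by rewrite lt_min divr_gt0//= subr_gt0.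
have de : d < e by rewrite gt_min (_ : e / 2 < e)//; lra.
have db : d <= b - sup S by rewrite ge_min lexx orbT.
have Sd : S (sup S + d).
  split; first by apply/andP; split; lra.
  move=> s /andP[as_ sd]; have [sc|cs] := leP s (sup S); first by apply: Pc'; rewrite as_.
  by apply: eP; rewrite cs /=; lra.
have := ub_le_sup hS.2 Sd; lra.
Qed.

(* A local form of compactness of [[a, b]]. *)
Lemma real_induction_local (P : R -> Prop) (a b : R) : a <= b -> P a ->
  (forall t, a <= t <= b -> exists2 e, 0 < e & forall s s', a <= s -> s' <= b ->
     t - e < s -> s <= t -> t <= s' -> s' < t + e -> P s -> P s') ->
  P b.
Proof.
move=> ab Pa Ploc.
suff H : forall t, a <= t <= b -> P t by apply: H; rewrite ab lexx.
apply: real_induction => // t /andP[at_ tb] Ps.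
  have [|e e0 eP] := Ploc t; first by rewrite at_ ltW.
  exists (Num.min e (b - t)) => [|s]; first by rewrite lt_min e0 subr_gt0.
  move=> /andP[ts]; rewrite -ltrBlDl lt_min => /andP[se sb].
  by apply: (eP t s) => //; [lra|lra|lra|lra|apply: Ps; rewrite at_ lexx].
have [|e e0 eP] := Ploc t; first by rewrite ltW.
pose s := Num.max a (t - e / 2).
have s1 : a <= s by rewrite le_max lexx.
have s2 : t - e < s by rewrite lt_max; apply/orP; right; lra.
have s3 : s < t by rewrite gt_max at_ /=; lra.
by apply: (eP s t) => //; [exact: ltW|lra|apply: Ps; rewrite s1 s3].
Qed.

(** The upper right Dini derivative of [phi] at [t] is at most [d]; [dini_ge] bounds the lower one
    from below. Such bounds apply to norms and to primitives of semicontinuous functions, which need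
    not be differentiable. *)
Definition dini_le (phi : R -> R) t d := forall e, 0 < e ->
  \forall h \near (0 : R)^'+, phi (t + h) - phi t <= h * (d + e).

Definition dini_ge (psi : R -> R) t d := forall e, 0 < e ->
  \forall h \near (0 : R)^'+, h * (d - e) <= psi (t + h) - psi t.

Lemma near0_right (P : R -> Prop) : (\forall h \near (0 : R)^'+, P h) <->
  exists2 e, 0 < e & forall h, 0 < h < e -> P h.
Proof.
split=> [[e /= e0 eP]|[e e0 eP]].
  exists e => // h /andP[h0 he]; apply: eP => //=.
  by rewrite sub0r normrN gtr0_norm.
exists e => //= h /=; rewrite sub0r normrN => he h0; apply: eP.
by rewrite h0 -[h]gtr0_norm.
Qed.

(** For every slope [e > 0], the line of slope [e] through the initial value dominates [phi], by
    real induction: the Dini bound gives the step to the right, continuity the passage to the limit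
    from the left. *)
Lemma dini_nonincreasing (phi : R -> R) (a b : R) : a <= b ->
  (forall t, a <= t <= b -> {for t, continuous phi}) ->
  (forall t, a <= t < b -> dini_le phi t 0) -> phi b <= phi a.
Proof.
move=> ab cphi dphi.
suff key e : 0 < e -> phi b <= phi a + e * (b - a).
  have [->//|ba] := eqVneq b a.
  have ba0 : 0 < b - a by rewrite subr_gt0 lt_neqAle eq_sym ba.
  apply/ler_addgt0Pr => e e0; have := key (e / (b - a)) (divr_gt0 e0 ba0).
  by rewrite divfK// lt0r_neq0.
move=> e0.
apply: (@real_induction (fun t => phi t <= phi a + e * (t - a)) a b) => //.
- by rewrite subrr mulr0 addr0.
- move=> t tab Ps; have /near0_right[d d0 dP] := dphi t tab e e0.
  exists d => // s /andP[ts st].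
  have /dP : 0 < s - t < d by rewrite subr_gt0 ts /= ltrBlDl.
  have := Ps t; rewrite lexx andbT => /(_ (andP tab).1).
  by rewrite (_ : t + (s - t) = s); [rewrite add0r; lra|ring].
- move=> t /andP[at_ tb] Ps.
  have : (fun s => phi s - e * (s - a)) s @[s --> t^'-] --> phi t - e * (t - a).
    apply: cvgB.
      by apply: cvg_at_left_filter; apply: cphi; rewrite tb ltW.
    apply: cvg_at_left_filter; apply: cvgM; first exact: cvg_cst.
    by apply: cvgB; [exact: cvg_id|exact: cvg_cst].
  move=> /cvgr_to_le h; rewrite -lerBlDr; apply: h.
  have ta0 : 0 < t - a by rewrite subr_gt0.
  exists (t - a) => //= s /= sd st; rewrite lerBlDr; apply: Ps.
  rewrite st andbT; move: sd; rewrite gtr0_norm ?subr_gt0//.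
  by rewrite ltrD2l ltrN2 => /ltW.
- by rewrite ab lexx.
Qed.

Section Normed.
Context {E : normedModType R}.
Implicit Types (x y w : R -> E) (t a b L : R).

Definition rderiv x t (v : E) := h^-1 *: (x (t + h) - x t) @[h --> (0 : R)^'+] --> v.

Lemma rderivP x t v : rderiv x t v <-> forall e, 0 < e ->
  \forall h \near (0 : R)^'+, `|x (t + h) - x t - h *: v| <= h * e.
Proof.
have hE h : 0 < h -> `|x (t + h) - x t - h *: v| =
    h * `|v - h^-1 *: (x (t + h) - x t)|.
  move=> h0; transitivity `|h *: (v - h^-1 *: (x (t + h) - x t))|.
    by rewrite scalerBr scalerA divff ?lt0r_neq0// scale1r distrC.
  by rewrite normrZ gtr0_norm.
split=> [/cvgrPdist_le xv e e0|xv]; last apply/cvgrPdist_le => e e0.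
  near=> h; have h0 : 0 < h by near: h; exact: nbhs_right_gt.
  rewrite hE// ler_pM2l//; near: h; exact: xv.
near=> h; have h0 : 0 < h by near: h; exact: nbhs_right_gt.
rewrite -(ler_pM2l h0) -hE//; near: h; exact: xv.
Unshelve. all: by end_near. Qed.

Lemma rderiv_near x y t v : (\forall h \near (0 : R)^'+, x (t + h) = y (t + h)) ->
  x t = y t -> rderiv x t v -> rderiv y t v.
Proof.
move=> xy xyt /rderivP xv; apply/rderivP => e e0.
near=> h; rewrite -xyt -(_ : x (t + h) = y (t + h)); last by near: h.
by near: h; exact: xv.
Unshelve. all: by end_near. Qed.

Lemma rderiv_norm_le x t v : rderiv x t v -> forall e, 0 < e ->
  \forall h \near (0 : R)^'+, `|x (t + h)| <= `|x t| + h * (`|v| + e).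
Proof.
move=> /rderivP xv e e0; near=> h.
have h0 : 0 < h by near: h; exact: nbhs_right_gt.
have he : `|x (t + h) - x t - h *: v| <= h * e by near: h; exact: xv.
rewrite -[x (t + h)](subrK (x t)) -[x (t + h) - x t](subrK (h *: v)).
apply: (le_trans (ler_normD _ _)); rewrite addrC lerD2l.
apply: (le_trans (ler_normD _ _)); rewrite normrZ gtr0_norm//; lra.
Unshelve. all: by end_near. Qed.

Lemma rderivD x y t u v : rderiv x t u -> rderiv y t v ->
  rderiv (fun s => x s + y s) t (u + v).
Proof.
rewrite /rderiv => xu yv.
under eq_fun do rewrite opprD addrACA scalerDr.
exact: cvgD.
Qed.

Lemma rderivN x t u : rderiv x t u -> rderiv (fun s => - x s) t (- u).
Proof.
rewrite /rderiv => xu; under eq_fun do rewrite -opprD scalerN.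
exact: cvgN.
Qed.

Lemma rderivB x y t u v : rderiv x t u -> rderiv y t v ->
  rderiv (fun s => x s - y s) t (u - v).
Proof. by move=> xu yv; apply: rderivD => //; exact: rderivN. Qed.

Lemma rderiv_cst (c : E) t : rderiv (fun=> c) t 0.
Proof.
by rewrite /rderiv; under eq_fun do rewrite subrr scaler0; exact: cvg_cst.
Qed.

Lemma rderiv_affine (c v : E) r t : rderiv (fun s => c + (s - r) *: v) t v.
Proof.
apply/rderivP => e e0; near=> h.
rewrite (_ : _ - _ = 0); first by rewrite normr0 mulr_ge0// ltW.
rewrite opprD addrACA subrr add0r -scalerBl -scalerBl.
by rewrite (_ : t + h - r - (t - r) - h = 0) ?scale0r//; ring.
Unshelve. all: by end_near. Qed.

Lemma rderiv_sum (I : Type) (r : seq I) (x : I -> R -> E) t (v : I -> E) :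
  (forall i, rderiv (x i) t (v i)) ->
  rderiv (fun s => \sum_(i <- r) x i s) t (\sum_(i <- r) v i).
Proof.
move=> xv; elim: r => [|i r IH].
  rewrite big_nil (_ : (fun _ => _) = (fun=> 0)); first exact: rderiv_cst.
  by apply/funext => s; rewrite big_nil.
rewrite big_cons (_ : (fun _ => _) = (fun s => x i s + \sum_(j <- r) x j s)).
  exact: rderivD.
by apply/funext => s; rewrite big_cons.
Qed.

Lemma rderiv_of_derivable x t : derivable x t 1 -> rderiv x t (derive1 x t).
Proof.
have E1 : (fun h => h^-1 *: ((x \o shift t) (h *: 1) - x t)) =
    (fun h => h^-1 *: (x (t + h) - x t)).
  apply/funext => h; congr (_ *: (x _ - _)). by rewrite /= [_ *: 1]mulr1 addrC.
rewrite /rderiv derive1E /derive /derivable E1.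
exact: cvg_dnbhs_at_right.
Qed.

(* The weight [expR (- L * _)] absorbs the linear term, because
   [expR (- L * h) <= (1 + L * h)^-1]. *)
Lemma gronwall w (psi : R -> R) L a b : 0 <= L -> a <= b ->
  (forall t, a <= t <= b -> {for t, continuous w}) ->
  (forall t, a <= t <= b -> {for t, continuous psi}) ->
  (forall t, a <= t < b -> exists v d, [/\ rderiv w t v, dini_ge psi t d,
     0 <= d & `|v| <= L * `|w t| + d]) ->
  `|w b| <= expR (L * (b - a)) * (`|w a| + (psi b - psi a)).
Proof.
move=> L0 ab cw cpsi dw.
(* Subtracting [psi] absorbs the inhomogeneous term [d], so that [phi] has a nonpositive upper Dini
   derivative. *)
pose phi t := expR (- (L * (t - a))) * `|w t| - psi t.
suff : phi b <= phi a.
  rewrite /phi subrr mulr0 oppr0 expR0 mul1r => h.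
  rewrite -ler_pdivrMl ?expR_gt0// -expRN; lra.
apply: dini_nonincreasing => // [t tab|t tab e e0].
  apply: cvgB; last exact: cpsi.
  apply: cvgM; last by apply: cvg_norm; exact: cw.
  apply: (@cvg_comp _ _ _ (fun s => - (L * (s - a))) expR); last exact: continuous_expR.
  apply: cvgN; apply: cvgM; first exact: cvg_cst.
  by apply: cvgB; [exact: cvg_id|exact: cvg_cst].
have [v [d [wv psid d0 vd]]] := dw t tab.
have e2 : 0 < e / 2 by rewrite divr_gt0.
near=> h.
have h0 : 0 < h by near: h; exact: nbhs_right_gt.
have w1 : `|w (t + h)| <= `|w t| + h * (`|v| + e / 2).
  by near: h; exact: rderiv_norm_le.
have psi1 : h * (d - e / 2) <= psi (t + h) - psi t by near: h; exact: psid.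
rewrite /phi add0r.
have -> : - (L * (t + h - a)) = - (L * (t - a)) + - (L * h) by ring.
rewrite expRD -mulrA; set E0 := expR (- (L * (t - a))).
have E01 : E0 <= 1.
  rewrite -expR0 ler_expR oppr_le0 mulr_ge0// subr_ge0.
  by case/andP: tab.
have E00 : 0 < E0 by exact: expR_gt0.
have Lh0 : 0 <= L * h by rewrite mulr_ge0// ltW.
have hd0 : 0 <= h * (d + e / 2) by rewrite mulr_ge0 ?addr_ge0// ltW.
have w2 : expR (- (L * h)) * `|w (t + h)| <= `|w t| + h * (d + e / 2).
  rewrite expRN ler_pdivrMl ?expR_gt0//.
  have X : 1 + L * h <= expR (L * h) by exact: expR_ge1Dx.
  apply: (@le_trans _ _ ((1 + L * h) * (`|w t| + h * (d + e / 2)))).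
    apply: (le_trans w1).
    have := ler_wpM2l (ltW h0) vd.
    have : 0 <= L * h * (h * (d + e / 2)) by rewrite mulr_ge0.
    by rewrite !mulrDr !mulrDl; nra.
  by rewrite ler_wpM2r// addr_ge0.
have w3 := ler_wpM2l (ltW E00) w2.
have : E0 * (h * (d + e / 2)) <= h * (d + e / 2).
  by rewrite ler_piMl.
rewrite mulrDr in w3; rewrite !mulrDr in psi1 *; lra.
Unshelve. all: by end_near. Qed.

Lemma dini_ge_affine c a0 t : dini_ge (fun s => c * (s - a0)) t c.
Proof.
move=> e e0; near=> h.
have h0 : 0 < h by near: h; exact: nbhs_right_gt.
rewrite [leRHS](_ : _ = h * c); last by ring.
by rewrite ler_pM2l// gerBl ltW.
Unshelve. all: by end_near. Qed.

Lemma rderiv_mvi x a b C : 0 <= C -> a <= b ->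
  (forall t, a <= t <= b -> {for t, continuous x}) ->
  (forall t, a <= t < b -> exists2 v, rderiv x t v & `|v| <= C) ->
  `|x b - x a| <= C * (b - a).
Proof.
move=> C0 ab cx dx.
have := @gronwall (fun t => x t - x a) (fun t => C * (t - a)) 0 a b (lexx 0) ab.
rewrite mul0r expR0 mul1r !subrr normr0 mulr0 subr0 add0r; apply.
- by move=> t tab; apply: cvgB; [exact: cx|exact: cvg_cst].
- move=> t _; apply: cvgM; first exact: cvg_cst.
  by apply: cvgB; [exact: cvg_id|exact: cvg_cst].
- move=> t tab; have [v xv vC] := dx t tab; exists v, C; split => //.
  + by rewrite -[v]subr0; apply: rderivB => //; exact: rderiv_cst.
  + exact: dini_ge_affine.
  + by rewrite mul0r add0r.
Qed.

End Normed.
End RightDerivatives.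

(** * Cadlag functions and ordinary differential equations *)

Section Cadlag.
Context {R : realType}.

Lemma near_right (t : R) (P : R -> Prop) : (\forall r \near t^'+, P r) <->
  exists2 e, 0 < e & forall r, t < r < t + e -> P r.
Proof.
split=> [[e /= e0 eP]|[e e0 eP]].
  exists e => // r /andP[tr re]; apply: eP => //=.
  by rewrite distrC gtr0_norm ?subr_gt0// ltrBlDl.
exists e => //= r /= re tr; apply: eP; rewrite tr /=.
by move: re; rewrite distrC gtr0_norm ?subr_gt0// ltrBlDl.
Qed.

Lemma near_left (t : R) (P : R -> Prop) : (\forall r \near t^'-, P r) <->
  exists2 e, 0 < e & forall r, t - e < r < t -> P r.
Proof.
split=> [[e /= e0 eP]|[e e0 eP]].
  exists e => // r /andP[re rt]; apply: eP => //=.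
  by rewrite gtr0_norm ?subr_gt0// ltrBlDl -ltrBlDr.
exists e => //= r /= re rt; apply: eP; rewrite rt andbT.
by move: re; rewrite gtr0_norm ?subr_gt0// ltrBlDl -ltrBlDr.
Qed.

(** Left limits have to lie in [U], because they are used as control values and [f] is continuous
    only there. *)
Definition cadlag {Z : topologicalType} (T : R) (U : set Z) (u : R -> Z) :=
  [/\ forall t, 0 <= t <= T -> U (u t),
      forall t, 0 <= t < T -> u r @[r --> t^'+] --> u t &
      forall t, 0 < t <= T -> exists2 z, U z & u r @[r --> t^'-] --> z].

(** Composition with [clamp T] extends a function on [[0, T]] by its end values, so that continuity
    on the interval becomes continuity on the line. *)
Definition clamp (T t : R) : R := Num.max 0 (Num.min t T).

Lemma clamp_itv T t : 0 <= T -> 0 <= clamp T t <= T.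
Proof. by move=> T0; rewrite le_max lexx /= ge_max T0 ge_min lexx orbT. Qed.

Lemma clamp_id T t : 0 <= t <= T -> clamp T t = t.
Proof.
by move=> /andP[t0 tT]; rewrite /clamp (min_idPl _)//; apply/max_idPr.
Qed.

Lemma clamp_continuous T : continuous (clamp T).
Proof.
move=> t; apply: (@continuous_max R R (fun=> 0) (fun t => Num.min t T) t).
  exact: cvg_cst.
by apply: (@continuous_min R R id (fun=> T) t); [exact: cvg_id|exact: cvg_cst].
Qed.

Lemma continuous_segment_bounded (phi : R -> R) T : 0 <= T ->
  (forall t, {for t, continuous phi}) ->
  exists2 c, 0 <= c & forall t, 0 <= t <= T -> phi t <= c.
Proof.
move=> T0 cphi.
have [|c _ cP] := @EVT_max R phi 0 T T0.
  by apply: continuous_subspaceT => t; exact: cphi.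
exists (Num.max 0 (phi c)) => [|t tT]; first by rewrite le_max lexx.
by rewrite le_max cP ?orbT// in_itv.
Qed.

End Cadlag.

Section Primitive.
Context {R : realType} {E : completeNormedModType R}.
Implicit Types (x y : R -> E) (T t K e : R).

Definition approx_primitive T (phi : R -> E) e y :=
  continuous y /\ forall t, 0 <= t < T -> exists2 v, rderiv y t v & `|v - phi t| <= e.

Lemma div_expr2_cvg0 (c : R) : c / 2 ^+ n @[n --> \oo] --> 0.
Proof.
rewrite (_ : (fun n => _) = (fun n => c * 2^-1 ^+ n)); last first.
  by apply/funext => n; rewrite exprVn.
have : c * 2^-1 ^+ n @[n --> \oo] --> c * 0.
  by apply: cvgM; [exact: cvg_cst|apply: cvg_expr; rewrite ger0_norm; lra].
by rewrite mulr0.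
Qed.

Lemma uniform_geometric_limit T (y : nat -> R -> E) K : 0 <= T -> 0 <= K ->
  (forall n, continuous (y n)) ->
  (forall n t, 0 <= t <= T -> `|y n.+1 t - y n t| <= K / 2 ^+ n) ->
  exists2 x, continuous x &
    forall n t, 0 <= t <= T -> `|y n t - x t| <= 2 * K / 2 ^+ n.
Proof.
move=> T0 K0 cy yK; pose z n t := y n (clamp T t).
(* The right-hand side is the geometric sum of the bounds [K / 2 ^+ i] for [n <= i < n + m]. *)
have zK n m t : `|z (n + m)%N t - z n t| <= 2 * K / 2 ^+ n - 2 * K / 2 ^+ (n + m).
  elim: m => [|m IH]; first by rewrite addn0 !subrr normr0.
  rewrite addnS -(subrK (z (n + m)%N t) (z (n + m).+1 t)) -addrA.
  apply: (le_trans (ler_normD _ _)).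
  have := yK (n + m)%N (clamp T t) (clamp_itv _ T0).
  have -> : 2 * K / 2 ^+ (n + m).+1 = K / 2 ^+ (n + m).
    by rewrite exprS; field; rewrite expf_neq0.
  rewrite /z; move: IH; rewrite /z.
  have -> : 2 * K / 2 ^+ (n + m) = K / 2 ^+ (n + m) + K / 2 ^+ (n + m) by ring.
  lra.
have pow0 n : 0 <= 2 * K / 2 ^+ n by rewrite divr_ge0// ?mulr_ge0// exprn_ge0.
have zK' n m t : (n <= m)%N -> `|z m t - z n t| <= 2 * K / 2 ^+ n.
  by move=> nm; rewrite -(subnKC nm); have := zK n (m - n)%N t; have := pow0 (n + (m - n))%N; lra.
have small e : 0 < e -> exists n, forall m, (n <= m)%N -> 2 * K / 2 ^+ m < e.
  move=> e0.
  have /cvgr0_norm_lt/(_ e e0)[n _ nP] := div_expr2_cvg0 (2 * K).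
  by exists n => m nm; have := nP m nm; rewrite /= ger0_norm.
have zcvg t : cvgn (z ^~ t).
  apply/cauchy_cvgP/cauchy_ballP => e e0.
  have [n nP] := small _ (divr_gt0 e0 (ltr0Sn _ 1)).
  pose A := [set z m t | m in [set m | (n <= m)%N]].
  exists (A, A); first by split; exists n => // m nm; exists m.
  move=> [_ _] /= [[i ni <-] [j nj <-]]; rewrite -ball_normE /=.
  rewrite -(subrKA (z n t)) (le_lt_trans (ler_normD _ _))//.
  rewrite [`|z n t - _|]distrC.
  by have := zK' n i t ni; have := zK' n j t nj; have := nP n (leqnn n); lra.
pose x t := limn (z ^~ t).
have zx n t : `|z n t - x t| <= 2 * K / 2 ^+ n.
  have : `|z n t - z m t| @[m --> \oo] --> `|z n t - x t|.
    by apply: cvg_norm; apply: cvgB; [exact: cvg_cst|exact: zcvg].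
  move=> /cvgr_to_le; apply; exists n => // m /= nm.
  by rewrite distrC zK'.
exists x => [t|n t tT]; last by have := zx n t; rewrite /z clamp_id.
apply/cvgrPdist_lt => e e0.
have [n nP] := small _ (divr_gt0 e0 (ltr0Sn _ 2)).
have zc : {for t, continuous (z n)}.
  by apply: continuous_comp; [exact: clamp_continuous|exact: cy].
have e3 : 0 < e / 3 by rewrite divr_gt0.
near=> s.
have h1 : `|z n t - z n s| < e / 3.
  by near: s; move/cvgrPdist_lt : zc; apply.
have -> : x t - x s = - (z n t - x t) + ((z n t - z n s) + (z n s - x s)).
  by rewrite opprB !subrKA.
apply: (le_lt_trans (ler_normD _ _)); rewrite normrN.
have := ler_normD (z n t - z n s) (z n s - x s).
have := zx n t; have := zx n s; have := nP n (leqnn n); lra.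
Unshelve. all: by end_near. Qed.

(** On [[t, t + h]], the mean value inequality is applied to [y n] minus the affine function of
    slope [phi t]. The estimate does not involve the derivative of the limit, so it survives as [n]
    grows. *)
Lemma approx_primitive_limit T (phi : R -> E) (y : nat -> R -> E) (x : R -> E) (e : nat -> R) :
  (forall t, 0 <= t < T -> phi r @[r --> t^'+] --> phi t) ->
  (forall n, approx_primitive T phi (e n) (y n)) ->
  (e n @[n --> \oo] --> 0) ->
  (forall t, 0 <= t <= T -> y n t @[n --> \oo] --> x t) ->
  forall t, 0 <= t < T -> rderiv x t (phi t).
Proof.
move=> cphi yphi e0 yx t tT; apply/rderivP => d d0.
have /near_right[r r0 rP] : \forall s \near t^'+, `|phi t - phi s| <= d / 2.
  by apply: cvgr_dist_le; [exact: cphi|rewrite divr_gt0].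
have /andP[t0 tT'] := tT.
near=> h.
have h0 : 0 < h by near: h; exact: nbhs_right_gt.
have hr : h < r by near: h; exact: nbhs_right_lt.
have hT : h < T - t by near: h; apply: nbhs_right_lt; rewrite subr_gt0.
have bound n : `|y n (t + h) - y n t - h *: phi t| <= (`|e n| + d / 2) * h.
  have [cy dy] := yphi n.
  have th : t + h - t = h by ring.
  pose g s := y n s - (0 + (s - t) *: phi t).
  have -> : y n (t + h) - y n t - h *: phi t = g (t + h) - g t.
    by rewrite /g !add0r subrr scale0r subr0 th addrAC.
  rewrite -[X in _ <= _ * X]th; apply: rderiv_mvi.
  - by rewrite addr_ge0// divr_ge0// ltW.
  - by rewrite lerDl ltW.
  - move=> s _; apply: cvgB; first exact: cy.
    apply: cvgD; first exact: cvg_cst.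
    by apply: cvgZl; apply: cvgB; [exact: cvg_id|exact: cvg_cst].
  - move=> s /andP[ts sh]; have [|v yv vphi] := dy s; first by apply/andP; split; lra.
    exists (v - phi t); first by apply: rderivB => //; exact: rderiv_affine.
    rewrite -(subrKA (phi s)); apply: (le_trans (ler_normD _ _)); apply: lerD.
      by apply: (le_trans vphi); exact: ler_norm.
    rewrite distrC; have [->|st] := eqVneq s t; first by rewrite subrr normr0 divr_ge0// ltW.
    by apply: rP; rewrite lt_neqAle eq_sym st ts /=; lra.
have lim1 : `|y n (t + h) - y n t - h *: phi t| @[n --> \oo] -->
    `|x (t + h) - x t - h *: phi t|.
  apply: cvg_norm; apply: cvgB; last exact: cvg_cst.
  by apply: cvgB; apply: yx; apply/andP; split; lra.
have {e0}[n _ en] : \forall n \near \oo, `|e n| <= d / 2.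
  by apply: cvgr0_norm_le => //; rewrite divr_gt0.
apply: (cvgr_to_le lim1); exists n => // m /= nm.
apply: (le_trans (bound m)); rewrite mulrC ler_pM2l//.
by have := en m nm; lra.
Unshelve. all: by end_near. Qed.

(** On either side of a time, a cadlag function is within [e] of its one-sided limit, so an
    approximate primitive can be continued by an affine piece; local real induction reaches [T]. *)
Lemma approx_primitive_exists T (phi : R -> E) e : 0 <= T -> 0 < e ->
  cadlag T setT phi -> exists2 y, y 0 = 0 & approx_primitive T phi e y.
Proof.
move=> T0 e0 [_ cr cl].
pose P t := exists2 y, y 0 = 0 & approx_primitive t phi e y.
have ext s s' v : 0 <= s -> s <= s' -> (forall r, s <= r < s' -> `|v - phi r| <= e) ->
    P s -> P s'.
  move=> s0 ss' vphi [y y0 [cy dy]].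
  exists (fun r => y (Num.min r s) + (Num.max r s - s) *: v).
    by rewrite (min_idPl s0) (max_idPr s0) subrr scale0r addr0.
  split=> [r|r /andP[r0 rs']].
    apply: cvgD.
      apply: continuous_comp; last exact: cy.
      by apply: (@continuous_min R R id (fun=> s) r); [exact: cvg_id|exact: cvg_cst].
    apply: cvgZl; apply: cvgB; last exact: cvg_cst.
    by apply: (@continuous_max R R id (fun=> s) r); [exact: cvg_id|exact: cvg_cst].
  have [sr|rs] := leP s r.
    exists v; last by apply: vphi; rewrite sr.
    apply: (@rderiv_near _ _ (fun r => y s + (r - s) *: v)); last exact: rderiv_affine.
      near=> h; have h0 : 0 < h by near: h; exact: nbhs_right_gt.
      by rewrite (min_idPr _) ?(max_idPl _)//; lra.
    by rewrite (min_idPr sr) (max_idPl sr).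
  have [|u yu uphi] := dy r; first by rewrite r0.
  exists u => //; apply: rderiv_near yu.
    near=> h; have h0 : h < s - r by near: h; apply: nbhs_right_lt; rewrite subr_gt0.
    by rewrite (min_idPl _) ?(max_idPr _) ?subrr ?scale0r ?addr0//; lra.
  by rewrite (min_idPl _) ?(max_idPr _) ?subrr ?scale0r ?addr0// ltW.
suff : P T by [].
apply: (@real_induction_local _ P 0 T T0).
  exists (fun=> 0) => //; split=> [t|t]; first exact: cvg_cst.
  by move=> /andP[/le_lt_trans /[apply]]; rewrite ltxx.
move=> t /andP[t0 tT].
have [d d0 dP] : exists2 d, 0 < d & forall s, 0 <= s -> t - d < s -> s <= t -> P s -> P t.
  have [tE|t_neq0] := eqVneq t 0.
    by exists 1 => // s s0 _; rewrite tE => s1; rewrite (@le_anti _ _ s 0) ?s0 ?s1.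
  have tp : 0 < t by rewrite lt_neqAle eq_sym t_neq0.
  have [|z _ zP] := cl t; first by rewrite tp.
  have /near_left[d d0 dP] : \forall s \near t^'-, `|z - phi s| <= e by exact: cvgr_dist_le.
  exists d => // s s0 ds st; apply: (ext _ _ z) => // r /andP[sr rt].
  by apply: dP; rewrite rt andbT (lt_le_trans ds).
have [d' d'0 d'P] : exists2 d, 0 < d & forall s, s <= T -> t <= s -> s < t + d -> P t -> P s.
  have [tT'|Tt] := ltP t T; last first.
    by exists 1 => // s sT ts _; rewrite (@le_anti _ _ s t)// ts (le_trans sT).
  have /near_right[d' d0' dP'] : \forall s \near t^'+, `|phi t - phi s| <= e.
    by apply: cvgr_dist_le => //; apply: cr; rewrite t0.
  exists d' => // s sT ts sd; apply: (ext _ _ (phi t)) => // r /andP[tr rs].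
  have [->|rt] := eqVneq r t; first by rewrite subrr normr0 ltW.
  by apply: dP'; rewrite lt_neqAle eq_sym rt tr (lt_trans rs).
exists (Num.min d d') => [|s s' s0 s'T]; first by rewrite lt_min d0.
rewrite ltrBlDr -ltrBlDl lt_min => /andP[h1 h2] st ts'.
rewrite -ltrBlDl lt_min => /andP[h3 h4] Ps.
apply: d'P => //; first lra.
by apply: (dP s) => //; lra.
Unshelve. all: by end_near. Qed.

(** This takes the place of an integral with values in a Banach space: approximate primitives with
    errors [2 ^- n] converge uniformly by the mean value inequality. *)
Lemma primitive_exists T (phi : R -> E) : 0 <= T -> cadlag T setT phi ->
  exists x, [/\ continuous x, x 0 = 0 & forall t, 0 <= t < T -> rderiv x t (phi t)].
Proof.
move=> T0 cphi.
have pos n : (0 : R) < (2 ^+ n)^-1 by rewrite invr_gt0 exprn_gt0.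
have [y yP] := choice (fun n => let: ex_intro2 y a b :=
  approx_primitive_exists T0 (pos n) cphi in ex_intro _ y (conj a b)).
have dist n t : 0 <= t <= T -> `|y n.+1 t - y n t| <= (2 * T) / 2 ^+ n.
  move=> /andP[t0 tT].
  have [y0 [cy dy]] := yP n; have [y0' [cy' dy']] := yP n.+1.
  have := @rderiv_mvi R E (fun s => y n.+1 s - y n s) 0 t (2 / 2 ^+ n).
  rewrite y0 y0' !subr0 => h; apply: le_trans (h _ t0 _ _) _.
  - by rewrite divr_ge0// exprn_ge0.
  - by move=> s _; apply: cvgB; [exact: cy'|exact: cy].
  - move=> s /andP[s0 st]; have sT : 0 <= s < T by rewrite s0 (lt_le_trans st).
    have [v yv vphi] := dy s sT; have [v' yv' vphi'] := dy' s sT.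
    exists (v' - v); first exact: rderivB.
    rewrite -(subrKA (phi s)) (le_trans (ler_normD _ _))// [`|phi s - v|]distrC.
    have : (2 ^+ n.+1)^-1 <= (2 ^+ n)^-1 :> R.
      by rewrite lef_pV2 ?posrE ?exprn_gt0// exprS ler_peMl ?exprn_ge0//; lra.
    lra.
  rewrite mulrAC ler_wpM2r ?invr_ge0 ?exprn_ge0//; lra.
have [||x cx xP] := uniform_geometric_limit T0 _ _ dist.
- by rewrite mulr_ge0.
- by move=> n; have [_ []] := yP n.
have ycvg t : 0 <= t <= T -> y n t @[n --> \oo] --> x t.
  move=> tT; apply/cvgrPdist_le => e e0.
  have /cvgr0_norm_le/(_ e e0) := div_expr2_cvg0 (2 * (2 * T)).
  apply: filterS => n h; rewrite distrC (le_trans (xP n t tT))//.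
  by rewrite (le_trans _ h)// ler_norm.
exists x; split => //.
  have h0 : y n 0 @[n --> \oo] --> x 0 by apply: ycvg; rewrite lexx.
  have h1 : y n 0 @[n --> \oo] --> (0 : E).
    rewrite (_ : (fun n => y n 0) = (fun=> 0)); first exact: cvg_cst.
    by apply/funext => n; have [] := yP n.
  exact: cvg_unique h0 h1.
have [_ cr _] := cphi.
apply: (approx_primitive_limit (y := y) (e := fun n => (2 ^+ n)^-1)) => //.
  by move=> n; have [] := yP n.
by have := div_expr2_cvg0 (1 : R); under eq_fun do rewrite mul1r.
Qed.

(** Picard iteration converges on all of [[0, T]] at once, because it halves distances measured with
    the weight [expR (2 * L * t)]. The bound [dist] records this, Gronwall's inequality being used
    with constant zero. *)
Lemma cauchy_lipschitz T L (F : R -> E -> E) (xi : E) : 0 <= T -> 0 <= L ->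
  (forall t u v, 0 <= t < T -> `|F t u - F t v| <= L * `|u - v|) ->
  (forall x, continuous x -> cadlag T setT (fun t => F t (x t))) ->
  exists x, [/\ continuous x, x 0 = xi & forall t, 0 <= t < T -> rderiv x t (F t (x t))].
Proof.
move=> T0 L0 FL Fc.
have step (x : {x : R -> E | continuous x}) : exists y : {y : R -> E | continuous y},
    sval y 0 = xi /\ forall t, 0 <= t < T -> rderiv (sval y) t (F t (sval x t)).
  have [y [cy y0 dy]] := primitive_exists T0 (Fc _ (svalP x)).
  have cy' : continuous (fun t => xi + y t) by move=> t; apply: cvgD; [exact: cvg_cst|exact: cy].
  exists (exist _ _ cy'); split => /= [|t tT]; first by rewrite y0 addr0.
  by rewrite -[F _ _]add0r; apply: rderivD; [exact: rderiv_cst|exact: dy].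
have [Phi PhiP] := choice step.
have cst : continuous (fun _ : R => xi) by move=> t; exact: cvg_cst.
pose X n := iter n Phi (exist _ _ cst).
pose x n := sval (X n).
have cx n : continuous (x n) by exact: svalP (X n).
have x0 n : x n 0 = xi by case: n => //= n; exact: (PhiP _).1.
have dx n t : 0 <= t < T -> rderiv (x n.+1) t (F t (x n t)) by exact: (PhiP (X n)).2.
have [c c0 cP] : exists2 c, 0 <= c & forall t, 0 <= t <= T -> `|x 1%N t - x 0%N t| <= c.
  apply: continuous_segment_bounded => // t; apply: cvg_norm; apply: cvgB; exact: cx.
have dist n t : 0 <= t <= T -> `|x n.+1 t - x n t| <= c / 2 ^+ n * expR (2 * L * t).
  elim: n t => [|n IH] t tT.
    have /andP[t0 _] := tT; rewrite expr0 divr1 (le_trans (cP t tT))// ler_peMr//.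
    by rewrite -expR0 ler_expR mulr_ge0// mulr_ge0.
  have /andP[t0 tT'] := tT.
  have c'0 : 0 <= c / 2 ^+ n.+1 by rewrite divr_ge0// exprn_ge0.
  have := @gronwall R E (fun s => x n.+2 s - x n.+1 s)
    (fun s => c / 2 ^+ n.+1 * expR (2 * L * s)) 0 0 t (lexx 0) t0.
  rewrite mul0r expR0 mul1r !x0 subrr normr0 add0r => h; apply: le_trans (h _ _ _) _.
  - by move=> s _; apply: cvgB; exact: cx.
  - move=> s _; apply: cvgM; first exact: cvg_cst.
    apply: (@cvg_comp _ _ _ (fun s => 2 * L * s) expR); last exact: continuous_expR.
    by apply: cvgM; [exact: cvg_cst|exact: cvg_id].
  - move=> s /andP[s0 st]; have sT : 0 <= s < T by rewrite s0 (lt_le_trans st).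
    exists (F s (x n.+1 s) - F s (x n s)), (2 * L * (c / 2 ^+ n.+1 * expR (2 * L * s))).
    split.
    + by apply: rderivB; exact: dx.
    + move=> e e0; near=> r.
      have r0 : 0 < r by near: r; exact: nbhs_right_gt.
      have -> : expR (2 * L * (s + r)) = expR (2 * L * s) * expR (2 * L * r).
        by rewrite mulrDr expRD.
      move: (expR_ge0 (2 * L * s)) c'0 (expR_ge1Dx (2 * L * r)).
      move: (expR _) (expR _) (c / _) => p B a p0 a0.
      move=> /(ler_wpM2l (mulr_ge0 a0 p0)).
      have : 0 <= r * e by rewrite mulr_ge0// ltW.
      lra.
    + by rewrite !mulr_ge0// expR_ge0.
    + have sT' : 0 <= s <= T by rewrite s0 (le_trans (ltW st)).
      rewrite mul0r add0r (le_trans (FL _ _ _ sT))// (le_trans (ler_wpM2l L0 (IH s sT')))//.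
      rewrite exprS le_eqVlt; apply/orP; left; apply/eqP; field.
      by rewrite expf_neq0.
  by rewrite mulr0 expR0 gerBl mulr1.
pose K := c * expR (2 * L * T).
have K0 : 0 <= K by rewrite mulr_ge0// expR_ge0.
have [|z cz zP] := @uniform_geometric_limit T x K T0 K0 cx.
  move=> n t tT; apply: (le_trans (dist n t tT)); rewrite /K mulrAC.
  rewrite ler_wpM2r ?invr_ge0 ?exprn_ge0// ler_wpM2l// ler_expR.
  by have /andP[_ ?] := tT; rewrite ler_wpM2l// mulr_ge0.
have xcvg t : 0 <= t <= T -> x n t @[n --> \oo] --> z t.
  move=> tT; apply/cvgrPdist_le => e e0.
  have /cvgr0_norm_le/(_ e e0) := div_expr2_cvg0 (2 * K).
  apply: filterS => n h; rewrite distrC (le_trans (zP n t tT))//.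
  by rewrite (le_trans _ h)// ler_norm.
exists z; split => //.
  have h0 : x n 0 @[n --> \oo] --> z 0 by apply: xcvg; rewrite lexx.
  have h1 : x n 0 @[n --> \oo] --> xi.
    rewrite (_ : (fun n => x n 0) = (fun=> xi)); first exact: cvg_cst.
    by apply/funext => n; exact: x0.
  exact: cvg_unique h0 h1.
have [_ cr _] := Fc _ cz.
apply: (approx_primitive_limit (y := fun n => x n.+1) (e := fun n => L * (2 * K) / 2 ^+ n)) => //.
  move=> n; split=> [|t tT]; first exact: cx.
  have tT' : 0 <= t <= T by have /andP[-> /ltW] := tT.
  exists (F t (x n t)); first exact: dx.
  by rewrite (le_trans (FL _ _ _ tT))// -mulrA ler_wpM2l// zP.
  exact: div_expr2_cvg0.
by move=> t tT; rewrite (@cvg_shiftS _ (x ^~ t)); exact: xcvg.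
Unshelve. all: by end_near. Qed.

End Primitive.

(** * Bounded linear maps and resolvents *)

Section BoundedBilinear.
Context {R : realType} {E F G : normedModType R}.

Definition bounded_bilinear (B : E -> F -> G) :=
  [/\ forall v, linear (B ^~ v), forall u, linear (B u) &
      exists2 C : R, 0 <= C & forall u v, `|B u v| <= C * `|u| * `|v|].

Lemma linear_sub {V W : lmodType R} (f : V -> W) u v : linear f -> f (u - v) = f u - f v.
Proof. by move=> lf; rewrite addrC -scaleN1r lf scaleN1r addrC. Qed.

Lemma linear_scale {V W : lmodType R} (f : V -> W) a u : linear f -> f (a *: u) = a *: f u.
Proof.
move=> lf; have f0 : f 0 = 0 by rewrite -(subrr 0) linear_sub// subrr.
by rewrite -[a *: u]addr0 lf f0 addr0.
Qed.

Lemma cvg_bilinear {T : Type} {Fi : set_system T} {FF : Filter Fi} (B : E -> F -> G)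
    (x : T -> E) (y : T -> F) u v : bounded_bilinear B ->
  x @ Fi --> u -> y @ Fi --> v -> B (x t) (y t) @[t --> Fi] --> B u v.
Proof.
move=> [lB rB [C C0 BC]] xu yv; apply/cvgrPdist_le => e e0.
have : C * `|u - x t| * `|y t| + C * `|u| * `|v - y t| @[t --> Fi] -->
    C * `|u - u| * `|v| + C * `|u| * `|v - v|.
  apply: cvgD; apply: cvgM.
  - apply: cvgM; [exact: cvg_cst|apply: cvg_norm; apply: cvgB => //; exact: cvg_cst].
  - exact: cvg_norm.
  - exact: cvg_cst.
  - apply: cvg_norm; apply: cvgB => //; exact: cvg_cst.
rewrite !subrr !normr0 mulr0 mul0r mulr0 addr0 => /cvgr0_norm_le/(_ e e0).
apply: filterS => t te.
have -> : B u v - B (x t) (y t) = B (u - x t) (y t) + B u (v - y t).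
  by rewrite (linear_sub _ _ (lB _)) (linear_sub _ _ (rB _)) [RHS]addrC subrKA.
apply: le_trans te; apply: (le_trans (ler_normD _ _)); apply: le_trans (ler_norm _).
by apply: lerD.
Qed.

Lemma rderiv_cvg {V : normedModType R} (x : R -> V) t v :
  rderiv x t v -> x (t + h) @[h --> 0^'+] --> x t.
Proof.
move=> xv.
have h0 : h *: (h^-1 *: (x (t + h) - x t)) @[h --> (0 : R)^'+] --> 0 *: v.
  by apply: cvgZ => //; apply: cvg_at_right_filter; exact: cvg_id.
have : x t + h *: (h^-1 *: (x (t + h) - x t)) @[h --> (0 : R)^'+] --> x t + 0 *: v.
  by apply: cvgD => //; exact: cvg_cst.
rewrite scale0r addr0; apply: cvg_trans; apply: near_eq_cvg; near=> h.
rewrite scalerA divff ?scale1r ?subrKC// lt0r_neq0//.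
Unshelve. all: by end_near. Qed.

Lemma rderiv_bilinear (B : E -> F -> G) (x : R -> E) (y : R -> F) t u v :
  bounded_bilinear B -> rderiv x t u -> rderiv y t v ->
  rderiv (fun s => B (x s) (y s)) t (B u (y t) + B (x t) v).
Proof.
move=> bB xu yv; have [lB rB _] := bB.
have : B (h^-1 *: (x (t + h) - x t)) (y (t + h)) +
    B (x t) (h^-1 *: (y (t + h) - y t)) @[h --> (0 : R)^'+] -->
    B u (y t) + B (x t) v.
  apply: cvgD; apply: cvg_bilinear => //; first exact: rderiv_cvg yv.
  exact: cvg_cst.
apply: cvg_trans; rewrite /rderiv; apply: near_eq_cvg; near=> h.
rewrite (linear_scale _ _ (lB _)) (linear_scale _ _ (rB _)) -scalerDr.
by rewrite (linear_sub _ _ (lB _)) (linear_sub _ _ (rB _)) subrKA.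
Unshelve. all: by end_near. Qed.

End BoundedBilinear.

Section BoundedLinear.
Context {R : realType}.

Lemma blinE {X Y : normedModType R} (D D' : blin X Y) : D =1 D' -> D = D'.
Proof. by move=> DD'; apply/val_inj/funext. Qed.

Lemma blin_normP {X Y : normedModType R} (D : blin X Y) x : `|D x| <= `|D| * `|x|.
Proof. exact: opnorm_le_bound. Qed.

Lemma blin_norm_le {X Y : normedModType R} (D : blin X Y) c : 0 <= c ->
  (forall x, `|D x| <= c * `|x|) -> `|D| <= c.
Proof.
move=> c0 Dc; apply: opnorm_le => x x1; apply: (le_trans (Dc x)).
by rewrite ler_piMr.
Qed.

Lemma blin_of_bound {X Y : normedModType R} (f : X -> Y) c : linear f ->
  (forall x, `|f x| <= c * `|x|) -> exists D : blin X Y, D =1 f.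
Proof.
move=> lf fc.
have cf : continuous f.
  move=> x; apply/cvgrPdist_le => e e0.
  have cid : (fun y : X => y) @ x --> x by exact: cvg_id.
  have d0 : 0 < e / (`|c| + 1) by rewrite divr_gt0// ltr_wpDl.
  have /cvgrPdist_lt/(_ _ d0) xd := cid.
  near=> y; rewrite -linear_sub//; apply: (le_trans (fc _)).
  have h : `|x - y| < e / (`|c| + 1).
    by near: y.
  apply: (@le_trans _ _ ((`|c| + 1) * `|x - y|)).
    by rewrite ler_wpM2r// (le_trans (ler_norm c))// lerDl.
  by rewrite mulrC -ler_pdivlMr ?ltr_wpDl// ltW.
have fP : f \in @clinear_pred R X Y by rewrite inE.
by exists (Blin fP).
Unshelve. all: by end_near. Qed.

Definition blin_comp_fun {X Y Z : normedModType R} (D : blin Y Z) (D' : blin X Y) :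
  X -> Z := fun x => D (D' x).

Lemma blin_comp_subproof {X Y Z : normedModType R} (D : blin Y Z) (D' : blin X Y) :
  blin_comp_fun D D' \in @clinear_pred R X Z.
Proof.
rewrite inE; split => [a u v|x]; first by rewrite /blin_comp_fun !linearP.
by apply: continuous_comp; exact: blin_continuous.
Qed.

Definition blin_comp {X Y Z : normedModType R} (D : blin Y Z) (D' : blin X Y) :
  blin X Z := Blin (blin_comp_subproof D D').

Lemma blin_comp_bilinear {X Y Z : normedModType R} :
  bounded_bilinear (@blin_comp X Y Z).
Proof.
split=> [D' a D1 D2|D a D1 D2|].
- by apply: blinE.
- by apply: blinE => x /=; rewrite /blin_comp_fun /= linearP.
- exists 1 => // D D'; rewrite mul1r; apply: blin_norm_le => [|x]; first by rewrite mulr_ge0.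
  apply: (le_trans (blin_normP D (D' x))); rewrite -mulrA.
  by apply: ler_wpM2l => //; exact: blin_normP.
Qed.

Lemma blin_id_subproof {X : normedModType R} : (@idfun X) \in @clinear_pred R X X.
Proof. by rewrite inE; split => // x; exact: cvg_id. Qed.

Definition blin_id {X : normedModType R} : blin X X := Blin blin_id_subproof.

Lemma blin_app_bilinear {X Y : normedModType R} :
  bounded_bilinear (fun (D : blin X Y) (x : X) => D x).
Proof.
split=> [x a D1 D2|D|]; [by []|exact: blin_linear|].
by exists 1 => // D x; rewrite mul1r blin_normP.
Qed.

Lemma scale_bilinear {X : normedModType R} :
  bounded_bilinear (fun (a : R^o) (x : X) => a *: x).
Proof.
split=> [x a b c|a b x y|].
- by rewrite scalerDl scalerA.
- by rewrite scalerDr !scalerA mulrC.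
- by exists 1 => // a x; rewrite mul1r normrZ.
Qed.

End BoundedLinear.

Section BlinComplete.
Context {R : realType} {X : normedModType R} {Y : completeNormedModType R}.

(** Makes the operators and the functionals complete, so that [cauchy_lipschitz] can be applied to
    operator-valued equations. The limit is taken pointwise, and the Cauchy estimate passes to it
    uniformly. *)
Lemma blin_cauchy_cvg (F : set_system (blin X Y)) :
  ProperFilter F -> cauchy F -> cvg F.
Proof.
move=> FF /cauchy_ballP cF.
have Fx x : cvg ((fun D : blin X Y => D x) @ F).
  apply/cauchy_cvgP/cauchy_ballP => e e0.
  have e1 : 0 < e / (`|x| + 1) by rewrite divr_gt0// ltr_wpDl.
  have [[A B] [FA FB] AB] := cF _ e1.
  exists ((fun D : blin X Y => D x) @` A, (fun D : blin X Y => D x) @` B).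
    by split; [apply: filterS FA|apply: filterS FB] => D AD; exists D.
  move=> [_ _] /= [[D AD <-] [D' BD' <-]].
  have := AB (D, D') (conj AD BD'); rewrite -!ball_normE /= => DD'.
  apply: (@le_lt_trans _ _ (`|D - D'| * `|x|)); first exact: (blin_normP (D - D') x).
  apply: (@le_lt_trans _ _ (`|D - D'| * (`|x| + 1))); first by rewrite ler_wpM2l// lerDl.
  by rewrite -ltr_pdivlMr// ltr_wpDl.
pose f x := lim ((fun D : blin X Y => D x) @ F).
have fP x : (fun D : blin X Y => D x) @ F --> f x by exact: Fx.
have lf : linear f.
  move=> a u v.
  have h : (fun D : blin X Y => D (a *: u + v)) @ F --> a *: f u + f v.
    under eq_fun do rewrite linearP.
    by apply: cvgD; [apply: cvgZr; exact: fP|exact: fP].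
  exact: cvg_unique (fP _) h.
have close e : 0 < e -> exists2 A, F A & forall D x, A D -> `|D x - f x| <= e * `|x|.
  move=> e0; have [[A B] [FA FB] AB] := cF _ e0.
  exists A => // D x AD.
  have : `|D x - D' x| @[D' --> F] --> `|D x - f x|.
    by apply: cvg_norm; apply: cvgB; [exact: cvg_cst|exact: fP].
  move=> /cvgr_to_le; apply; apply: filterS FB => D' BD'.
  have := AB (D, D') (conj AD BD'); rewrite -ball_normE /= => DD'.
  apply: (@le_trans _ _ (`|D - D'| * `|x|)); first exact: (blin_normP (D - D') x).
  by rewrite ler_wpM2r// ltW.
have [A FA AP] := close 1 ltr01.
have [D0 AD0] := filter_ex FA.
have [Df DfE] : exists D : blin X Y, D =1 f.
  apply: (@blin_of_bound _ _ _ f (`|D0| + 1)) => // x.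
  rewrite -[f x](subrK (D0 x)) addrC (le_trans (ler_normD _ _))// mulrDl.
  apply: lerD; first exact: blin_normP.
  by rewrite distrC AP.
apply/cvg_ex; exists Df; apply/cvgrPdist_le => e e0.
have [B FB BP] := close e e0; apply: filterS FB => D BD.
rewrite distrC; apply: blin_norm_le => [|x]; first exact: ltW.
by rewrite [X in `|X|](_ : _ = D x - f x) ?BP// -DfE.
Qed.

HB.instance Definition _ := Uniform_isComplete.Build (blin X Y) blin_cauchy_cvg.

End BlinComplete.

Section Resolvent.
Context {R : realType}.

Lemma cadlag_bilinear {E F G : normedModType R} (B : E -> F -> G) T (x : R -> E) (y : R -> F) :
  bounded_bilinear B -> cadlag T setT x -> cadlag T setT y ->
  cadlag T setT (fun t => B (x t) (y t)).
Proof.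
move=> bB [_ xr xl] [_ yr yl]; split => // t tT.
  by apply: cvg_bilinear => //; [exact: xr|exact: yr].
have [u _ xu] := xl t tT; have [v _ yv] := yl t tT.
by exists (B u v) => //; exact: cvg_bilinear.
Qed.

Lemma continuous_cadlag {Z : topologicalType} T (U : set Z) (x : R -> Z) :
  (forall t, 0 <= t <= T -> U (x t)) -> continuous x -> cadlag T U x.
Proof.
move=> Ux cx; split => // t tT; first by apply: cvg_at_right_filter; exact: cx.
exists (x t); first by apply: Ux; have /andP[/ltW -> ->] := tT.
by apply: cvg_at_left_filter; exact: cx.
Qed.

Lemma cadlagN {E : normedModType R} T (x : R -> E) :
  cadlag T setT x -> cadlag T setT (fun t => - x t).
Proof.
move=> [_ xr xl]; split => // t tT; first by apply: cvgN; exact: xr.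
by have [u _ xu] := xl t tT; exists (- u) => //; exact: cvgN.
Qed.

Lemma cadlag_bounded {E : normedModType R} T (x : R -> E) : 0 <= T ->
  cadlag T setT x -> exists2 c, 0 <= c & forall t, 0 <= t <= T -> `|x t| <= c.
Proof.
move=> T0 [_ xr xl].
suff : exists2 c, 0 <= c & forall t, 0 <= t <= T -> `|x t| <= c by [].
apply: (@real_induction_local _
  (fun s => exists2 c, 0 <= c & forall t, 0 <= t <= s -> `|x t| <= c) 0 T T0).
  by exists `|x 0| => // t /le_anti <-.
move=> t /andP[t0 tT].
have [d1 d10 [c1 c1P]] : exists2 d, 0 < d & exists c, forall s, 0 <= s -> t - d < s < t -> `|x s| <= c.
  have [tE|t_neq0] := eqVneq t 0.
    by exists 1 => //; exists 0 => s s0 /andP[_]; rewrite tE ltNge s0.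
  have [|z _ zP] := xl t; first by rewrite lt_neqAle eq_sym t_neq0 t0.
  have /near_left[d d0 dP] : \forall s \near t^'-, `|z - x s| <= 1 by exact: cvgr_dist_le.
  exists d => //; exists (1 + `|z|) => s _ sd.
  by rewrite -(subrK z (x s)) (le_trans (ler_normD _ _))// lerD2r distrC dP.
have [d2 d20 [c2 c2P]] : exists2 d, 0 < d & exists c, forall s, s <= T -> t < s < t + d -> `|x s| <= c.
  have [tT'|Tt] := ltP t T; last first.
    by exists 1 => //; exists 0 => s sT /andP[]; rewrite ltNge (le_trans sT).
  have /near_right[d d0 dP] : \forall s \near t^'+, `|x t - x s| <= 1.
    by apply: cvgr_dist_le => //; apply: xr; rewrite t0.
  exists d => //; exists (1 + `|x t|) => s _ sd.
  by rewrite -(subrK (x t) (x s)) (le_trans (ler_normD _ _))// lerD2r distrC dP.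
exists (Num.min d1 d2) => [|s s' s0 s'T]; first by rewrite lt_min d10.
rewrite ltrBlDr -ltrBlDl lt_min => /andP[h1 h2] st ts'.
rewrite -ltrBlDl lt_min => /andP[h3 h4] [c c0 cP].
exists (`|x t| + (c + (`|c1| + `|c2|))) => [|r /andP[r0 rs']]; first by rewrite !addr_ge0.
have := normr_ge0 (x t); have := ler_norm c1; have := ler_norm c2.
have := normr_ge0 c1; have := normr_ge0 c2.
have [rs|sr] := leP r s; first by have := cP r; rewrite r0 rs => /(_ isT); lra.
have [rt|tr|->] := ltgtP r t; last by lra.
  by have := c1P r r0; rewrite rt andbT => /(_ _)/wrap[|]; lra.
by have := c2P r; rewrite tr => /(_ _ _)/wrap[||]; lra.
Qed.

Context {E : completeNormedModType R}.

Lemma linear_flow T {V : completeNormedModType R} (B : R -> V -> V) (c : R) (v0 : V) :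
  0 <= T -> 0 <= c -> (forall t, linear (B t)) ->
  (forall t v, 0 <= t <= T -> `|B t v| <= c * `|v|) ->
  (forall x, continuous x -> cadlag T setT (fun t => B t (x t))) ->
  exists x, [/\ continuous x, x 0 = v0 & forall t, 0 <= t < T -> rderiv x t (B t (x t))].
Proof.
move=> T0 c0 lB Bc cB; apply: (cauchy_lipschitz (L := c)) => // t u v /andP[t0 tT].
by rewrite -(linear_sub _ _ (lB t)) Bc// t0 ltW.
Qed.

(** [Q] is obtained from its own equation instead of by inverting [S], which also supplies the
    derivative needed for the adjoint state. *)
Lemma resolvent_exists T (A : R -> blin E E) : 0 <= T -> cadlag T setT A ->
  exists S Q : R -> blin E E, [/\ continuous S, continuous Q,
    forall t, 0 <= t < T -> rderiv S t (blin_comp (A t) (S t)),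
    forall t, 0 <= t < T -> rderiv Q t (- blin_comp (Q t) (A t)) &
    forall t, 0 <= t <= T -> blin_comp (S t) (Q t) = blin_id].
Proof.
move=> T0 cA; have [c c0 cP] := cadlag_bounded T0 cA.
have bB := @blin_comp_bilinear R E E E.
have [lB rB _] := bB.
have normB (D D' : blin E E) : `|blin_comp D D'| <= `|D| * `|D'|.
  apply: blin_norm_le => [|x]; first by rewrite mulr_ge0.
  apply: (le_trans (blin_normP D (D' x))); rewrite -mulrA.
  by apply: ler_wpM2l => //; exact: blin_normP.
have [S [cS S0 dS]] : exists S : R -> blin E E, [/\ continuous S, S 0 = blin_id &
    forall t, 0 <= t < T -> rderiv S t (blin_comp (A t) (S t))].
  apply: (linear_flow (B := fun t D => blin_comp (A t) D) (c := c)) => //.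
    by move=> t D tT; apply: (le_trans (normB _ _)); rewrite ler_wpM2r// cP.
  by move=> x cx; apply: cadlag_bilinear => //; apply: continuous_cadlag.
have [Q [cQ Q0 dQ]] : exists Q : R -> blin E E, [/\ continuous Q, Q 0 = blin_id &
    forall t, 0 <= t < T -> rderiv Q t (- blin_comp (Q t) (A t))].
  apply: (linear_flow (B := fun t D => - blin_comp D (A t)) (c := c)) => //.
  - by move=> t a D D'; rewrite lB opprD scalerN.
  - by move=> t D tT; rewrite normrN (le_trans (normB _ _))// mulrC ler_wpM2r// cP.
  - move=> x cx; apply: cadlagN; apply: cadlag_bilinear => //.
    exact: continuous_cadlag.
exists S, Q; split => // t /andP[t0 tT].
(* [W] solves the linear equation [W' = A W - W A] with [W 0 = 0], so Gronwall's inequality with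
   constant [c + c] forces it to vanish. *)
pose W s := blin_comp (S s) (Q s) - blin_id.
apply/eqP; rewrite -subr_eq0 -[_ - _]/(W t) -normr_le0.
have W0 : W 0 = 0.
  by rewrite /W S0 Q0; apply/eqP; rewrite subr_eq0; apply/eqP; exact: blinE.
have cst0 (s : R) : {for s, continuous (fun=> (0 : R))} by exact: cvg_cst.
have := @gronwall R _ W (fun=> 0) (c + c) 0 t.
rewrite W0 normr0 subrr addr0 mulr0; apply => //; first by rewrite addr_ge0.
  move=> s _; apply: cvgB; last exact: cvg_cst.
  by apply: cvg_bilinear => //; [exact: cS|exact: cQ].
move=> s /andP[s0 st]; have sT : 0 <= s < T by rewrite s0 (lt_le_trans st).
exists (blin_comp (A s) (W s) - blin_comp (W s) (A s)), 0; split => //.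
- have -> : blin_comp (A s) (W s) - blin_comp (W s) (A s) =
      blin_comp (blin_comp (A s) (S s)) (Q s) + blin_comp (S s) (- blin_comp (Q s) (A s)) - 0.
    rewrite subr0 /W (linear_sub _ _ (rB (A s))) (linear_sub _ _ (lB (A s))).
    have -> : blin_comp (A s) blin_id = A s by exact: blinE.
    have -> : blin_comp blin_id (A s) = A s by exact: blinE.
    rewrite opprB addrA subrK; congr (_ + _); first exact: blinE.
    apply: blinE => x /=.
    exact: esym (linearN (S s) (Q s (A s x))).
  apply: rderivB; last exact: rderiv_cst.
  by apply: rderiv_bilinear => //; [exact: dS|exact: dQ].
- by move=> e e0; near=> h; rewrite subrr sub0r mulrN oppr_le0 mulr_ge0// ltW.
- rewrite addr0 (le_trans (ler_normB _ _))// mulrDl.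
  have As : `|A s| <= c by apply: cP; have /andP[-> /ltW] := sT.
  apply: lerD; rewrite (le_trans (normB _ _))//; first by rewrite ler_wpM2r.
  by rewrite mulrC ler_wpM2r.
Unshelve. all: by end_near. Qed.

End Resolvent.

(** * Primitives of semicontinuous functions *)

Section LscMajorant.
Context {R : realType}.
Local Notation mu := (@lebesgue_measure R).

(** [psi] is the integral of [g] from [a], Lipschitz with constant [C]. A lower bound of [g] just to
    the right of [t] is a lower bound of the difference quotients of [psi] there. *)
Lemma lsc_primitive (g : R -> R) (C a : R) :
  (forall t, 0 <= g t <= C) -> lower_semicontinuous (fun t => (g t)%:E) ->
  exists psi : R -> R,
   [/\ forall t, a < t -> {for t, continuous psi},
       forall s t, a <= s -> s <= t -> psi t - psi s = \int[mu]_(x in `]s, t]) g x &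
       forall t d, a <= t -> (forall e, 0 < e -> \forall h \near 0^'+, d - e <= g (t + h)) ->
         dini_ge psi t d].
Proof.
move=> gC lsc_g.
have mg : measurable_fun setT g.
  by apply/measurable_EFinP; exact: lower_semicontinuous_measurable.
have int_g s t : mu.-integrable `]s, t] (EFin \o g).
  apply: measurable_bounded_integrable => //.
  - rewrite /= lebesgue_measure_itv/=; case: ifPn => // _.
    by rewrite -EFinB ltry.
  - exact: measurable_funS mg.
  - exists C; split; first exact: num_real.
    by move=> x Cx y _ /=; rewrite ger0_norm; have /andP[? ?] := gC y => //; lra.
have mu_itv s t : s <= t -> fine (mu `]s, t]) = t - s.
  move=> st; rewrite /= lebesgue_measure_itv/= lte_fin.
  have [//|ts] := ltP s t.
  by rewrite (@le_anti _ _ s t) ?st// subrr.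
pose psi t := \int[mu]_(x in `]a, t]) g x.
have psiB s t : a <= s -> s <= t -> psi t - psi s = \int[mu]_(x in `]s, t]) g x.
  by move=> as_ st; rewrite /psi Rintegral_itvB// bnd_simp.
have psi_ub s t : a <= s -> s <= t -> psi t - psi s <= C * (t - s).
  move=> as_ st; rewrite psiB// -(mu_itv _ _ st) -Rintegral_cst//.
  apply: le_Rintegral => //.
    apply: measurable_bounded_integrable => //.
      rewrite /= lebesgue_measure_itv/=; case: ifPn => // _.
      by rewrite -EFinB ltry.
    exact: bounded_cst.
  by move=> x _; have /andP[] := gC x.
have psi_lb s t c : a <= s -> s <= t -> (forall x, s < x <= t -> c <= g x) ->
    c * (t - s) <= psi t - psi s.
  move=> as_ st cg; rewrite psiB// -(mu_itv _ _ st) -Rintegral_cst//.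
  apply: le_Rintegral => //.
    apply: measurable_bounded_integrable => //.
      rewrite /= lebesgue_measure_itv/=; case: ifPn => // _.
      by rewrite -EFinB ltry.
    exact: bounded_cst.
exists psi; split => // [t at_|t d at_ dg e e0].
  have C0 : 0 <= C by have /andP[/le_trans] := gC 0; apply.
  have lip s : a < s -> `|psi t - psi s| <= C * `|t - s|.
    move=> as_; wlog st : s t as_ at_ / s <= t.
      have [/[swap]|/ltW ts] := leP s t; first exact.
      by move=> /(_ t s at_ as_ ts); rewrite distrC [`|s - t|]distrC.
    have h0 : 0 <= psi t - psi s.
      rewrite -[leLHS](mul0r (t - s)); apply: psi_lb => //; first exact: ltW.
      by move=> x _; have /andP[] := gC x.
    by rewrite (ger0_norm h0) ger0_norm ?subr_ge0//; apply: psi_ub => //; exact: ltW.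
  apply/cvgrPdist_le => e e0; near=> s.
  apply: (le_trans (lip s _)); first by near: s; exact: lt_nbhsr.
  have h : `|t - s| <= e / (C + 1).
    near: s; have cid : s @[s --> t] --> t by exact: cvg_id.
    by move/cvgrPdist_le : cid; apply; rewrite divr_gt0// ltr_wpDl.
  apply: (@le_trans _ _ ((C + 1) * `|t - s|)); first by rewrite ler_wpM2r// lerDl.
  by rewrite mulrC -ler_pdivlMr ?ltr_wpDl.
have /near0_right[r r0 rP] := dg e e0.
apply/near0_right; exists r => // h /andP[h0 hr].
have th : t <= t + h by rewrite lerDl ltW.
have -> : h * (d - e) = (d - e) * (t + h - t) by ring.
apply: psi_lb => // x /andP[tx xh].
have -> : x = t + (x - t) by ring.
by apply: rP; apply/andP; split; lra.
Unshelve. all: by end_near. Qed.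

(* Dominated convergence supplies the bound that Gronwall's lemma needs. *)
Lemma lsc_majorant (g : nat -> R -> R) (C T : R) : 0 <= T ->
  (forall n t, 0 <= g n t <= C) ->
  (forall n, lower_semicontinuous (fun t => (g n t)%:E)) ->
  (forall t, g n t @[n --> \oo] --> 0) ->
  forall e, 0 < e -> exists n (psi : R -> R),
   [/\ forall t, 0 <= t <= T -> {for t, continuous psi},
       psi T - psi 0 <= e &
       forall t d, 0 <= t ->
         (forall e, 0 < e -> \forall h \near 0^'+, d - e <= g n (t + h)) ->
         dini_ge psi t d].
Proof.
move=> T0 gC lsc_g g0 e e0.
have mg n : measurable_fun setT (g n).
  by apply/measurable_EFinP; exact: lower_semicontinuous_measurable (lsc_g n).
have : (\int[mu]_(x in `]0%R, T]) (g n x)%:E @[n --> \oo] --> 0)%E.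
  have -> : (0%E = \int[mu]_(x in `]0%R, T]) (cst 0%E x) :> \bar R)%E.
    by rewrite integral0.
  have [] // := @dominated_convergence _ _ R mu `]0, T]%classic _
    (fun n x => (g n x)%:E) (cst 0%E) (cst C%:E).
  - by move=> n; apply/measurable_EFinP; exact: measurable_funS (mg n).
  - apply: aeW => x _; apply: cvg_EFin; [exact: nearW|exact: g0].
  - apply: (measurable_bounded_integrable (f := fun=> C)) => //.
      rewrite /= lebesgue_measure_itv/=; case: ifPn => // _.
      by rewrite -EFinB ltry.
    exact: bounded_cst.
  - apply: aeW => x n _ /=; rewrite lee_fin ger0_norm; by have /andP[] := gC n x.
move=> /fine_cvg /= /cvgr0_norm_le/(_ e e0)[n _ /(_ n (leqnn n)) /= ne].
(* The integral starts at [-1] in order that [psi] be continuous also at [0]. *)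
have [psi [cpsi psiB dpsi]] := lsc_primitive (-1) (gC n) (lsc_g n).
exists n, psi; split.
- by move=> t /andP[t0 _]; apply: cpsi; lra.
- by rewrite psiB// (le_trans _ ne)// ler_norm.
- by move=> t d t0; apply: dpsi; lra.
Qed.

End LscMajorant.

(** * Piecewise continuous and piecewise smooth functions *)

Section Subdivisions.
Context {R : realType}.
Implicit Types (T t : R) (s D : seq R).

Lemma node_itv T s i : itv_partition 0 T s -> (i < size s)%N ->
  [/\ 0 <= node s i, node s i < node s i.+1 & node s i.+1 <= T].
Proof.
move=> [ps /eqP lT] si; have so : sorted <%R (0 :: s) by [].
have lt i' j' : (i' < j')%N -> (j' <= size s)%N -> node s i' < node s j'.
  move=> ij js; rewrite /node; apply: (sorted_ltn_nth lt_trans _ so) => //.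
  by rewrite inE /= ltnS (leq_trans (ltnW ij)).
split; last 1 first.
- rewrite -lT (last_nth 0) -/(node s (size s)).
  by have [->//|si'] := eqVneq i.+1 (size s); apply: ltW; apply: lt; rewrite // ltn_neqAle si'.
- by case: i si => // i si; apply: ltW; apply: (lt 0%N) => //; exact: ltnW.
- exact: lt.
Qed.

(** Allows [C1_along_itv], stated for smooth functions along a subdivision, to be used for a bare
    subdivision. *)
Lemma cst_C1_along T s : itv_partition 0 T s -> C1_along T s (fun _ : R => 0 : R^o).
Proof.
move=> ps; split => // i si.
have d0 : derive1 (fun _ : R => 0 : R^o) = fun=> 0.
  by apply/funext => t; rewrite derive1_cst.
rewrite d0; split.
- by move=> t _; exact: derivable_cst.
- by apply: continuous_subspaceT => t; exact: cvg_cst.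
- exact: is_cvg_cst.
- exact: is_cvg_cst.
Qed.

Lemma itv_partition_cover T s t : itv_partition 0 T s -> 0 <= t <= T -> t \notin 0 :: s ->
  exists2 i, (i < size s)%N & t \in `]node s i, node s i.+1[.
Proof.
by move=> /cst_C1_along ps tT; apply: C1_along_itv ps _; rewrite in_itv.
Qed.

Lemma itv_partition_node T s t : itv_partition 0 T s -> t \in 0 :: s -> t < T ->
  exists2 i, (i < size s)%N & t = node s i.
Proof.
move=> [ps /eqP lT] /(nthP 0)[i /= si <-] iT; exists i => //.
rewrite ltn_neqAle -ltnS si andbT; apply: contraTneq iT => ->.
by rewrite -(last_nth 0 0) lT ltxx.
Qed.

Lemma itv_partition_exists T D : 0 < T -> exists2 s, itv_partition 0 T s &
  forall i t, (i < size s)%N -> t \in `]node s i, node s i.+1[ -> t \notin D.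
Proof.
move=> T0; pose D' := sort <=%R (undup [seq d <- D | 0 < d < T]).
have D'E d : (d \in D') = (d \in D) && (0 < d < T) by rewrite mem_sort mem_undup mem_filter andbC.
pose s := rcons D' T.
have so : sorted <%R D'.
  by rewrite sort_lt_sorted undup_uniq.
have ps : path <%R 0 s.
  rewrite /s rcons_path; apply/andP; split.
    rewrite path_min_sorted//; apply/allP => d; rewrite D'E => /andP[_ /andP[]] //.
  case: (lastP D') D'E => //= r d D'E; rewrite last_rcons.
  by have := D'E d; rewrite mem_rcons inE eqxx /= => /esym/andP[_ /andP[]].
have itv : itv_partition 0 T s by split => //; rewrite /s last_rcons.
exists s => // i t si; rewrite in_itv /= => /andP[it ti].
have [i0 _ iT] := node_itv itv si.
apply/negP => tD.
have : t \in s.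
  rewrite /s mem_rcons inE D'E tD /= orbC; apply/orP; left.
  by rewrite (le_lt_trans i0 it) (lt_le_trans ti iT).
move=> /(nthP 0)[j js tE].
have lt i' j' : (i' < j')%N -> (j' <= size s)%N -> node s i' < node s j'.
  move=> ij js'; rewrite /node; apply: (sorted_ltn_nth lt_trans _ (ps : sorted <%R (0 :: s))) => //.
  by rewrite inE /= ltnS (leq_trans (ltnW ij)).
have {}tE : t = node s j.+1 by [].
have [ij|ji|ij] := ltngtP i j.
- by have := lt i.+1 j.+1; rewrite ltnS => /(_ ij js); rewrite -tE ltNge (ltW ti).
- have : node s j.+1 <= node s i.
    move: ji; rewrite leq_eqVlt => /orP[/eqP <-//|ji].
    by apply: ltW; apply: lt => //; exact: ltnW.
  by rewrite -tE leNgt it.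
- by move: ti; rewrite tE ij ltxx.
Qed.

End Subdivisions.

Section NPC0Cadlag.
Context {R : realType} {Z : topologicalType}.
Implicit Types (T t : R) (U : set Z) (u : R -> Z).

Lemma NPC0_cadlag T U u : 0 < T -> NPC0 T U u -> cadlag T U u /\
  exists D : seq R, forall t, 0 < t < T -> t \notin D -> {for t, continuous u}.
Proof.
move=> T0 [uU [s ps pc] ur ul].
have open_cont t : 0 <= t <= T -> t \notin 0 :: s -> {for t, continuous u}.
  move=> tT ts; have [i si ti] := itv_partition_cover ps tT ts.
  have [cu _ _] := pc i si.
  rewrite continuous_open_subspace in cu; last exact: interval_open.
  by apply: cu; rewrite inE.
have uU' t : 0 <= t <= T -> U (u t) by move=> tT; apply: uU; rewrite in_itv.
split; last first.
  by exists (0 :: s) => t /andP[/ltW t0 /ltW tT] ts; apply: open_cont => //; rewrite t0.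
split=> [//|t tT|t tT]; first by apply: ur; rewrite in_itv.
have tT' : 0 <= t <= T by have /andP[/ltW -> ->] := tT.
have [ts|ts] := boolP (t \in 0 :: s); last first.
  by exists (u t); [exact: uU'|apply: cvg_at_left_filter; exact: open_cont].
move: ts; rewrite inE => /orP[/eqP t0|/(nthP 0)[i si <-]].
  by move: tT; rewrite t0 ltxx.
by have [_ _] := pc i si.
Qed.

Lemma cadlag_NPC0 T U u (D : seq R) : 0 < T -> cadlag T U u ->
  (forall t, 0 < t < T -> t \notin D -> {for t, continuous u}) ->
  u r @[r --> T^'-] --> u T -> NPC0 T U u.
Proof.
move=> T0 [uU ur ul] uD uT; have [s ps sD] := itv_partition_exists D T0.
split=> //; exists s => // i si; have [i0 ii iT] := node_itv ps si; split.
- rewrite continuous_open_subspace; last exact: interval_open.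
  move=> t; rewrite inE /= => ti; apply: uD; last exact: sD ti.
  move: ti; rewrite in_itv /= => /andP[h1 h2]; apply/andP; split; lra.
- have iT' : 0 <= node s i < T by rewrite i0 (lt_le_trans ii).
  exists (u (node s i)); last exact: ur.
  by apply: uU; have /andP[-> /ltW] := iT'.
- by apply: ul; rewrite iT andbT; lra.
Qed.

End NPC0Cadlag.

(** * Piecewise C^1 functions in terms of right derivatives *)

Section PC1Rderiv.
Context {R : realType} {E : normedModType R}.
Implicit Types (T t a b : R) (x phi : R -> E).

(** Meant for [rderiv_right_limit], where the right derivative at [a] is the unknown; the left end
    is reached by continuity. *)
Lemma rderiv_mvi_open x a b C : 0 <= C -> a < b -> continuous x ->
  (forall t, a < t < b -> exists2 v, rderiv x t v & `|v| <= C) ->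
  `|x b - x a| <= C * (b - a).
Proof.
move=> C0 ab cx dx.
have lim1 : `|x b - x c| @[c --> a^'+] --> `|x b - x a|.
  apply: cvg_norm; apply: cvgB; first exact: cvg_cst.
  by apply: cvg_at_right_filter; exact: cx.
apply: (cvgr_to_le lim1); near=> c.
have ac : a < c by near: c; exact: nbhs_right_gt.
have cb : c < b by near: c; exact: nbhs_right_lt.
apply: (@le_trans _ _ (C * (b - c))); last by rewrite ler_wpM2l// lerD2l lerN2 ltW.
apply: rderiv_mvi => //; [exact: ltW|by move=> t _; exact: cx|].
by move=> t /andP[ct tb]; apply: dx; rewrite tb (lt_le_trans ac).
Unshelve. all: by end_near. Qed.

Lemma rderiv_increment x phi v a b e : 0 <= e -> a < b -> continuous x ->
  (forall t, a < t < b -> rderiv x t (phi t) /\ `|phi t - v| <= e) ->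
  `|x b - x a - (b - a) *: v| <= e * (b - a).
Proof.
move=> e0 ab cx dx; pose g s := x s - (0 + (s - a) *: v).
have -> : x b - x a - (b - a) *: v = g b - g a.
  by rewrite /g !add0r subrr scale0r subr0 addrAC.
apply: rderiv_mvi_open => // [t|t tab].
  apply: cvgB; first exact: cx.
  apply: cvgD; first exact: cvg_cst.
  by apply: cvgZl; apply: cvgB; [exact: cvg_id|exact: cvg_cst].
have [dxt pv] := dx t tab; exists (phi t - v) => //.
by apply: rderivB => //; exact: rderiv_affine.
Qed.

Lemma rderiv_right_limit x phi t v : continuous x ->
  (\forall s \near t^'+, rderiv x s (phi s)) -> phi s @[s --> t^'+] --> v -> rderiv x t v.
Proof.
move=> cx /near_right[d d0 dP] phiv; apply/rderivP => e e0.
have /near_right[d' d'0 d'P] : \forall s \near t^'+, `|v - phi s| <= e by exact: cvgr_dist_le.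
near=> h.
have h0 : 0 < h by near: h; exact: nbhs_right_gt.
have hd : h < d by near: h; exact: nbhs_right_lt.
have hd' : h < d' by near: h; exact: nbhs_right_lt.
have th : t + h - t = h by ring.
rewrite -{2}th mulrC -[X in e * X]th; apply: (rderiv_increment (phi := phi)) => //.
- exact: ltW.
- by rewrite ltrDl.
- move=> s /andP[ts sh]; split; first by apply: dP; rewrite ts /=; lra.
  by rewrite distrC; apply: d'P; rewrite ts /=; lra.
Unshelve. all: by end_near. Qed.

(** Continuity of the right derivative at [t] controls the increments to the left as well: the mean
    value inequality on [[t + h, t]] with [h < 0] compares them with [phi t]. *)
Lemma derivable_of_rderiv x phi t : continuous x ->
  (\forall s \near t, rderiv x s (phi s)) -> {for t, continuous phi} ->
  derivable x t 1 /\ derive1 x t = phi t.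
Proof.
move=> cx /nbhs_ballP[d /= d0 dP] cphi.
have rt : rderiv x t (phi t) by apply: dP; exact: ballxx.
have E1 : (fun h => h^-1 *: ((x \o shift t) (h *: 1) - x t)) =
    (fun h => h^-1 *: (x (t + h) - x t)).
  apply/funext => h; congr (_ *: (x _ - _)); by rewrite /= [_ *: 1]mulr1 addrC.
suff lim1 : h^-1 *: (x (t + h) - x t) @[h --> 0^'] --> phi t.
  split; first by rewrite /derivable E1; apply/cvg_ex; exists (phi t).
  by rewrite derive1E /derive E1; exact: cvg_lim.
suff liml : h^-1 *: (x (t + h) - x t) @[h --> 0^'-] --> phi t.
  move=> P Pv; move: (rt P Pv) (liml P Pv); rewrite /fmap /at_right /at_left /within /=.
  apply: (@filterS2 _ (nbhs (0 : R))) => h Pp Pm h0.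
  by have [/Pm|/Pp|h0'] := ltgtP h 0 => //; rewrite h0' eqxx in h0.
apply/cvgrPdist_le => e e0.
have /nbhs_ballP[d' /= d'0 d'P] : \forall s \near t, `|phi t - phi s| <= e.
  by have /cvgrPdist_le/(_ e e0) : phi s @[s --> t] --> phi t by exact: cphi.
near=> h; have h0 : h < 0 by near: h; exact: nbhs_left_lt.
have hd : - d < h by near: h; apply: nbhs_left_gt; rewrite oppr_lt0.
have hd' : - d' < h by near: h; apply: nbhs_left_gt; rewrite oppr_lt0.
have nh0 : 0 < - h by rewrite oppr_gt0.
rewrite -(ler_pM2l nh0) -[X in X * `|_|](gtr0_norm nh0) -normrZ scalerBr !scaleNr scalerA.
rewrite divff ?lt_eqF// scale1r opprK.
have -> : - (h *: phi t) + (x (t + h) - x t) = - (x t - x (t + h) - (t - (t + h)) *: phi t).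
  rewrite (_ : t - (t + h) = - h); last by ring.
  by rewrite scaleNr opprK opprD opprB addrC.
rewrite normrN [leRHS]mulrC (_ : - h = t - (t + h)); last by ring.
apply: (rderiv_increment (phi := phi)) => //; [exact: ltW|by rewrite gtrDl|].
move=> s /andP[s1 s2]; split; first by apply: dP; rewrite /ball /= gtr0_norm ?subr_gt0//; lra.
by rewrite distrC; apply: d'P; rewrite /ball /= gtr0_norm ?subr_gt0//; lra.
Unshelve. all: by end_near. Qed.

Lemma clamp_path T x : 0 <= T -> {within `[0, T], continuous x} -> continuous (x \o clamp T).
Proof.
move=> T0 /subspace_continuousP cx t.
have tT : `[0, T]%classic (clamp T t) by rewrite /= in_itv /=; exact: clamp_itv.
move=> A /(cx _ tT) H.
have : clamp T s @[s --> t] --> clamp T t by exact: clamp_continuous.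
move=> /(_ _ H); apply: (@filterS _ (nbhs t)) => s /= h.
by apply: h; rewrite in_itv /=; exact: clamp_itv.
Qed.

Lemma rderiv_clamp T x t v : 0 <= t < T -> rderiv x t v <-> rderiv (x \o clamp T) t v.
Proof.
move=> /andP[t0 tT].
have nc : \forall h \near (0 : R)^'+, clamp T (t + h) = t + h.
  near=> h; have h0 : 0 < h by near: h; exact: nbhs_right_gt.
  have hT : h < T - t by near: h; apply: nbhs_right_lt; rewrite subr_gt0.
  by apply: clamp_id; apply/andP; split; lra.
have tc : clamp T t = t by rewrite clamp_id// t0 ltW.
by split; apply: rderiv_near; rewrite /= ?tc//; apply: filterS nc => h /= ->.
Unshelve. all: by end_near. Qed.

Lemma PC1_rderiv T (G : set E) x : PC1 T G x -> forall t, 0 <= t < T ->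
  rderiv (x \o clamp T) t (ext_deriv T x t).
Proof.
move=> [cx _ [s xs]] t tT; have /andP[t0 tT'] := tT.
have T0 : 0 <= T by rewrite (le_trans t0)// ltW.
have ps := xs.1.
have open_der i r : (i < size s)%N -> r \in `]node s i, node s i.+1[ ->
    rderiv (x \o clamp T) r (derive1 x r).
  move=> si ri; have [i0 ii iT] := node_itv ps si; have [dx _ _ _] := xs.2 i si.
  have rT : 0 <= r < T by move: ri; rewrite in_itv /= => /andP[? ?]; apply/andP; split; lra.
  by have [h _] := rderiv_clamp x (derive1 x r) rT; apply: h; exact: rderiv_of_derivable (dx r ri).
rewrite (ext_derivE xs) ?in_itv/= ?t0 ?ltW// /ext_deriv_along.
case: ifPn => [ts|]; last rewrite negbK tT' => ts.
  have [|i si ti] := itv_partition_cover ps _ ts; first by rewrite t0 ltW.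
  exact: open_der ti.
have [i si ti] := itv_partition_node ps ts tT'; have [i0 ii iT] := node_itv ps si.
have [_ _ cr _] := xs.2 i si.
apply: (rderiv_right_limit (phi := derive1 x)); first exact: clamp_path.
  apply/near_right; exists (node s i.+1 - node s i); first by rewrite subr_gt0.
  move=> r /andP[tr rt]; apply: (open_der i) => //; rewrite in_itv /= -ti tr /=.
  by move: rt; rewrite ti; lra.
by rewrite ti.
Qed.

(** On a subdivision whose open intervals avoid [D], the derivative exists and equals [phi]; its
    limits at the nodes are those of [phi]. At [T], where [ext_deriv] is a left limit, it equals
    [phi T] because [phi] is left continuous there. *)
Lemma rderiv_PC1 T (G : set E) x phi (D : seq R) : 0 < T -> continuous x ->
  (forall t, 0 <= t <= T -> G (x t)) -> cadlag T setT phi ->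
  (forall t, 0 < t < T -> t \notin D -> {for t, continuous phi}) ->
  phi r @[r --> T^'-] --> phi T ->
  (forall t, 0 <= t < T -> rderiv x t (phi t)) ->
  PC1 T G x /\ forall t, 0 <= t <= T -> ext_deriv T x t = phi t.
Proof.
move=> T0 cx Gx [_ phir phil] phiD phiT dx.
have [s ps sD] := itv_partition_exists D T0.
have itvT i t : (i < size s)%N -> t \in `]node s i, node s i.+1[ -> 0 < t < T.
  move=> si; have [i0 ii iT] := node_itv ps si.
  by rewrite in_itv /= => /andP[? ?]; apply/andP; split; lra.
have der i t : (i < size s)%N -> t \in `]node s i, node s i.+1[ ->
    derivable x t 1 /\ derive1 x t = phi t.
  move=> si ti; apply: derivable_of_rderiv => //.
    have nr : \forall r \near t, r \in `]node s i, node s i.+1[.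
      exact: near_in_itvoo.
    by apply: (filterS _ nr) => r ri; have /andP[/ltW r0 rT] := itvT _ _ si ri; apply: dx; rewrite r0.
  by apply: phiD; [exact: itvT ti|exact: sD ti].
have near_node i : (i < size s)%N -> \forall r \near (node s i)^'+, derive1 x r = phi r.
  move=> si; have [i0 ii iT] := node_itv ps si.
  apply/near_right; exists (node s i.+1 - node s i); first by rewrite subr_gt0.
  by move=> r /andP[r1 r2]; have [|_ ->//] := der i r si; rewrite in_itv /= r1; lra.
have near_node' i : (i < size s)%N -> \forall r \near (node s i.+1)^'-, derive1 x r = phi r.
  move=> si; have [i0 ii iT] := node_itv ps si.
  apply/near_left; exists (node s i.+1 - node s i); first by rewrite subr_gt0.
  by move=> r /andP[r1 r2]; have [|_ ->//] := der i r si; rewrite in_itv /= r2 andbT; lra.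
have right_lim i : (i < size s)%N -> derive1 x r @[r --> (node s i)^'+] --> phi (node s i).
  move=> si; have [i0 ii iT] := node_itv ps si.
  apply: (@cvg_trans _ (phi r @[r --> (node s i)^'+])).
    by apply: near_eq_cvg; apply: (filterS _ (near_node i si)) => r ->.
  by apply: phir; rewrite i0 (lt_le_trans ii).
have left_eq i : (i < size s)%N ->
    derive1 x r @[r --> (node s i.+1)^'-] `=>` phi r @[r --> (node s i.+1)^'-].
  by move=> si; apply: near_eq_cvg; apply: (filterS _ (near_node' i si)) => r ->.
have xs : C1_along T s x.
  split=> // i si; have [i0 ii iT] := node_itv ps si; split.
  - by move=> t ti; have [] := der i t si ti.
  - rewrite continuous_open_subspace; last exact: interval_open.
    move=> t; rewrite inE /= => ti.
    have nt : \forall r \near t, derive1 x r = phi r.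
      have nr : \forall r \near t, r \in `]node s i, node s i.+1[.
        exact: near_in_itvoo.
      by apply: (filterS _ nr) => r ri; by have [_ ->] := der i r si ri.
    apply: (@cvg_trans _ (phi r @[r --> t])).
      by apply: near_eq_cvg; apply: (filterS _ nt) => r ->.
    rewrite (der i t si ti).2; apply: phiD; [exact: itvT ti|exact: sD ti].
  - by apply/cvg_ex; exists (phi (node s i)); exact: right_lim.
  - have [|z _ zP] := phil (node s i.+1); first by rewrite iT andbT; lra.
    by apply/cvg_ex; exists z; exact: cvg_trans (left_eq i si) zP.
split; first by split=> //; [exact: continuous_subspaceT|exists s].
move=> t tT; rewrite (ext_derivE xs) ?in_itv// /ext_deriv_along.
case: ifPn => [ts|]; last rewrite negbK => ts.
  by have [i si ti] := itv_partition_cover ps tT ts; exact: (der i t si ti).2.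
case: ifPn => [tT'|]; last rewrite -leNgt => Tt.
  have [i si ->] := itv_partition_node ps ts tT'.
  by apply: cvg_lim => //; exact: right_lim.
have tE : t = T by have /andP[_ tT'] := tT; lra.
have lT : last 0 s = T by have [_ /eqP] := ps.
have s0 : (0 < size s)%N by case: (s) lT => //= T0'; move: T0; rewrite -T0' ltxx.
have nT : node s (size s).-1.+1 = T by rewrite prednK// -lT (last_nth 0).
rewrite tE; apply: cvg_lim => //.
have := left_eq (size s).-1; rewrite nT => h; apply: cvg_trans (h _) phiT.
by rewrite prednK.
Qed.

End PC1Rderiv.

(** * Limits within subsets, compact sequences and Frechet remainders *)

Section Misc.
Context {R : realType}.

Lemma within_continuous_cvg {X Z : topologicalType} (D : set X) (g : X -> Z)
    {I : Type} (F : set_system I) {FF : Filter F} (z : I -> X) z0 :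
  {within D, continuous g} -> D z0 -> (\forall i \near F, D (z i)) ->
  z @ F --> z0 -> g (z i) @[i --> F] --> g z0.
Proof.
move=> /subspace_continuousP cg Dz0 FD zz0 A gA.
have := cg z0 Dz0 A gA; rewrite /within /= => /zz0 /= H.
by apply: filterS2 FD H => i Di; exact.
Qed.

(** If the limit is not a cluster point of a filter, some neighbourhood of it misses a set of the
    filter, so that the filter contains a finite set of terms. The lemma makes [f_bound] applicable
    to convergent sequences. *)
Lemma cvg_seq_compact {X : topologicalType} (x : nat -> X) (a : X) :
  x @ \oo --> a -> compact (a |` range x).
Proof.
move=> xa F FF FK; apply: contrapT => /nonemptyPn h.
have [ca|] := pselect (cluster F a).
  have : (set0 : set X) a by rewrite -h; split => //; left.
  by [].
move=> /existsNP[A /existsNP[B /not_implyP[FA /not_implyP[aB /set0P/negP/negPn/eqP AB]]]].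
have [N _ NB] := xa B aB.
have fin : finite_set [set x n | n in [set n | (n < N)%N]].
  by apply: finite_image; exact: finite_II.
have := finite_compact fin; move/(_ F FF).
have FS : F [set x n | n in [set n | (n < N)%N]].
  apply: filterS2 FK FA => _ [->|[n _ <-]] Ay.
    by have : (A `&` B) a by [split => //; exact: nbhs_singleton]; rewrite AB.
  exists n => //=; rewrite ltnNge; apply/negP => Nn.
  by have : (A `&` B) (x n) by [split => //; exact: NB]; rewrite AB.
move=> /(_ FS)[_ [[n nN <-] cn]].
by have : (set0 : set X) (x n) by rewrite -h; split => //; right; exists n.
Qed.

End Misc.

Section FrechetRemainder.
Context {R : realType} {V W : normedModType R}.

Lemma DFE (g : V -> W) x : differentiable g x -> 'd g x = DF g x :> (V -> W).
Proof.
move=> dg; rewrite /DF; case: xgetP => [D _ [_ ->]//|h].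
have gP : ('d g x : V -> W) \in @clinear_pred R V W.
  by rewrite inE; split; [exact: linearP|exact: diff_continuous].
by have := h (Blin gP); case; split.
Qed.

Lemma DF_remainder (g : V -> W) x : differentiable g x -> forall e, 0 < e ->
  exists2 d, 0 < d & forall w, `|w| < d -> `|g (x + w) - g x - DF g x w| <= e * `|w|.
Proof.
move=> dg e e0; have /eqaddoP/(_ e e0) := diff_locally dg.
move=> /nbhs_ballP[d /= d0 dP]; exists d => // w wd.
have := dP w; rewrite -ball_normE /= sub0r normrN => /(_ wd).
rewrite -[X in `|X| <= _]/(g (w + x) - (g x + 'd g x w)) DFE//.
by rewrite opprD addrA [w + x]addrC.
Qed.

End FrechetRemainder.

(** * Needle controls *)

Section Ramps.
Context {R : realType}.

Lemma dini_geD (p q : R -> R) t c d : dini_ge p t c -> dini_ge q t d ->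
  dini_ge (fun s => p s + q s) t (c + d).
Proof.
move=> pc qd e e0; have e2 : 0 < e / 2 by rewrite divr_gt0.
apply: filterS2 (pc _ e2) (qd _ e2) => h; rewrite !mulrBr mulrDr; lra.
Qed.

Lemma dini_geZ (a : R) (p : R -> R) t c : 0 <= a -> dini_ge p t c ->
  dini_ge (fun s => a * p s) t (a * c).
Proof.
move=> a0 pc e e0; have e2 : 0 < e / (a + 1) by rewrite divr_gt0// ltr_wpDl.
near=> h; have h0 : 0 < h by near: h; exact: nbhs_right_gt.
have hp : h * (c - e / (a + 1)) <= p (t + h) - p t by near: h; exact: pc.
have ae : a * (e / (a + 1)) <= e.
  by rewrite mulrCA ger_pMr// ler_pdivrMr ?mul1r ?lerDl// ltr_wpDl.
have := ler_wpM2l a0 hp; rewrite -mulrBr; apply: le_trans.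
by rewrite mulrCA ler_pM2l// mulrBr lerD2l lerN2.
Unshelve. all: by end_near. Qed.

Lemma dini_ge_nondecreasing (p : R -> R) t : {homo p : a b / a <= b} -> dini_ge p t 0.
Proof.
move=> hp e e0; near=> h; have h0 : 0 < h by near: h; exact: nbhs_right_gt.
rewrite sub0r mulrN; apply: (@le_trans _ _ 0).
  by rewrite oppr_le0 mulr_ge0// ltW.
by rewrite subr_ge0; apply: hp; rewrite lerDl ltW.
Unshelve. all: by end_near. Qed.

Lemma dini_ge_sum (I : Type) (s : seq I) (p : I -> R -> R) t (c : I -> R) :
  (forall i, dini_ge (p i) t (c i)) ->
  dini_ge (fun r => \sum_(i <- s) p i r) t (\sum_(i <- s) c i).
Proof.
move=> pc; elim: s => [|i s IH].
  rewrite big_nil (_ : (fun _ => _) = (fun=> 0)); first exact: dini_ge_nondecreasing.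
  by apply/funext => r; rewrite big_nil.
rewrite big_cons (_ : (fun _ => _) = (fun r => p i r + \sum_(j <- s) p j r)).
  exact: dini_geD.
by apply/funext => r; rewrite big_cons.
Qed.

(** For [a <= b], a primitive of the indicator function of [[a, b[]. It serves both to measure where
    two controls differ and to switch on the effect of a needle. *)
Definition ramp (a b t : R) : R := Num.min (Num.max t a) b.

Lemma ramp_continuous a b : continuous (ramp a b).
Proof.
move=> t; apply: (@continuous_min R R (fun t => Num.max t a) (fun=> b) t).
  by apply: (@continuous_max R R id (fun=> a) t); [exact: cvg_id|exact: cvg_cst].
exact: cvg_cst.
Qed.

Lemma ramp_nondecreasing a b : {homo ramp a b : s t / s <= t}.
Proof.
move=> s t st; rewrite /ramp le_min !ge_min lexx orbT andbT.
apply/orP; left; rewrite ge_max !le_max st lexx orbT//.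
Qed.

Lemma ramp_itv a b t : a <= b -> a <= ramp a b t <= b.
Proof. by move=> ab; rewrite /ramp le_min ge_min le_max !lexx ab !orbT. Qed.

Lemma ramp_dini a b t : dini_ge (ramp a b) t (a <= t < b)%R%:R.
Proof.
have [/andP[at_ tb]|_] := boolP (a <= t < b); last first.
  by apply: dini_ge_nondecreasing; exact: ramp_nondecreasing.
move=> e e0; near=> h; have h0 : 0 < h by near: h; exact: nbhs_right_gt.
have hb : h < b - t by near: h; apply: nbhs_right_lt; rewrite subr_gt0.
rewrite /ramp (max_idPl at_) (min_idPl (ltW tb)) (max_idPl _); last lra.
rewrite (min_idPl _); last lra.
by rewrite mulrBr mulr1 addrAC subrr add0r gerBl mulr_ge0// ltW.
Unshelve. all: by end_near. Qed.

Lemma ramp_rderiv a b t : a <= b -> rderiv (ramp a b : R -> R^o) t ((a <= t < b)%R%:R : R^o).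
Proof.
move=> ab; have [at_|ta] := leP a t; last first.
  rewrite /=; apply: (@rderiv_near _ _ (fun=> a)); last exact: rderiv_cst.
    near=> h; have h0 : h < a - t by near: h; apply: nbhs_right_lt; rewrite subr_gt0.
    by rewrite /ramp (max_idPr _) ?(min_idPl _)//; lra.
  by rewrite /ramp (max_idPr _) ?(min_idPl _)// ltW.
have [tb|bt] := ltP t b.
  apply: (@rderiv_near _ _ (fun s : R => (t + (s - t) *: (1 : R^o)) : R^o)).
  - near=> h; have h0 : 0 < h by near: h; exact: nbhs_right_gt.
    have hb : h < b - t by near: h; apply: nbhs_right_lt; rewrite subr_gt0.
    rewrite /ramp (max_idPl _) ?(min_idPl _); [|lra|lra].
    by rewrite [_ *: _]mulr1; ring.
  - by rewrite /ramp (max_idPl _)// (min_idPl _) 1?ltW// subrr scale0r addr0.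
  - exact: rderiv_affine.
apply: (@rderiv_near _ _ (fun=> b)); last exact: rderiv_cst.
  near=> h; have h0 : 0 < h by near: h; exact: nbhs_right_gt.
  by rewrite /ramp (max_idPl _) ?(min_idPr _)//; lra.
by rewrite /ramp (max_idPl _)// (min_idPr _).
Unshelve. all: by end_near. Qed.

Lemma itv_right (a b t : R) : \forall s \near t^'+, (a <= s < b) = (a <= t < b).
Proof.
have [ta|at_] := ltP t a.
  apply/near_right; exists (a - t); first by rewrite subr_gt0.
  by move=> s /andP[_ sa]; rewrite leNgt (_ : s < a)//; lra.
have [tb|bt] := ltP t b; last first.
  apply/near_right; exists 1 => // s /andP[ts _].
  by rewrite !ltNge (le_trans bt (ltW ts)) !andbF.
apply/near_right; exists (b - t); first by rewrite subr_gt0.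
by move=> s /andP[ts sb]; apply/andP; split; lra.
Qed.

Lemma itv_left (a b t : R) : \forall s \near t^'-, (a <= s < b) = (a < t <= b).
Proof.
have [ta|at_] := leP t a.
  apply/near_left; exists 1 => // s /andP[_ st].
  by rewrite leNgt (lt_le_trans st ta).
have [tb|bt] := leP t b; last first.
  apply/near_left; exists (t - b); first by rewrite subr_gt0.
  by move=> s /andP[sb _]; rewrite andbC ltNge (_ : b <= s)//; lra.
apply/near_left; exists (t - a); first by rewrite subr_gt0.
by move=> s /andP[sa st]; apply/andP; split; lra.
Qed.

Lemma itv_near (a b t : R) : t != a -> t != b ->
  \forall s \near t, (a <= s < b) = (a <= t < b).
Proof.
move=> ta tb.
have h (c : R) : t != c -> \forall s \near t, (c <= s) = (c <= t).
  move=> tc; have [ct|tc'] := leP c t.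
    have {}ct : c < t by rewrite lt_neqAle eq_sym tc.
    by near=> s; apply: ltW; near: s; exact: lt_nbhsr.
  near=> s; apply/negbTE; rewrite -ltNge; near: s; exact: lt_nbhsl.
by apply: filterS2 (h a ta) (h b tb) => s; rewrite !ltNge => -> ->.
Unshelve. all: by end_near. Qed.

Definition override {Z : Type} (a b : R) (z : Z) (u : R -> Z) : R -> Z :=
  fun t => if a <= t < b then z else u t.

Lemma override_cadlag {Z : topologicalType} T (U : set Z) a b z (u : R -> Z) :
  U z -> cadlag T U u -> cadlag T U (override a b z u).
Proof.
move=> Uz [uU ur ul]; split=> t tT.
- by rewrite /override; case: ifP => // _; exact: uU.
- apply: (@cvg_trans _ ((fun s => if a <= t < b then z else u s) @ t^'+)).
    apply: near_eq_cvg; apply: filterS (itv_right a b t) => s.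
    by rewrite /override => ->.
  by rewrite /override; case: (a <= t < b); [exact: cvg_cst|exact: ur].
- have [y Uy uy] := ul t tT; exists (if a < t <= b then z else y); first by case: ifP.
  apply: (@cvg_trans _ ((fun s => if a < t <= b then z else u s) @ t^'-)).
    apply: near_eq_cvg; apply: filterS (itv_left a b t) => s.
    by rewrite /override => ->.
  by case: (a < t <= b) => //; exact: cvg_cst.
Qed.

Lemma override_continuous {Z : topologicalType} (a b : R) z (u : R -> Z) (t : R) :
  t != a -> t != b -> {for t, continuous u} -> {for t, continuous (override a b z u)}.
Proof.
move=> ta tb ut; rewrite /prop_for /continuous_at; apply: (@cvg_trans _ ((fun s => if a <= t < b then z else u s) @ t)).
  by apply: near_eq_cvg; apply: filterS (itv_near ta tb) => s; rewrite /override => ->.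
rewrite /override; case: (a <= t < b); last exact: ut.
by move=> A /nbhs_singleton zA; have : \forall s \near (t : R), A z by apply: filterE.
Qed.

Section Needle.
Context {Z : Type} {N : nat}.
Variables (u0 : R -> Z) (zeta : 'I_N -> Z).

(** Where intervals overlap, the smallest index prevails, so that the control is defined for
    arbitrary endpoints. *)
Definition needle (al be : 'I_N -> R) : R -> Z :=
  foldr (fun j => override (al j) (be j) (zeta j)) u0 (enum 'I_N).

Lemma needleP al be t : needle al be t = u0 t \/ exists j, needle al be t = zeta j.
Proof.
rewrite /needle; elim: (enum _) => [|j js IH] /=; first by left.
by rewrite /override; case: ifP => // _; right; exists j.
Qed.

Lemma needle_eq al be al' be' t :
  (forall j, (al j <= t < be j) = (al' j <= t < be' j)) ->
  needle al be t = needle al' be' t.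
Proof.
move=> h; rewrite /needle; elim: (enum _) => [|j js IH] //=.
by rewrite /override h IH.
Qed.

Lemma needle_out al be t : (forall j, (al j <= t < be j) = false) ->
  needle al be t = u0 t.
Proof.
by move=> h; rewrite /needle; elim: (enum _) => [|j js IH] //=; rewrite /override h.
Qed.

Lemma needle_in al be t j : al j <= t < be j ->
  (forall i, i != j -> (al i <= t < be i) = false) -> needle al be t = zeta j.
Proof.
move=> tj h; rewrite /needle; have := mem_enum 'I_N j; elim: (enum _) => [|i js IH] //=.
rewrite inE /override; have [<-|ji] := eqVneq j i; first by rewrite tj.
by move=> /IH; rewrite h// eq_sym.
Qed.

End Needle.

Lemma needle_cadlag {Z : topologicalType} {N : nat} T (U : set Z) (u0 : R -> Z)
    (zeta : 'I_N -> Z) al be : (forall j, U (zeta j)) ->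
  cadlag T U u0 -> cadlag T U (needle u0 zeta al be).
Proof.
move=> Uz cu; rewrite /needle; elim: (enum _) => [|j js IH] //=.
exact: override_cadlag.
Qed.

Lemma needle_continuous {Z : topologicalType} {N : nat} (u0 : R -> Z)
    (zeta : 'I_N -> Z) (al be : 'I_N -> R) (t : R) : (forall j, t != al j) -> (forall j, t != be j) ->
  {for t, continuous u0} -> {for t, continuous (needle u0 zeta al be)}.
Proof.
move=> tal tbe cu; rewrite /needle; elim: (enum _) => [|j js IH] //=.
exact: override_continuous.
Qed.

End Ramps.

Lemma cvg_sumr {R : realType} {V : normedModType R} {T I : Type} (F : set_system T)
    {FF : Filter F} (s : seq I) (p : I -> T -> V) (a : I -> V) :
  (forall i, p i x @[x --> F] --> a i) ->
  \sum_(i <- s) p i x @[x --> F] --> \sum_(i <- s) a i.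
Proof. by move=> pa; apply: cvg_big => // -[x y]; exact: add_continuous. Qed.

(** * Radial projection onto a ball *)

Section Retraction.
Context {R : realType} {E : normedModType R}.
Variable r : R.
Hypothesis r_gt0 : 0 < r.

Definition retract (w : E) : E := (r / Num.max r `|w|) *: w.

Let max_gt0 (w : E) : 0 < Num.max r `|w|.
Proof. by rewrite lt_max r_gt0. Qed.

Lemma retract_id w : `|w| <= r -> retract w = w.
Proof. by move=> wr; rewrite /retract (max_idPl wr) divff ?scale1r// lt0r_neq0. Qed.

Lemma retract_norm w : `|retract w| <= r.
Proof.
rewrite /retract normrZ ger0_norm; last by rewrite divr_ge0// ltW.
by rewrite mulrAC ler_pdivrMr// ler_pM2l// le_max lexx orbT.
Qed.

(** Change first the vector, then the scaling factor. The factor is at most 1 and [Num.max r] is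
    1-Lipschitz in the norm, so each change costs at most the distance of the points, which gives
    the constant 2. *)
Lemma retract_lipschitz w w' : `|retract w - retract w'| <= 2 * `|w - w'|.
Proof.
rewrite /retract; set m := Num.max r `|w|; set m' := Num.max r `|w'|.
have m0 : 0 < m by exact: max_gt0.
have m'0 : 0 < m' by exact: max_gt0.
have mm' : `|m' - m| <= `|w - w'|.
  have h1 := ler_dist_dist w w'; rewrite ler_norml in h1; have /andP[h2 h3] := h1.
  have mx (a b c : R) : a <= b + c -> 0 <= c -> Num.max r a <= Num.max r b + c.
    move=> abc c0; rewrite ge_max -!lerBlDr !le_max !lerBlDr lerDl c0 /=.
    by rewrite abc orbT.
  rewrite ler_norml; apply/andP; split.
    by rewrite lerNl opprB lerBlDl; apply: mx => //; lra.
  by rewrite lerBlDl; apply: mx => //; lra.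
have -> : (r / m) *: w - (r / m') *: w' = (r / m) *: (w - w') + (r / m - r / m') *: w'.
  by rewrite scalerBr scalerBl addrA subrK.
apply: (le_trans (ler_normD _ _)); rewrite [X in X + _]normrZ [X in _ + X]normrZ mulr2n mulrDl mul1r.
have rm : r / m <= 1 by rewrite ler_pdivrMr// mul1r le_max lexx.
have rm0 : 0 <= r / m by rewrite divr_ge0// ltW.
apply: lerD; first by rewrite (ger0_norm rm0) ler_piMl.
have -> : r / m - r / m' = (r / m) * ((m' - m) / m').
  by field; rewrite !lt0r_neq0.
rewrite normrM ger0_norm// normrM normfV (gtr0_norm m'0) -mulrA.
apply: (@le_trans _ _ (1 * (`|w - w'| * 1))); last by rewrite mulr1 mul1r.
apply: ler_pM => //; first by rewrite !mulr_ge0// invr_ge0 ltW.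
rewrite -mulrA; apply: ler_pM => //; first by rewrite mulr_ge0// invr_ge0 ltW.
by rewrite ler_pdivrMl// mulr1 le_max lexx orbT.
Qed.

Lemma retract_continuous : continuous retract.
Proof.
move=> w; apply/cvgrPdist_le => e e0.
have cid : (fun y : E => y) @ w --> w by exact: cvg_id.
move/cvgrPdist_le : cid => /(_ _ (divr_gt0 e0 (ltr0Sn _ 1))); apply: filterS => y wy.
by apply: (le_trans (retract_lipschitz _ _)); lra.
Qed.

End Retraction.

(** * Multipliers *)

Section Multipliers.
Context {R : realType} {E : normedModType R} {l m q : nat}.
Variables (V : set E) (G0 : 'I_l -> dual E) (G : 'I_m -> dual E) (H : 'I_q -> dual E).
Variable act : 'I_m -> Prop.

(** Coordinates of inactive inequalities are left free. This forces their multipliers to vanish,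
    which is complementary slackness. *)
Definition image_cone : set ('I_l + 'I_m + 'I_q -> R^o) :=
  [set x | exists2 v, V v & [/\ forall i, x (inl (inl i)) <= G0 i v,
    forall a, act a -> x (inl (inr a)) <= G a v & forall b, x (inr b) = H b v]].

Lemma dual_sum (I : finType) (c : I -> R) (F : I -> dual E) v :
  (\sum_i c i *: F i) v = \sum_i c i * F i v.
Proof. by elim/big_rec2 : _ => // i y D _ <-. Qed.

Lemma image_cone_convex : convex_cone V -> convex_cone image_cone.
Proof.
move=> [V0 VD VZ]; split.
- by exists 0 => //; split => *; rewrite linear0.
- move=> x y [v Vv [x1 x2 x3]] [w Vw [y1 y2 y3]]; exists (v + w); first exact: VD.
  split => [i|a aa|b].
  + by rewrite linearD; apply: lerD; [exact: x1|exact: y1].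
  + by rewrite linearD; apply: lerD; [exact: x2|exact: y2].
  + by rewrite [LHS]/(x _ + y _) x3 y3 linearD.
- move=> c x c0 [v Vv [x1 x2 x3]]; exists (c *: v); first exact: VZ.
  split => [i|a aa|b].
  + by rewrite linearZ; apply: ler_wpM2l => //; exact: x1.
  + by rewrite linearZ; apply: ler_wpM2l => //; exact: x2.
  + by rewrite [LHS]/(c * x _) x3 linearZ.
Qed.

Lemma cone_multipliers : convex_cone V -> image_cone <> setT ->
  exists (th : {ffun 'I_l -> R}) (la : {ffun 'I_m -> R}) (mu : {ffun 'I_q -> R}),
  [/\ (th, la, mu) <> 0, (forall i, 0 <= th i) /\ (forall a, 0 <= la a),
      forall a, ~ act a -> la a = 0 &
      forall v, V v -> (\sum_i th i *: G0 i + \sum_a la a *: G a + \sum_b mu b *: H b) v <= 0].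
Proof.
move=> cV /(cone_separation (image_cone_convex cV))[nu [k nuk] nuC].
have [V0 _ _] := cV.
have split3 (x : 'I_l + 'I_m + 'I_q -> R^o) : \sum_i nu i * x i =
    \sum_i nu (inl (inl i)) * x (inl (inl i)) + \sum_a nu (inl (inr a)) * x (inl (inr a)) +
    \sum_b nu (inr b) * x (inr b).
  by rewrite !big_sumType.
pose unit_at j (c : R) : 'I_l + 'I_m + 'I_q -> R^o := fun i => c * (i == j)%:R.
have nu_unit j c : image_cone (unit_at j c) -> nu j * c <= 0.
  move=> /nuC; rewrite (bigD1 j)//= big1 ?addr0 /unit_at; first by rewrite eqxx mulr1.
  by move=> i /negbTE ->; rewrite !mulr0.
(* The zero vector of [V] dominates the negative unit vectors of objectives and inequalities; hence
   the signs of the multipliers. *)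
have unitN j : (if j is inr _ then false else true) -> image_cone (unit_at j (-1)).
  move=> jl; exists 0 => //; split => [i|a _|b]; rewrite linear0 /unit_at.
  - by rewrite mulN1r oppr_le0 ler0n.
  - by rewrite mulN1r oppr_le0 ler0n.
  - by case: j jl => // j _; rewrite mulr0.
pose th := [ffun i => nu (inl (inl i))]; pose la := [ffun a => nu (inl (inr a))].
pose mu := [ffun b => nu (inr b)]; exists th, la, mu.
have la0 a : ~ act a -> la a = 0.
  move=> na; rewrite ffunE; apply/eqP; move: (nu (inl (inr a))) (@nu_unit (inl (inr a))) => c hc.
  have act1 : image_cone (unit_at (inl (inr a)) 1).
    exists 0 => //; split => [i|a' aa'|b]; rewrite linear0 /unit_at ?mulr0//.
    by rewrite (_ : (_ == _) = false) ?mulr0//; apply/eqP => -[aE]; apply: na; rewrite -aE.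
  by rewrite eq_le; have := hc _ act1; have := hc _ (unitN (inl (inr a)) isT); lra.
split => //.
- case: k nuk => [[i|a]|b]; apply: contra_neq_not => -[tE lE mE].
  + by have := congr1 (fun h : {ffun _ -> _} => h i) tE; rewrite !ffunE.
  + by have := congr1 (fun h : {ffun _ -> _} => h a) lE; rewrite !ffunE.
  + by have := congr1 (fun h : {ffun _ -> _} => h b) mE; rewrite !ffunE.
- split => [i|a]; rewrite ffunE.
  + by have := nu_unit _ _ (unitN (inl (inl i)) isT); lra.
  + by have := nu_unit _ _ (unitN (inl (inr a)) isT); lra.
- move=> v Vv; have addE (D D' : dual E) : (D + D') v = D v + D' v by [].
  rewrite !addE !dual_sum.
  pose x : 'I_l + 'I_m + 'I_q -> R^o := fun i => match i with
    inl (inl i) => G0 i v | inl (inr a) => G a v | inr b => H b v end.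
  have /nuC : image_cone x by exists v.
  rewrite split3 /x; apply: le_trans; rewrite le_eqVlt; apply/orP; left; apply/eqP.
  by congr (_ + _ + _); apply: eq_bigr => i _; rewrite ffunE.
Qed.

End Multipliers.

Lemma DF_blin_comp {R : realType} {V W Z : normedModType R} (p : blin W Z) (F : V -> W) x :
  differentiable F x -> DF (fun v => p (F v)) x = blin_comp p (DF F x).
Proof.
move=> dF; have dp : differentiable p (F x).
  by apply: linear_differentiable; exact: blin_continuous.
apply: blinE => v; rewrite -DFE; last exact: (differentiable_comp dF dp).
have -> : (fun v => p (F v)) = p \o F by [].
rewrite diff_comp//= (DFE dF) diff_lin//; exact: blin_continuous.
Qed.

(** * Needle variations *)

Section Dynamics.
Context {R : realType} {E : completeNormedModType R} {Y : normedModType R}.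
Variables (T : R) (Omega : set E) (U : set Y) (f : R -> E -> Y -> E).
Hypothesis T0 : 0 <= T.
Hypothesis oOmega : open Omega.
Hypothesis f_cont : {within `[0, T] `*` Omega `*` U,
  continuous (fun z : R * E * Y => f z.1.1 z.1.2 z.2)}.
Hypothesis f_gat : forall t xi zeta, t \in `[0, T] -> Omega xi -> U zeta ->
  gateaux_differentiable (fun xi' => f t xi' zeta) xi.
Hypothesis f_bound : forall (K : set E) (M : set Y),
  K !=set0 -> compact K -> K `<=` Omega ->
  M !=set0 -> compact M -> M `<=` U ->
  (ereal_sup [set `|DG (fun xi => f z.1.1 xi z.2) z.1.2|%:E
             | z in (`[0%R, T] `*` K `*` M : set (R * E * Y))] < +oo)%E.

Lemma f_cvg {I : Type} (F : set_system I) {FF : Filter F}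
    (t : I -> R) (x : I -> E) (u : I -> Y) t0 x0 u0 :
  0 <= t0 <= T -> Omega x0 -> U u0 ->
  (\forall i \near F, 0 <= t i <= T) -> (\forall i \near F, U (u i)) ->
  t @ F --> t0 -> x @ F --> x0 -> u @ F --> u0 ->
  f (t i) (x i) (u i) @[i --> F] --> f t0 x0 u0.
Proof.
move=> t0T Ox0 Uu0 tT Uu tt0 xx0 uu0.
apply: (@within_continuous_cvg _ _ _ _ _ F _ (fun i => (t i, x i, u i)) (t0, x0, u0) f_cont).
- by split => //; split => //=; rewrite ?in_itv.
- have : \forall i \near F, Omega (x i) by apply: xx0; exact: open_nbhs_nbhs.
  apply: filterS3 tT Uu => i tT Uu Ox; split => //; split => //=.
- have h1 : (t i, x i) @[i --> F] --> (t0, x0) by exact: cvg_pair tt0 xx0.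
  exact: cvg_pair h1 uu0.
Qed.

(** If no local bound existed, there would be states and controls tending to [xi] and [zeta] along
    which the norms are unbounded. Together with their limits they form compact sets, contradicting
    [f_bound]. *)
Lemma DG_locally_bounded xi zeta : Omega xi -> U zeta ->
  exists2 r, 0 < r & exists C, forall t xi' zeta', 0 <= t <= T -> `|xi' - xi| < r ->
    `|zeta' - zeta| < r -> U zeta' ->
    Omega xi' /\ `|DG (fun x => f t x zeta') xi'| <= C.
Proof.
move=> Oxi Uz.
have /nbhs_ballP[r0 /= r00 r0O] : nbhs xi Omega by exact: open_nbhs_nbhs (conj oOmega Oxi).
apply: contrapT => /forallPNP h.
have dn n : 0 < Num.min r0 (n.+1%:R^-1) by rewrite lt_min r00 invr_gt0 ltr0n.
have hn n : exists z : R * E * Y, [/\ 0 <= z.1.1 <= T, `|z.1.2 - xi| < Num.min r0 n.+1%:R^-1,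
    `|z.2 - zeta| < Num.min r0 n.+1%:R^-1, U z.2 &
    n%:R < `|DG (fun x => f z.1.1 x z.2) z.1.2| ].
  apply: contrapT => /forallNP hz; apply: (h _ (dn n)); exists n%:R => t xi' zeta' tT x1 z1 Uz'.
  split; first by apply: r0O; rewrite -ball_normE /= distrC; move: x1; rewrite lt_min => /andP[].
  by rewrite leNgt; apply/negP => hlt; apply: (hz (t, xi', zeta')); split.
have [z zP] := choice hn.
have conv (V : normedModType R) (y : nat -> V) a :
    (forall n, `|y n - a| < Num.min r0 n.+1%:R^-1) -> y n @[n --> \oo] --> a.
  move=> ya; apply/cvgrPdist_le => e e0; near=> n.
  rewrite distrC; apply: (le_trans (ltW (ya n))); rewrite ge_min; apply/orP; right.
  by apply: ltW; near: n; exact: (near_infty_natSinv_lt (PosNum e0)).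
have z1 : (z n).1.2 @[n --> \oo] --> xi by apply: conv => n; have [] := zP n.
have z2 : (z n).2 @[n --> \oo] --> zeta by apply: conv => n; have [] := zP n.
have := f_bound (K := xi |` range (fun n => (z n).1.2)) (M := zeta |` range (fun n => (z n).2)).
move=> /(_ _ (cvg_seq_compact z1) _ _ (cvg_seq_compact z2) _)/wrap[||||].
- by exists xi; left.
- move=> _ [->//|[n _ <-]]; have [_ zn _ _ _] := zP n; apply: r0O.
  by rewrite -ball_normE /= distrC; move: zn; rewrite lt_min => /andP[].
- by exists zeta; left.
- by move=> _ [->//|[n _ <-]]; have [] := zP n.
set s := ereal_sup _ => sfin.
have [M sM] : exists M : R, (s <= M%:E)%E.
  by case: s sfin => [M _| |_]; [exists M|rewrite ltxx|exists 0; rewrite leNye].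
have [zT _ _ _ ] := zP (Num.truncn M).+1.
have : (`|DG (fun x => f (z (Num.truncn M).+1).1.1 x (z (Num.truncn M).+1).2)
    (z (Num.truncn M).+1).1.2|%:E <= s)%E.
  apply: ereal_sup_ubound; exists (z (Num.truncn M).+1) => //.
  split; last by right; exists (Num.truncn M).+1.
  split; last by right; exists (Num.truncn M).+1.
  by rewrite /= in_itv.
move=> /le_trans/(_ sM); rewrite lee_fin => h1 h2.
have := truncnS_gt M; lra.
Unshelve. all: by end_near. Qed.

Definition tube (r L : R) (x : R -> E) (v : R -> Y) (t : R) := forall xi, `|xi - x t| < r ->
  Omega xi /\ `|DG (fun x' => f t x' (v t)) xi| <= L.

(** Near each time the control is close to its value on the right and to its left limit on the left.
    Both lie in [U], so the local bounds apply, and local real induction assembles them. *)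
Lemma tube_exists (x : R -> E) (v : R -> Y) : continuous x ->
  (forall t, 0 <= t <= T -> Omega (x t)) -> cadlag T U v ->
  exists2 r, 0 < r & exists L, forall t, 0 <= t <= T -> tube r L x v t.
Proof.
move=> cx Ox [vU vr vl].
have sub r r' L L' t : r <= r' -> L' <= L -> tube r' L' x v t -> tube r L x v t.
  move=> rr' LL' h xi xit; have [? hL] := h xi (lt_le_trans xit rr').
  by split=> //; exact: le_trans LL'.
have loc t zeta : 0 <= t <= T -> U zeta -> exists2 r, 0 < r & exists2 d, 0 < d & exists L,
    forall s, 0 <= s <= T -> `|t - s| < d -> `|zeta - v s| < r -> tube (r / 2) L x v s.
  move=> tT Uz; have [r r0 [L rL]] := DG_locally_bounded (Ox _ tT) Uz.
  have /cvgrPdist_lt/(_ (r / 2) (divr_gt0 r0 (ltr0Sn _ 1)))/nbhs_ballP[d /= d0 dx] := cx t.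
  exists r => //; exists d => //; exists L => s sT sd sr xi xis.
  apply: rL => //; last 2 first.
  - by rewrite distrC.
  - exact: vU.
  rewrite -(subrKA (x s)) (le_lt_trans (ler_normD _ _))//.
  have := dx s; rewrite -ball_normE /= => /(_ sd); rewrite [`|x s - x t|]distrC; lra.
suff : exists2 r, 0 < r & exists L, forall t, 0 <= t <= T -> tube r L x v t by [].
apply: (@real_induction_local _ (fun s => exists2 r, 0 < r & exists L,
  forall t, 0 <= t <= s -> tube r L x v t) 0 T T0).
  have h00 : 0 <= (0 : R) <= T by rewrite lexx.
  have [r r0 [d d0 [L rL]]] := loc 0 (v 0) h00 (vU 0 h00).
  exists (r / 2); first by rewrite divr_gt0.
  by exists L => t /le_anti <-; apply: rL; rewrite ?subrr ?normr0.
move=> t /andP[t0 tT]; have t0T : 0 <= t <= T by rewrite t0.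
have [r1 r10 [d1 d10 [L1 P1]]] : exists2 r, 0 < r & exists2 d, 0 < d & exists L,
    forall s, 0 <= s -> t - d < s < t -> tube r L x v s.
  have [tE|t_neq0] := eqVneq t 0.
    by exists 1 => //; exists 1 => //; exists 0 => s s0 /andP[_]; rewrite tE ltNge s0.
  have [|z Uz zP] := vl t; first by rewrite lt_neqAle eq_sym t_neq0 t0.
  have [r r0 [d d0 [L rL]]] := loc t z t0T Uz.
  have /near_left[d' d'0 dP] : \forall s \near t^'-, `|z - v s| < r by exact: cvgr_dist_lt.
  exists (r / 2); first by rewrite divr_gt0.
  exists (Num.min d d'); first by rewrite lt_min d0.
  exists L => s s0 /andP[ds st]; move: ds; rewrite ltrBlDr -ltrBlDl lt_min => /andP[h1 h2].
  apply: rL; [apply/andP; split; lra|rewrite gtr0_norm; lra|apply: dP; apply/andP; split; lra].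
have [r2 r20 [d2 d20 [L2 P2]]] : exists2 r, 0 < r & exists2 d, 0 < d & exists L,
    forall s, s <= T -> t <= s < t + d -> tube r L x v s.
  have [r r0 [d d0 [L rL]]] := loc t (v t) t0T (vU t t0T).
  have [tT'|Tt] := ltP t T; last first.
    exists (r / 2); first by rewrite divr_gt0.
    exists 1 => //; exists L => s sT /andP[ts _]; have -> : s = t by lra.
    by apply: rL; rewrite ?subrr ?normr0.
  have /near_right[d' d'0 dP] : \forall s \near t^'+, `|v t - v s| < r.
    by apply: cvgr_dist_lt => //; apply: vr; rewrite t0.
  exists (r / 2); first by rewrite divr_gt0.
  exists (Num.min d d'); first by rewrite lt_min d0.
  exists L => s sT /andP[ts]; rewrite -ltrBlDl lt_min => /andP[h1 h2].
  apply: rL; [apply/andP; split; lra|rewrite distrC ger0_norm; lra|].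
  have [->|st] := eqVneq s t; first by rewrite subrr normr0.
  by apply: dP; rewrite lt_neqAle eq_sym st ts /=; lra.
exists (Num.min d1 d2) => [|s s' s0 s'T]; first by rewrite lt_min d10.
rewrite ltrBlDr -ltrBlDl lt_min => /andP[h1 h2] st ts'.
rewrite -ltrBlDl lt_min => /andP[h3 h4] [r r0 [L rL]].
exists (Num.min r (Num.min r1 r2)); first by rewrite !lt_min r0 r10.
exists (Num.max L (Num.max L1 L2)) => u /andP[u0 us'].
have [us|su] := leP u s.
  by apply: (sub _ r _ L); [rewrite ge_min lexx|rewrite le_max lexx|apply: rL; rewrite u0].
have [ut|tu] := ltP u t.
  apply: (sub _ r1 _ L1); [rewrite !ge_min lexx orbT//|rewrite !le_max lexx orbT//|].
  by apply: P1 => //; apply/andP; split; lra.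
apply: (sub _ r2 _ L2); [rewrite !ge_min lexx !orbT//|rewrite !le_max lexx !orbT//|].
by apply: P2 => //; [lra|apply/andP; split; lra].
Qed.

(** Along the segment from [xi'] to [xi], which stays in the ball, the Gateaux differential is
    exactly the right derivative needed for the mean value inequality. *)
Lemma tube_lipschitz r L (x : R -> E) (v : R -> Y) t xi xi' : 0 <= t <= T -> U (v t) ->
  tube r L x v t -> `|xi - x t| < r -> `|xi' - x t| < r ->
  `|f t xi (v t) - f t xi' (v t)| <= L * `|xi - xi'|.
Proof.
move=> tT Uv tub xir xir'.
have L0 : 0 <= L by have [_] := tub xi xir; apply: le_trans.
have inb s : 0 <= s <= 1 -> `|xi' + s *: (xi - xi') - x t| < r.
  move=> /andP[s0 s1].
  have -> : xi' + s *: (xi - xi') - x t = (1 - s) *: (xi' - x t) + s *: (xi - x t).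
    have comb (a b : E) : (1 - s) *: a + s *: b = a + s *: (b - a).
      by rewrite scalerBl scale1r scalerBr addrA addrAC.
    rewrite comb addrAC; congr (_ + _ *: _).
    by rewrite opprB addrA subrK.
  apply: (le_lt_trans (ler_normD _ _)); rewrite !normrZ !ger0_norm ?subr_ge0//.
  have [s00|s_neq0] := eqVneq s 0; first by rewrite s00; lra.
  have sp : 0 < s by rewrite lt_neqAle eq_sym s_neq0.
  have : s * `|xi - x t| < s * r by rewrite ltr_pM2l.
  have : (1 - s) * `|xi' - x t| <= (1 - s) * r by rewrite ler_wpM2l ?subr_ge0// ltW.
  lra.
pose phi s := f t (xi' + s *: (xi - xi')) (v t).
have -> : f t xi (v t) - f t xi' (v t) = phi 1 - phi 0.
  by rewrite /phi scale1r subrKC scale0r addr0.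
rewrite -[leRHS]mulr1 -[X in _ * X]subr0; apply: rderiv_mvi => //.
- by rewrite mulr_ge0.
- move=> s s01; have [Os _] := tub _ (inb s s01).
  apply: f_cvg => //; [exact: nearW|exact: nearW|exact: cvg_cst| |exact: cvg_cst].
  apply: cvgD; first exact: cvg_cst.
  by apply: cvgZl; exact: cvg_id.
- move=> s /andP[s0 s1]; have s01 : 0 <= s <= 1 by rewrite s0 ltW.
  have [Os Ds] := tub _ (inb s s01).
  exists (DG (fun x' => f t x' (v t)) (xi' + s *: (xi - xi')) (xi - xi')).
    have tT' : t \in `[0, T] by rewrite in_itv.
    have /(@xgetPex _ 0)/(_ (xi - xi')) := f_gat tT' Os Uv.
    rewrite /rderiv; apply: cvg_trans; apply: near_eq_cvg; near=> h.
    by rewrite /phi scalerDl addrA.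
  by apply: (le_trans (blin_normP _ _)); rewrite ler_wpM2r.
Unshelve. all: by end_near. Qed.

Variables (x0 : R -> E) (u0 : R -> Y) (D : seq R).
Hypothesis x0_cont : continuous x0.
Hypothesis x0_Omega : forall t, 0 <= t <= T -> Omega (x0 t).
Hypothesis u0_cadlag : cadlag T U u0.
Hypothesis u0_D : forall t, 0 < t < T -> t \notin D -> {for t, continuous u0}.
Hypothesis f_diff : forall t zeta, t \in `[0, T] -> U zeta ->
  differentiable (fun xi => f t xi zeta) (x0 t).
Hypothesis df_cont : {within `[0, T] `*` U,
  continuous (fun z : R * Y => DF (fun xi => f z.1 xi z.2) (x0 z.1))}.

Definition linearization (t : R) : blin E E := DF (fun xi => f t xi (u0 t)) (x0 t).
Local Notation A := linearization.

Lemma df_cvg {I : Type} (F : set_system I) {FF : Filter F}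
    (t : I -> R) (u : I -> Y) t1 u1 : 0 <= t1 <= T -> U u1 ->
  (\forall i \near F, 0 <= t i <= T) -> (\forall i \near F, U (u i)) ->
  t @ F --> t1 -> u @ F --> u1 ->
  DF (fun xi => f (t i) xi (u i)) (x0 (t i)) @[i --> F] --> DF (fun xi => f t1 xi u1) (x0 t1).
Proof.
move=> t1T Uu1 tT Uu tt1 uu1.
apply: (@within_continuous_cvg _ _ _ _ _ F _ (fun i => (t i, u i)) (t1, u1) df_cont).
- by split => //=; rewrite in_itv.
- by apply: filterS2 tT Uu => i tT Uu; split => //=; rewrite in_itv.
- exact: cvg_pair tt1 uu1.
Qed.

Lemma near_right_itv t : 0 <= t < T -> \forall s \near t^'+, 0 <= s <= T.
Proof.
move=> /andP[t0 tT]; apply/near_right; exists (T - t); first by rewrite subr_gt0.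
by move=> s /andP[ts st]; apply/andP; split; lra.
Qed.

Lemma near_left_itv t : 0 < t <= T -> \forall s \near t^'-, 0 <= s <= T.
Proof.
move=> /andP[t0 tT]; apply/near_left; exists t => //.
by move=> s /andP[ts st]; apply/andP; split; lra.
Qed.

Lemma linearization_cadlag : cadlag T setT A.
Proof.
have [u0U u0r u0l] := u0_cadlag.
split => // t tT.
  have tT' : 0 <= t <= T by have /andP[-> /ltW] := tT.
  apply: df_cvg => //; [exact: u0U|exact: near_right_itv| | |exact: u0r].
    by apply: filterS (near_right_itv tT) => s sT; exact: u0U.
  by apply: cvg_at_right_filter; exact: cvg_id.
have [z Uz uz] := u0l t tT.
exists (DF (fun xi => f t xi z) (x0 t)) => //.
have tT' : 0 <= t <= T by have /andP[/ltW -> ->] := tT.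
apply: df_cvg => //; [exact: near_left_itv| |].
  by apply: filterS (near_left_itv tT) => s sT; exact: u0U.
by apply: cvg_at_left_filter; exact: cvg_id.
Qed.

Lemma near_itv t : 0 < t < T -> \forall s \near t, 0 < s < T.
Proof.
move=> /andP[t0 tT]; near=> s; apply/andP; split; near: s.
  exact: lt_nbhsr.
exact: lt_nbhsl.
Unshelve. all: by end_near. Qed.

Lemma linearization_continuous t : 0 < t < T -> t \notin D -> {for t, continuous A}.
Proof.
move=> tT tD; have [u0U _ _] := u0_cadlag.
have tT' : 0 <= t <= T by have /andP[/ltW -> /ltW ->] := tT.
have nt : \forall s \near t, 0 <= s <= T.
  by apply: filterS (near_itv tT) => s /andP[/ltW -> /ltW ->].
apply: df_cvg => //; [exact: u0U| |exact: u0_D].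
by apply: filterS nt => s sT; exact: u0U.
Qed.

Definition frechet_remainder t w :=
  f t (x0 t + w) (u0 t) - f t (x0 t) (u0 t) - A t w.

(** * The Frechet remainder is small in the mean *)

Section SmallRemainder.
Variables (r L : R).
Hypothesis r_gt0 : 0 < r.
Hypothesis tubeP : forall t, 0 <= t <= T -> tube r L x0 u0 t.

(** The value 0 keeps the set non-empty when [E] is trivial and its supremum nonnegative. The
    denominator [n.+2] keeps the radius strictly below that of the tube, even for [n = 0]. *)
Let remainder_quotients n t := [set q | q = 0 \/ exists2 w, 0 < `|w| <= r / n.+2%:R &
  q = `|frechet_remainder t w| / `|w| ].
Let rho n t := sup (remainder_quotients n t).

Let r_n n : 0 < r / n.+2%:R < r.
Proof.
rewrite divr_gt0 ?ltr0n//= ltr_pdivrMr ?ltr0n// ltr_pMr// ltr1n//.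
Qed.

(** In the tube [f] is Lipschitz with constant [L], and the linearization is bounded by [c]; hence
    the bound [L + c]. *)
Let bound : exists2 C, 0 <= C & forall n t q, 0 <= t <= T -> remainder_quotients n t q ->
  0 <= q <= C.
Proof.
have [c c0 cP] := cadlag_bounded T0 linearization_cadlag.
have [u0U _ _] := u0_cadlag.
have L0 : 0 <= L.
  have h00 : 0 <= (0 : R) <= T by rewrite lexx.
  have [|_] := tubeP h00 (xi := x0 0); first by rewrite subrr normr0.
  by apply: le_trans.
exists (L + c) => [|n t q tT [->|[w /andP[w0 wr] ->]]]; first by rewrite addr_ge0.
  by rewrite lexx addr_ge0.
rewrite divr_ge0//= ler_pdivrMr// mulrDl /frechet_remainder (le_trans (ler_normB _ _))//.
apply: lerD.
  have /andP[_ rr] := r_n n.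
  have -> : L * `|w| = L * `|x0 t + w - x0 t| by rewrite addrAC subrr add0r.
  apply: (tube_lipschitz (r := r)) => //; [exact: u0U|exact: tubeP| |].
    by rewrite addrAC subrr add0r (le_lt_trans wr).
  by rewrite subrr normr0.
by apply: (le_trans (blin_normP _ _)); rewrite ler_wpM2r// cP.
Qed.

Let hs n t : 0 <= t <= T -> has_sup (remainder_quotients n t).
Proof.
move=> tT; split; first by exists 0; left.
by have [C _ CP] := bound; exists C => q qt; have /andP[] := CP n t q tT qt.
Qed.

(* Near [t], within the filter [F], a quotient at [t] persists: this is the
   lower semicontinuity of the supremum [rho n]. *)
Let rho_lsc n t (F : set_system R) (FF : Filter F) : 0 <= t <= T ->
  F --> t -> u0 @ F --> u0 t -> (\forall s \near F, 0 <= s <= T) ->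
  forall a, a < rho n t -> \forall s \near F, a < rho n s.
Proof.
move=> tT Ft Fu FT a at_; have [u0U _ _] := u0_cadlag.
have [|q qt aq] := @sup_adherent _ _ (rho n t - a) _ (hs n tT); first by rewrite subr_gt0.
move: aq; rewrite opprB addrCA subrr addr0 => aq.
case: qt aq => [->|[w /andP[w0 wr] ->]] aq.
  apply: filterS FT => s sT; apply: (lt_le_trans aq).
  by apply: (ub_le_sup (hs n sT).2); left.
have FU : \forall s \near F, U (u0 s) by apply: filterS FT => s; exact: u0U.
have Ow s : 0 <= s <= T -> Omega (x0 s + w).
  move=> sT; have [|//] := tubeP sT (xi := x0 s + w).
  by rewrite addrAC subrr add0r (le_lt_trans wr)//; have /andP[] := r_n n.
have Fx : x0 @ F --> x0 t by apply: cvg_comp Ft _; exact: x0_cont.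
have : `|frechet_remainder s w| / `|w| @[s --> F] --> `|frechet_remainder t w| / `|w|.
  apply: cvgM; last exact: cvg_cst.
  apply: cvg_norm; apply: cvgB.
    apply: cvgB; apply: f_cvg => //; [exact: Ow|exact: u0U| |exact: x0_Omega|exact: u0U].
    by apply: cvgD => //; exact: cvg_cst.
  apply: (cvg_bilinear (@blin_app_bilinear R E E)); last exact: cvg_cst.
  by apply: df_cvg => //; exact: u0U.
move=> /cvgr_gt/(_ _ aq) H; apply: filterS2 FT H => s sT sq; apply: (lt_le_trans sq).
by apply: (ub_le_sup (hs n sT).2); right; exists w => //; rewrite w0.
Qed.

Let rho_cvg0 t : 0 <= t <= T -> rho n t @[n --> \oo] --> 0.
Proof.
move=> tT; have [u0U _ _] := u0_cadlag; apply/cvgrPdist_le => e e0.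
have tT' : t \in `[0, T] by rewrite in_itv.
have [d d0 dP] := DF_remainder (f_diff tT' (u0U t tT)) e0.
near=> n.
have rd : r / n.+2%:R < d.
  rewrite ltr_pdivrMr ?ltr0n// -ltr_pdivrMl//.
  have : r / d < n.+1%:R.
    by near: n; apply: filterS (nbhs_infty_gtr (r / d)) => k /lt_trans; apply; rewrite ltr_nat.
  by rewrite mulrC => /lt_trans; apply; rewrite ltr_nat.
rewrite sub0r normrN ger0_norm; last first.
  by apply: (ub_le_sup (hs n tT).2); left.
apply: ge_sup; first exact: (hs n tT).1.
move=> _ [->|[w /andP[w0 wr] ->]]; first exact: ltW.
by rewrite ler_pdivrMr//; apply: dP; rewrite (le_lt_trans wr).
Unshelve. all: by end_near. Qed.

(** The remainder gets a Lipschitz factor [c] that depends on time and whose primitive [psi] has a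
    small total increment. This is what replaces a remainder uniformly small in [t]. *)
Lemma remainder_small e : 0 < e -> exists2 d, 0 < d & exists psi : R -> R,
  [/\ forall t, 0 <= t <= T -> {for t, continuous psi}, psi T - psi 0 <= e &
      forall t, 0 <= t < T -> exists c, [/\ 0 <= c, dini_ge psi t c &
        forall w, `|w| <= d -> `|frechet_remainder t w| <= c * `|w| ] ].
Proof.
move=> e0; have [C C0 CP] := bound.
(* [rho n] is known to be lower semicontinuous at the continuity times of [u0]. Being nonnegative,
   it remains so when replaced by 0 outside the open set of times left after removing [D]. *)
pose g n t := if (0 < t < T) && (t \notin D) then rho n t else 0.
have rho0 n t : 0 <= t <= T -> 0 <= rho n t.
  by move=> tT; apply: (ub_le_sup (hs n tT).2); left.
have itvW t : 0 < t < T -> 0 <= t <= T by move=> /andP[/ltW -> /ltW ->].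
have nD (D' : seq R) t : t \notin D' -> \forall s \near t, s \notin D'.
  elim: D' => [_|d D' IH]; first by apply: filterE.
  rewrite inE negb_or => /andP[td /IH tD].
  have td0 : 0 < `|t - d| by rewrite normr_gt0 subr_eq0.
  have : \forall s \near t, s != d.
    apply/nbhs_ballP; exists `|t - d| => //= s; rewrite -ball_normE /=.
    by apply: contraTneq => ->; rewrite ltxx.
  by apply: filterS2 tD => s sD sd; rewrite inE negb_or sd.
have gC n t : 0 <= g n t <= C.
  rewrite /g; case: ifP => [/andP[/itvW tT _]|_]; last by rewrite lexx.
  rewrite rho0//=; apply: ge_sup; first exact: (hs n tT).1.
  by move=> q /(CP n t q tT)/andP[].
have glsc n : lower_semicontinuous (fun t => (g n t)%:E).
  move=> t a at_E; have at_ : a < g n t by rewrite -lte_fin.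
  have [a0|a0] := ltP a 0.
    exists setT; first exact: filterT.
    move=> s _; have as_ : a < g n s by apply: (lt_le_trans a0); have /andP[] := gC n s.
    by rewrite -lte_fin in as_.
  move: at_; rewrite {1}/g; case: ifP => [/andP[tT tD] at_|_]; last by rewrite ltNge a0.
  have nt : \forall s \near t, 0 <= s <= T by apply: filterS (near_itv tT) => s /itvW.
  have h := rho_lsc (F := nbhs t) (nbhs_filter t) (itvW _ tT) (@cvg_id _ (nbhs t)) (u0_D tT tD) nt at_.
  exists [set s | a < g n s] => [|s /= as_]; last by rewrite -lte_fin in as_.
  by apply: filterS3 h (near_itv tT) (nD D t tD) => s; rewrite /g /= => ? -> ->.
have gcvg t : g n t @[n --> \oo] --> 0.
  have [ct|cf] := boolP ((0 < t < T) && (t \notin D)).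
    rewrite (_ : g^~ t = rho^~ t); last by apply/funext => n; rewrite /g ct.
    by apply: rho_cvg0; case/andP: ct => /itvW.
  rewrite (_ : g^~ t = (fun=> 0)); first exact: cvg_cst.
  by apply/funext => n; rewrite /g (negbTE cf).
have [n [psi [cpsi psie dpsi]]] := lsc_majorant T0 gC glsc gcvg e0.
exists (r / n.+2%:R); first by have /andP[] := r_n n.
exists psi; split => // t tT.
have tT' : 0 <= t <= T by have /andP[-> /ltW] := tT.
exists (rho n t); split; first exact: rho0.
  apply: dpsi => [|d d0]; first by have /andP[] := tT.
  have [_ u0r _] := u0_cadlag.
  have rd : rho n t - d < rho n t by rewrite ltrBlDr ltrDl.
  have h : \forall s \near t^'+, rho n t - d < rho n s.
    apply: rho_lsc rd => //; [|exact: u0r|exact: near_right_itv].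
    by apply: cvg_at_right_filter; exact: cvg_id.
  (* Just to the right of [t] there is no point of [D], so [g n] agrees with [rho n] there, even if
     [t] is [0] or belongs to [D]. *)
  have {}h : \forall s \near t^'+, rho n t - d <= g n s.
    have [d' d'0 d'D] : exists2 d', 0 < d' & forall s, t < s < t + d' -> s \notin D.
      elim: (D) => [|b D' [d' d'0 IH]]; first by exists 1.
      have [tb|bt] := ltP t b.
        exists (Num.min d' (b - t)); first by rewrite lt_min d'0 subr_gt0.
        move=> s /andP[ts]; rewrite -ltrBlDl lt_min => /andP[h1 h2].
        rewrite inE negb_or IH ?andbT ?ts/=; last lra.
        by rewrite lt_eqF//; lra.
      exists d' => // s /[dup] sd' /andP[ts _].
      by rewrite inE negb_or IH// andbT gt_eqF// (le_lt_trans bt).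
    have /near_right[d2 d20 d2P] := h.
    apply/near_right; exists (Num.min (Num.min d' d2) (T - t)).
      by rewrite !lt_min d'0 d20 subr_gt0; have /andP[] := tT.
    move=> s /andP[ts]; rewrite -ltrBlDl !lt_min => /andP[/andP[h1 h2] h3].
    have /andP[t0 _] := tT.
    rewrite /g (d'D s) ?andbT; last by rewrite ts /=; lra.
    have -> : 0 < s < T by apply/andP; split; lra.
    by apply: ltW; apply: d2P; rewrite ts /=; lra.
  move: h => /near_right[d' d'0 d'P]; apply/near0_right; exists d' => // s /andP[s0 sd].
  by apply: d'P; rewrite ltrDl s0 ltrD2l.
move=> w wd; have [->|w0] := eqVneq w 0.
  by rewrite /frechet_remainder addr0 linear0 subr0 subrr !normr0 mulr0.
rewrite -ler_pdivrMr ?normr_gt0//; apply: (ub_le_sup (hs n tT').2).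
by right; exists w => //; rewrite normr_gt0 w0.
Unshelve. all: by end_near. Qed.

End SmallRemainder.

Hypothesis T_gt0 : 0 < T.
Hypothesis u0_T : u0 r @[r --> T^'-] --> u0 T.
Hypothesis x0_sol : forall t, 0 <= t < T -> rderiv x0 t (f t (x0 t) (u0 t)).
Variables (S Q : R -> blin E E).
Hypothesis S_cont : continuous S.
Hypothesis Q_cont : continuous Q.
Hypothesis dS : forall t, 0 <= t < T -> rderiv S t (blin_comp (A t) (S t)).
Hypothesis dQ : forall t, 0 <= t < T -> rderiv Q t (- blin_comp (Q t) (A t)).
Hypothesis SQ : forall t, 0 <= t <= T -> blin_comp (S t) (Q t) = blin_id.

(** * Trajectories of needle controls and their first-order expansion *)

Section Needles.
Variables (N : nat) (zeta : 'I_N -> Y) (r L : R).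
Hypothesis zetaU : forall j, U (zeta j).
Hypothesis r_gt0 : 0 < r.
Hypothesis tube_u0 : forall t, 0 <= t <= T -> tube r L x0 u0 t.
Hypothesis tube_zeta : forall j t, 0 <= t <= T -> tube r L x0 (fun=> zeta j) t.

Definition mixed (v : R -> Y) := forall t, v t = u0 t \/ exists j, v t = zeta j.

Let r2_gt0 : 0 < r / 2. Proof. by rewrite divr_gt0. Qed.

(* Outside a tube around [x0] the dynamics is replaced by its value at the radial
   projection, which makes it globally Lipschitz. *)
Definition cutoff (v : R -> Y) t xi := f t (x0 t + retract (r / 2) (xi - x0 t)) (v t).

Lemma cutoff_id v t xi : `|xi - x0 t| <= r / 2 -> cutoff v t xi = f t xi (v t).
Proof. by move=> h; rewrite /cutoff retract_id// subrKC. Qed.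

Let ret_lt t (w : E) : `|x0 t + retract (r / 2) w - x0 t| < r.
Proof.
rewrite addrAC subrr add0r (le_lt_trans (retract_norm r2_gt0 _))//.
have := r_gt0; lra.
Qed.

Let mixed_tube v t : mixed v -> 0 <= t <= T -> tube r L x0 v t.
Proof.
move=> mv tT; rewrite /tube; case: (mv t) => [->|[j ->]]; first exact: tube_u0.
exact: tube_zeta.
Qed.

Let mixed_U v t : mixed v -> 0 <= t <= T -> U (v t).
Proof.
have [u0U _ _] := u0_cadlag.
by move=> mv tT; case: (mv t) => [->|[j ->]]; [exact: u0U|exact: zetaU].
Qed.

Lemma tube_constant_ge0 : 0 <= L.
Proof.
have h00 : 0 <= (0 : R) <= T by rewrite lexx.
have [|_] := tube_u0 h00 (xi := x0 0); first by rewrite subrr normr0.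
by apply: le_trans.
Qed.

Lemma cutoff_lipschitz v t xi xi' : mixed v -> 0 <= t <= T ->
  `|cutoff v t xi - cutoff v t xi'| <= 2 * L * `|xi - xi'|.
Proof.
move=> mv tT.
apply: (le_trans (tube_lipschitz tT (mixed_U mv tT) (mixed_tube mv tT) (ret_lt _ _) (ret_lt _ _))).
rewrite opprD addrACA subrr add0r.
have := retract_lipschitz r2_gt0 (xi - x0 t) (xi' - x0 t).
move=> /(ler_wpM2l tube_constant_ge0).
rewrite (_ : xi - x0 t - (xi' - x0 t) = xi - xi'); last by rewrite opprB addrA subrK.
by rewrite mulrA [L * 2]mulrC.
Qed.

Lemma cutoff_cadlag v x : mixed v -> cadlag T U v -> continuous x ->
  cadlag T setT (fun t => cutoff v t (x t)).
Proof.
move=> mv [vU vr vl] cx.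
have cret : continuous (fun t => x0 t + retract (r / 2) (x t - x0 t)).
  move=> t; apply: cvgD; first exact: x0_cont.
  apply: (@cvg_comp _ _ _ (fun t => x t - x0 t) (retract (r / 2))); last first.
    exact: retract_continuous.
  by apply: cvgB; [exact: cx|exact: x0_cont].
have inO t : 0 <= t <= T -> Omega (x0 t + retract (r / 2) (x t - x0 t)).
  by move=> tT; have [] := tube_u0 tT (ret_lt t (x t - x0 t)).
split => // t tT.
  have tT' : 0 <= t <= T by have /andP[-> /ltW] := tT.
  apply: f_cvg => //; [exact: inO|exact: vU|exact: near_right_itv| | | |exact: vr].
  - by apply: filterS (near_right_itv tT) => s sT; exact: vU.
  - by apply: cvg_at_right_filter; exact: cvg_id.
  - by apply: cvg_at_right_filter; exact: cret.
have [z Uz vz] := vl t tT.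
have tT' : 0 <= t <= T by have /andP[/ltW -> ->] := tT.
exists (f t (x0 t + retract (r / 2) (x t - x0 t)) z) => //.
apply: f_cvg => //; [exact: inO|exact: (near_left_itv tT)| | |].
- by apply: filterS (near_left_itv tT) => s sT; exact: vU.
- by apply: cvg_at_left_filter; exact: cvg_id.
- by apply: cvg_at_left_filter; exact: cret.
Qed.

Let const_cadlag z : U z -> cadlag T U (fun=> z).
Proof. by move=> Uz; apply: continuous_cadlag => // t; exact: cvg_cst. Qed.

Lemma cutoff_bound : exists2 M, 0 <= M & forall v t xi, mixed v -> 0 <= t <= T ->
  `|cutoff v t xi| <= M.
Proof.
have path_cadlag v : cadlag T U v -> cadlag T setT (fun t => f t (x0 t) (v t)).
  move=> [vU vr vl]; split => // t tT.
    have tT' : 0 <= t <= T by have /andP[-> /ltW] := tT.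
    apply: f_cvg => //; [exact: x0_Omega|exact: vU|exact: near_right_itv| | | |exact: vr].
    - by apply: filterS (near_right_itv tT) => s sT; exact: vU.
    - by apply: cvg_at_right_filter; exact: cvg_id.
    - by apply: cvg_at_right_filter; exact: x0_cont.
  have [z Uz vz] := vl t tT.
  have tT' : 0 <= t <= T by have /andP[/ltW -> ->] := tT.
  exists (f t (x0 t) z) => //.
  apply: f_cvg => //; [exact: x0_Omega|exact: (near_left_itv tT)| | |].
  - by apply: filterS (near_left_itv tT) => s sT; exact: vU.
  - by apply: cvg_at_left_filter; exact: cvg_id.
  - by apply: cvg_at_left_filter; exact: x0_cont.
have [c0 c00 c0P] := cadlag_bounded T0 (path_cadlag _ u0_cadlag).
have zb j : exists c, 0 <= c /\ forall t, 0 <= t <= T -> `|f t (x0 t) (zeta j)| <= c.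
  by have [c c0' cP] := cadlag_bounded T0 (path_cadlag _ (const_cadlag (zetaU j))); exists c.
have [c cP] := choice zb.
have sc0 : 0 <= \sum_j c j by apply: sumr_ge0 => j _; have [] := cP j.
have L0 := tube_constant_ge0.
exists (c0 + \sum_j c j + L * r) => [|v t xi mv tT].
  by rewrite !addr_ge0// mulr_ge0// ltW.
have b1 : `|f t (x0 t) (v t)| <= c0 + \sum_j c j.
  case: (mv t) => [->|[j ->]]; first by rewrite (le_trans (c0P t tT))// lerDl.
  have [_ cj] := cP j; rewrite (le_trans (cj t tT))// (bigD1 j)//= addrCA lerDl.
  by rewrite addr_ge0// sumr_ge0// => i _; have [] := cP i.
have x0t : `|x0 t - x0 t| < r by rewrite subrr normr0.
have := tube_lipschitz tT (mixed_U mv tT) (mixed_tube mv tT) (ret_lt t (xi - x0 t)) x0t.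
have : L * `|x0 t + retract (r / 2) (xi - x0 t) - x0 t| <= L * r.
  by rewrite ler_wpM2l// ltW.
rewrite -/(cutoff v t xi) => h1 h2.
rewrite -(subrK (f t (x0 t) (v t)) (cutoff v t xi)) (le_trans (ler_normD _ _))//.
rewrite addrC; apply: lerD => //; exact: le_trans h2 h1.
Qed.

Definition trajectory (v : R -> Y) x :=
  [/\ continuous x, x 0 = x0 0 & forall t, 0 <= t < T -> rderiv x t (cutoff v t (x t))].

Lemma trajectory_exists v : mixed v -> cadlag T U v -> exists x, trajectory v x.
Proof.
move=> mv cv; apply: (cauchy_lipschitz (L := 2 * L) (F := cutoff v)) => //.
- by rewrite mulr_ge0// tube_constant_ge0.
- by move=> t xi xi' /andP[t0 /ltW tT]; apply: cutoff_lipschitz => //; rewrite t0.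
- by move=> x cx; exact: cutoff_cadlag.
Qed.

Lemma trajectory_x0 : trajectory u0 x0.
Proof.
split => // t tT; rewrite cutoff_id; first exact: x0_sol.
by rewrite subrr normr0 ltW.
Qed.

Local Notation needle := (needle u0 zeta).

Lemma needle_mixed al be : mixed (needle al be).
Proof. exact: needleP. Qed.

Lemma trajectory_lipschitz : exists2 C, 0 <= C & forall al be al' be' x x',
  trajectory (needle al be) x -> trajectory (needle al' be') x' ->
  forall t, 0 <= t <= T ->
  `|x t - x' t| <= C * \sum_j (`|al j - al' j| + `|be j - be' j|).
Proof.
have [M M0 MP] := cutoff_bound; have L0 := tube_constant_ge0.
have L20 : 0 <= 2 * L by rewrite mulr_ge0.
exists (expR (2 * L * T) * (2 * M)) => [|al be al' be' x x' [cx x00 dx] [cx' x00' dx'] t /andP[t0 tT]].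
  by rewrite mulr_ge0 ?expR_ge0// mulr_ge0.
pose lo (a b : R) := Num.min a b; pose hi (a b : R) := Num.max a b.
pose p j s := ramp (lo (al j) (al' j)) (hi (al j) (al' j)) s +
  ramp (lo (be j) (be' j)) (hi (be j) (be' j)) s.
pose psi s := 2 * M * \sum_j p j s.
have lohi a b : lo a b <= hi a b by rewrite ge_min !le_max lexx.
have ramp_len a b : ramp (lo a b) (hi a b) t - ramp (lo a b) (hi a b) 0 <= `|a - b|.
  have /andP[h1 h2] := ramp_itv t (lohi a b); have /andP[h3 h4] := ramp_itv 0 (lohi a b).
  have := addr_max_min a b; have := maxr_absE a b; rewrite /lo /hi in h1 h2 h3 h4 *; lra.
have psiT : psi t - psi 0 <= 2 * M * \sum_j (`|al j - al' j| + `|be j - be' j|).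
  rewrite /psi -mulrBr -sumrB ler_wpM2l ?mulr_ge0//; apply: ler_sum => j _.
  by rewrite /p opprD addrACA lerD.
(* A time that lies in only one of the two intervals lies between the two left ends or between the
   two right ends. *)
have disj (a b a' b' s : R) : (a <= s < b) != (a' <= s < b') ->
    (lo a a' <= s < hi a a') || (lo b b' <= s < hi b b').
  rewrite /lo /hi !ge_min !lt_max.
  by case: (leP a s) => //; case: (leP a' s) => //; case: (leP b s) => //; case: (leP b' s).
have cw : continuous (fun s => x s - x' s) by move=> s; apply: cvgB; [exact: cx|exact: cx'].
have cpsi : continuous psi.
  move=> s; apply: cvgM; first exact: cvg_cst.
  apply: (@cvg_sumr R R) => j.
  by apply: cvgD; exact: ramp_continuous.
have := @gronwall R E (fun s => x s - x' s) psi (2 * L) 0 t L20 t0.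
rewrite subr0 x00 x00' subrr normr0 add0r => G.
apply: (le_trans (G _ _ _)).
- by move=> s _; exact: cw.
- by move=> s _; exact: cpsi.
- move=> s /andP[s0 st]; have sT : 0 <= s < T by rewrite s0 (lt_le_trans st).
  have sT' : 0 <= s <= T by have /andP[-> /ltW] := sT.
  pose c j : R := (lo (al j) (al' j) <= s < hi (al j) (al' j))%R%:R +
    (lo (be j) (be' j) <= s < hi (be j) (be' j))%R%:R.
  have c0 j : 0 <= c j by rewrite addr_ge0.
  have sc0 : 0 <= \sum_j c j by exact: sumr_ge0.
  exists (cutoff (needle al be) s (x s) - cutoff (needle al' be') s (x' s)), (2 * M * \sum_j c j).
  split.
  - by apply: rderivB; [exact: dx|exact: dx'].
  - apply: dini_geZ; first by rewrite mulr_ge0.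
    by apply: dini_ge_sum => j; apply: dini_geD; exact: ramp_dini.
  - by rewrite !mulr_ge0.
  - rewrite -(subrKA (cutoff (needle al be) s (x' s))) (le_trans (ler_normD _ _))//.
    apply: lerD; first by apply: cutoff_lipschitz => //; exact: needle_mixed.
    have [E1|/existsNP[j /eqP jE]] :=
        pselect (forall j, (al j <= s < be j) = (al' j <= s < be' j)).
      rewrite /cutoff (needle_eq _ _ E1) subrr normr0.
      by rewrite !mulr_ge0.
    have sc1 : 1 <= \sum_j c j.
      rewrite (bigD1 j)//= -[leLHS]addr0 lerD//; last by apply: sumr_ge0.
      by rewrite /c; case/orP: (disj _ _ _ _ _ jE) => ->; rewrite ?lerDl ?lerDr.
    rewrite (le_trans (ler_normB _ _))//.
    apply: (@le_trans _ _ (2 * M * 1)); last by rewrite ler_wpM2l// mulr_ge0.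
    by rewrite mulr1 mulr2n mulrDl mul1r; apply: lerD; apply: MP => //; exact: needle_mixed.
rewrite -[leRHS]mulrA ler_pM ?expR_ge0//.
- by rewrite subr_ge0 /psi ler_wpM2l ?mulr_ge0//; apply: ler_sum => j _; rewrite lerD// ramp_nondecreasing.
- by rewrite ler_expR ler_wpM2l.
Qed.

Variable s : 'I_N -> R.
Hypothesis s_itv : forall j, 0 <= s j < T.
Implicit Types a : 'I_N -> R.

(* The needles are placed one after the other, so that they remain disjoint even if
   several base times [s j] coincide. *)
Definition total a : R := \sum_j a j.
Definition partial a (k : nat) : R := \sum_(i < N | (i < k)%N) a i.
Definition needle_start a j := s j + partial a j.
Definition needle_end a j := s j + partial a j.+1.

Lemma partialS a (j : 'I_N) : partial a j.+1 = partial a j + a j.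
Proof.
rewrite /partial (bigD1 j)//= addrC; congr (_ + _); apply: eq_bigl => i.
by rewrite ltnS ltn_neqAle andbC.
Qed.

Lemma partial_le a k k' : (forall j, 0 <= a j) -> (k <= k')%N -> partial a k <= partial a k'.
Proof.
move=> a0 kk'; rewrite /partial [leRHS](bigID (fun i : 'I_N => (i < k)%N))/=.
rewrite (eq_bigl (fun i : 'I_N => (i < k')%N && (i < k)%N)) ?lerDl ?sumr_ge0//.
by move=> i; case: ltnP => [/leq_trans/(_ kk') ->|]//; rewrite andbF.
Qed.

Lemma partial_itv a k : (forall j, 0 <= a j) -> 0 <= partial a k <= total a.
Proof.
move=> a0; rewrite sumr_ge0//= /total /partial [leRHS](bigID (fun i : 'I_N => (i < k)%N))/=.
by rewrite lerDl sumr_ge0.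
Qed.

Lemma needle_disjoint a i j t : (forall k, 0 <= a k) ->
  (forall i j, s i != s j -> total a < `|s i - s j|) ->
  i != j -> needle_start a j <= t < needle_end a j ->
  (needle_start a i <= t < needle_end a i) = false.
Proof.
move=> a0 gap ij /andP[]; rewrite /needle_start /needle_end => h1 h2.
have /andP[i0 iT] := partial_itv i a0; have /andP[j0 jT] := partial_itv j a0.
have /andP[i0' iT'] := partial_itv i.+1 a0; have /andP[j0' jT'] := partial_itv j.+1 a0.
apply/negbTE/negP => /andP[h3 h4].
have [sij|sij] := eqVneq (s i) (s j).
  have [ij'|ji|/val_inj ij'] := ltngtP i j.
  - by have := partial_le a0 ij'; lra.
  - by have := partial_le a0 ji; lra.
  - by rewrite ij' eqxx in ij.
by have := gap _ _ sij; rewrite ltr_normr => /orP[]; lra.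
Qed.

Lemma needle_start_dist a j : (forall k, 0 <= a k) ->
  `|needle_start a j - s j| <= total a /\ `|needle_end a j - s j| <= total a.
Proof.
move=> a0; rewrite /needle_start /needle_end ![s j + _]addrC !addrK.
have /andP[i0 iT] := partial_itv j a0; have /andP[j0 jT] := partial_itv j.+1 a0.
by rewrite !ger0_norm.
Qed.

Lemma needle_trajectory_close : exists2 C, 0 <= C & forall a x, (forall k, 0 <= a k) ->
  trajectory (needle (needle_start a) (needle_end a)) x ->
  forall t, 0 <= t <= T -> `|x t - x0 t| <= C * total a.
Proof.
have [C C0 CP] := trajectory_lipschitz.
exists (C * (2 * N%:R)) => [|a x a0 tx t tT]; first by rewrite !mulr_ge0.
(* Needles with the empty intervals [[s j, s j[] do not alter [u0]. *)
have tx0 : trajectory (needle s s) x0.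
  rewrite (_ : needle s s = u0); first exact: trajectory_x0.
  apply/funext => t'; apply: needle_out => j.
  by apply/negbTE/negP => /andP[/le_lt_trans/[apply]]; rewrite ltxx.
apply: (le_trans (CP _ _ _ _ _ _ tx tx0 t tT)); rewrite -mulrA ler_wpM2l//.
apply: (@le_trans _ _ (\sum_(j < N) (total a + total a))).
  by apply: ler_sum => j _; have [h1 h2] := needle_start_dist j a0; exact: lerD.
by rewrite sumr_const card_ord -mulr_natl; lra.
Qed.

Definition needle_jump j : E := f (s j) (x0 (s j)) (zeta j) - f (s j) (x0 (s j)) (u0 (s j)).
Definition needle_vector j : E := S T (Q (s j) (needle_jump j)).

Lemma needle_expansion e : 0 < e -> \forall d \near (0 : R)^'+, forall a x,
  (forall k, 0 <= a k) -> total a <= d ->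
  trajectory (needle (needle_start a) (needle_end a)) x ->
  `|x T - x0 T - \sum_j a j *: needle_vector j| <= e * total a.
Proof.
move=> e0; have [u0U u0r _] := u0_cadlag.
have [cA cA0 cAP] := cadlag_bounded T0 linearization_cadlag.
have [C C0 CP] := needle_trajectory_close; have L0 := tube_constant_ge0.
pose W := expR (cA * T); have W0 : 0 < W by exact: expR_gt0.
(* [W] is the factor in Gronwall's inequality; [eta] and [sig] are such that the errors off and on
   the needles each contribute at most [e / 2] times [total a]. *)
pose eta := e / (2 * W * (C + 1)); pose sig := e / (2 * W).
have eta0 : 0 < eta by rewrite divr_gt0// !mulr_gt0// ltr_wpDl.
have sig0 : 0 < sig by rewrite divr_gt0// mulr_gt0.
have [dr dr0 [psi [cpsi psie dpsi]]] := remainder_small r_gt0 tube_u0 eta0.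
pose y j t := S t (Q (s j) (needle_jump j)).
have cy j : continuous (y j).
  move=> t; apply: (cvg_bilinear (@blin_app_bilinear R E E)); [exact: S_cont|exact: cvg_cst].
have dy j t : 0 <= t < T -> rderiv (y j) t (A t (y j t)).
  move=> tT; have := rderiv_bilinear (@blin_app_bilinear R E E) (dS tT)
    (rderiv_cst (Q (s j) (needle_jump j)) t).
  by rewrite linear0 addr0.
have ys j : y j (s j) = needle_jump j.
  have /andP[s0 sT] := s_itv j.
  have : 0 <= s j <= T by rewrite s0 ltW.
  move=> /SQ/(congr1 (fun D : blin E E => D (needle_jump j))); exact.
have sig4 : 0 < sig / 4 by rewrite divr_gt0.
have near_jump : \forall d \near (0 : R)^'+, forall j, forall t, s j <= t < s j + d ->
    `|f t (x0 t) (zeta j) - f t (x0 t) (u0 t) - y j t| <= sig / 4.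
  apply: filter_forall => j; have /andP[s0 sT] := s_itv j.
  have sT' : 0 <= s j <= T by rewrite s0 ltW.
  have : f t (x0 t) (zeta j) - f t (x0 t) (u0 t) - y j t @[t --> (s j)^'+] -->
      f (s j) (x0 (s j)) (zeta j) - f (s j) (x0 (s j)) (u0 (s j)) - y j (s j).
    have cid : t @[t --> (s j)^'+] --> s j by apply: cvg_at_right_filter; exact: cvg_id.
    have cx : x0 t @[t --> (s j)^'+] --> x0 (s j) by apply: cvg_at_right_filter; exact: x0_cont.
    have nT := near_right_itv (s_itv j).
    apply: cvgB; last by apply: cvg_at_right_filter; exact: cy.
    apply: cvgB; apply: f_cvg => //; [exact: x0_Omega|exact: nearW|exact: cvg_cst|
      exact: x0_Omega|exact: u0U| |exact: u0r].
    by apply: filterS nT => t; exact: u0U.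
  rewrite ys /needle_jump subrr => /cvgr0_norm_le/(_ _ sig4)/near_right[d d0 dP].
  apply/near0_right; exists d => // h /andP[h0 hd] t /andP[st th].
  have [->|ts] := eqVneq t (s j); first by rewrite ys subrr normr0 ltW.
  by apply: dP; rewrite lt_neqAle eq_sym ts st /=; lra.
have near_gap : \forall d \near (0 : R)^'+, forall i j, s i != s j -> d < `|s i - s j|.
  apply: filter_forall => i; apply: filter_forall => j.
  have [_|sij] := eqVneq (s i) (s j); first by apply: filterE.
  by near=> d => _; near: d; apply: nbhs_right_lt; rewrite normr_gt0 subr_eq0.
have near_T : \forall d \near (0 : R)^'+, forall j, d < T - s j.
  apply: filter_forall => j; apply: nbhs_right_lt; rewrite subr_gt0.
  by have /andP[] := s_itv j.
have d_small (b c : R) : 0 <= b -> 0 < c -> (\forall d \near (0 : R)^'+, b * d <= c).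
  move=> b0 c0; near=> h; have h0 : 0 < h by near: h; exact: nbhs_right_gt.
  have h1 : h <= c / (b + 1) by apply: ltW; near: h; apply: nbhs_right_lt; rewrite divr_gt0// ltr_wpDl.
  apply: (@le_trans _ _ ((b + 1) * h)); first by rewrite ler_wpM2r ?lerDl// ltW.
  by rewrite mulrC -ler_pdivlMr// ltr_wpDl.
have LcA0 : 0 <= (L + cA) * C by rewrite mulr_ge0// addr_ge0.
near=> d => a x a0 ad tx; have [cx x00 dx] := tx.
have dT j : d < T - s j by move: j; near: d.
have dgap i j : s i != s j -> d < `|s i - s j| by move: i j; near: d.
have djump j t : s j <= t < s j + d ->
  `|f t (x0 t) (zeta j) - f t (x0 t) (u0 t) - y j t| <= sig / 4 by move: j t; near: d.
have Cdr : C * d <= r / 2 by near: d; exact: d_small.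
have Cddr : C * d <= dr by near: d; exact: d_small.
have LcAd : (L + cA) * C * d <= sig / 4 by near: d; exact: d_small.
have tot0 : 0 <= total a by exact: sumr_ge0.
have gap i j : s i != s j -> total a < `|s i - s j|.
  by move=> sij; exact: le_lt_trans ad (dgap _ _ sij).
have xx0 t : 0 <= t <= T -> `|x t - x0 t| <= C * total a by exact: CP a0 tx t.
have CtotCd : C * total a <= C * d by rewrite ler_wpM2l.
have start_end j : needle_start a j <= needle_end a j.
  by rewrite /needle_start /needle_end lerD2l partial_le.
have start_ge j : s j <= needle_start a j.
  by rewrite /needle_start lerDl; have /andP[] := partial_itv j a0.
have end_le j : needle_end a j <= s j + total a.
  by rewrite /needle_end lerD2l; have /andP[] := partial_itv j.+1 a0.
have end_lt j : needle_end a j < T by have := dT j; have := end_le j; lra.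
have end_start j : needle_end a j - needle_start a j = a j.
  by rewrite /needle_start /needle_end partialS; ring.
pose k j t : R^o := ramp (needle_start a j) (needle_end a j) t - needle_start a j.
pose z t := x t - x0 t - \sum_j k j t *: y j t.
pose b j t : R := (needle_start a j <= t < needle_end a j)%R%:R.
have kT j : k j T = a j.
  rewrite /k /ramp (max_idPl _); last by rewrite (le_trans (start_end j))// ltW.
  by rewrite (min_idPr _) ?end_start// ltW.
have k0 j : k j 0 = 0.
  rewrite /k /ramp (max_idPr _); last by have /andP[h _] := s_itv j; exact: le_trans h (start_ge j).
  by rewrite (min_idPl (start_end j)) subrr.
have zT : z T = x T - x0 T - \sum_j a j *: needle_vector j.
  by rewrite /z; congr (_ - _); apply: eq_bigr => j _; rewrite kT.
have z0 : z 0 = 0.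
  by rewrite /z x00 subrr sub0r big1 ?oppr0// => j _; rewrite k0 scale0r.
have ck j : continuous (k j).
  by move=> t; apply: cvgB; [exact: ramp_continuous|exact: cvg_cst].
have cz : continuous z.
  move=> t; apply: cvgB; first by apply: cvgB; [exact: cx|exact: x0_cont].
  by apply: cvg_sumr => j; apply: cvgZ; [exact: ck|exact: cy].
have dk j t : rderiv (k j) t (b j t : R^o).
  by rewrite -[b j t]subr0; apply: rderivB; [exact: ramp_rderiv|exact: rderiv_cst].
pose Psi t := C * total a * psi t + sig * \sum_j ramp (needle_start a j) (needle_end a j) t.
have Ct0 : 0 <= C * total a by rewrite mulr_ge0.
have PsiT : Psi T - Psi 0 <= C * total a * eta + sig * total a.
  have -> : Psi T - Psi 0 = C * total a * (psi T - psi 0) + sig *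
      \sum_j (ramp (needle_start a j) (needle_end a j) T - ramp (needle_start a j) (needle_end a j) 0).
    by rewrite sumrB /Psi; ring.
  apply: lerD; rewrite ler_wpM2l//; first exact: ltW.
  apply: ler_sum => j _; rewrite -end_start.
  have /andP[h1 h2] := ramp_itv T (start_end j); have /andP[h3 h4] := ramp_itv 0 (start_end j).
  lra.
have := @gronwall R E z Psi cA 0 T cA0 T0.
rewrite subr0 z0 normr0 add0r zT => G; apply: (le_trans (G _ _ _)) => {G}.
- by move=> t _; exact: cz.
- move=> t tT; apply: cvgD; apply: cvgM; [exact: cvg_cst|exact: cpsi|exact: cvg_cst|].
  by apply: (@cvg_sumr R R) => j; exact: ramp_continuous.
- move=> t tT; have tT' : 0 <= t <= T by have /andP[-> /ltW] := tT.
  have [c [c0 psic remc]] := dpsi t tT.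
  have b0 j : 0 <= b j t by [].
  exists (cutoff (needle (needle_start a) (needle_end a)) t (x t) - f t (x0 t) (u0 t) -
    \sum_j (b j t *: y j t + k j t *: A t (y j t))), (C * total a * c + sig * \sum_j b j t).
  split.
  + apply: rderivB; first by apply: rderivB; [exact: dx|exact: x0_sol].
    apply: rderiv_sum => j; apply: rderiv_bilinear (dk j t) (dy j t tT).
    exact: scale_bilinear.
  + apply: dini_geD; first exact: dini_geZ.
    apply: dini_geZ; first exact: ltW.
    by apply: dini_ge_sum => j; exact: ramp_dini.
  + by apply: addr_ge0; [exact: mulr_ge0|apply: mulr_ge0; [exact: ltW|exact: sumr_ge0]].
  set cu := cutoff _ _ _; set f0 := f t (x0 t) (u0 t).
  set B := \sum_j b j t *: y j t.
  (* The term [A t (z t)] is split off: it is the linear term that Gronwall's inequality absorbs. *)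
  have -> : \sum_j (b j t *: y j t + k j t *: A t (y j t)) = B + (A t (x t - x0 t) - A t (z t)).
    rewrite big_split -linearB; congr (_ + _).
    rewrite /z opprB addrC subrK linear_sum; apply: eq_bigr => j _.
    by rewrite linearZ.
  have -> : cu - f0 - (B + (A t (x t - x0 t) - A t (z t))) =
      A t (z t) + (cu - f0 - B - A t (x t - x0 t)).
    by rewrite opprD opprB addrA addrCA.
  apply: (le_trans (ler_normD _ _)); apply: lerD.
    by apply: (le_trans (blin_normP _ _)); rewrite ler_wpM2r// cAP.
  have xr : `|x t - x0 t| <= r / 2 by exact: le_trans (xx0 t tT') (le_trans CtotCd Cdr).
  have [[j tj]|nj] := pselect (exists j, needle_start a j <= t < needle_end a j); last first.
    have nj' j : (needle_start a j <= t < needle_end a j) = false.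
      by apply/negP => h; apply: nj; exists j.
    have -> : B = 0 by rewrite /B big1// => j _; rewrite /b nj' scale0r.
    rewrite [X in sig * X]big1 ?mulr0 ?addr0 ?subr0; last by move=> j _; rewrite /b nj'.
    have -> : cu - f0 - A t (x t - x0 t) = frechet_remainder t (x t - x0 t).
      by rewrite /cu cutoff_id// needle_out// /frechet_remainder subrKC.
    apply: (le_trans (remc _ _)); last by rewrite mulrC ler_wpM2r// xx0.
    exact: le_trans (xx0 t tT') (le_trans CtotCd Cddr).
  have tj' i : i != j -> (needle_start a i <= t < needle_end a i) = false.
    by move=> ij; exact: (needle_disjoint a0 gap ij tj).
  have BE : B = y j t.
    rewrite /B (bigD1 j)//= big1 ?addr0 => [|i ij]; first by rewrite /b tj scale1r.
    by rewrite /b tj'// scale0r.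
  have -> : \sum_i b i t = 1.
    by rewrite (bigD1 j)//= big1 ?addr0 => [|i ij]; rewrite /b ?tj ?tj'.
  have cuE : cu = f t (x t) (zeta j) by rewrite /cu cutoff_id// (needle_in _ _ tj).
  (* On needle [j] the error consists of a change of state, the variation of the jump, and the
     linear term. The first and third together, and the second, are at most [sig / 4] each. *)
  have -> : cu - f0 - B - A t (x t - x0 t) = (f t (x t) (zeta j) - f t (x0 t) (zeta j)) +
      (f t (x0 t) (zeta j) - f0 - y j t) - A t (x t - x0 t).
    by rewrite cuE BE [in RHS]addrA subrKA.
  have xr' : `|x t - x0 t| < r by rewrite (le_lt_trans xr)//; have := r_gt0; lra.
  have x0r' : `|x0 t - x0 t| < r by rewrite subrr normr0.
  have h1 : `|f t (x t) (zeta j) - f t (x0 t) (zeta j)| <= L * (C * total a).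
    have := tube_lipschitz tT' (zetaU j) (tube_zeta j tT') xr' x0r'.
    by move=> /le_trans; apply; rewrite ler_wpM2l// xx0.
  have h2 : `|f t (x0 t) (zeta j) - f0 - y j t| <= sig / 4.
    apply: djump; have := start_ge j; have := end_le j; have /andP[] := tj.
    by move=> ? ? ? ?; apply/andP; split; lra.
  have h3 : `|A t (x t - x0 t)| <= cA * (C * total a).
    apply: (le_trans (blin_normP _ _)); apply: ler_pM => //; first exact: cAP.
    exact: xx0.
  have h4 : (L + cA) * C * total a <= sig / 4 by apply: le_trans LcAd; rewrite ler_wpM2l.
  have h5 : 0 <= C * total a * c by rewrite mulr_ge0.
  apply: (le_trans (ler_normB _ _)); apply: (le_trans (lerD (ler_normD _ _) (lexx _))).
  rewrite mulr1; have := sig0; lra.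
have : W * (Psi T - Psi 0) <= W * (C * total a * eta + sig * total a) by rewrite ler_pM2l.
move=> /le_trans; apply.
have Wsig : W * sig = e / 2 by rewrite /sig; field; rewrite lt0r_neq0.
have Weta : W * C * eta <= e / 2.
  have -> : W * C * eta = (e / 2) * (C / (C + 1)).
    by rewrite /eta; field; rewrite !lt0r_neq0// ltr_wpDl.
  rewrite ger_pMr ?divr_gt0// ler_pdivrMr ?mul1r ?lerDl// ltr_wpDl//.
have -> : W * (C * total a * eta + sig * total a) = (W * C * eta + W * sig) * total a by ring.
rewrite Wsig ler_wpM2r//; lra.
Unshelve. all: by end_near. Qed.

(** * Needle variations indexed by the cube *)

Section Family.
Variables (q : nat) (a : 'rV[R]_q -> 'I_N -> R) (bd : R) (X : R -> 'rV[R]_q -> R -> E).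
Hypothesis a_cont : forall j, continuous (a ^~ j).
Hypothesis a_ge0 : forall d j, 0 <= a d j.
Hypothesis bd_ge0 : 0 <= bd.
Hypothesis a_bd : forall d, unit_cube q d -> total (a d) <= bd.
Let sa e d := fun j => e * a d j.
Hypothesis XP : forall e d, trajectory (needle (needle_start (sa e d)) (needle_end (sa e d))) (X e d).

Definition direction d : E := \sum_j a d j *: needle_vector j.

Lemma direction_continuous : continuous direction.
Proof.
move=> d; apply: (cvg_sumr (FF := nbhs_filter (d : 'rV[R]_q))) => j.
by apply: cvgZl; exact: a_cont.
Qed.

Let total_sa e d : total (sa e d) = e * total (a d).
Proof. by rewrite /total mulr_sumr. Qed.

Lemma endpoint_cvg {I : Type} (F : set_system I) {FF : Filter F} (e : I -> R)
    (d : I -> 'rV[R]_q) e1 d1 : e @ F --> e1 -> d @ F --> d1 ->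
  X (e i) (d i) T @[i --> F] --> X e1 d1 T.
Proof.
move=> ee1 dd1; have [C C0 CP] := trajectory_lipschitz.
have sac j : sa (e i) (d i) j @[i --> F] --> sa e1 d1 j.
  apply: cvgM => //; apply: (@cvg_comp _ _ _ d (a ^~ j) _ (nbhs d1)) => //.
  exact: a_cont.
have partc k : partial (sa (e i) (d i)) k @[i --> F] --> partial (sa e1 d1) k.
  rewrite /partial.
  have h (p : pred 'I_N) : \sum_(j < N | p j) sa (e i) (d i) j @[i --> F] -->
      \sum_(j < N | p j) sa e1 d1 j.
    rewrite big_mkcond; under eq_cvg do rewrite big_mkcond.
    apply: (@cvg_sumr R R) => j; case: (p j); [exact: sac|exact: cvg_cst].
  exact: h.
have : C * \sum_j (`|needle_start (sa e1 d1) j - needle_start (sa (e i) (d i)) j| +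
    `|needle_end (sa e1 d1) j - needle_end (sa (e i) (d i)) j|) @[i --> F] -->
    C * \sum_j (`|needle_start (sa e1 d1) j - needle_start (sa e1 d1) j| +
    `|needle_end (sa e1 d1) j - needle_end (sa e1 d1) j|).
  apply: cvgM; first exact: cvg_cst.
  apply: (@cvg_sumr R R) => j; apply: cvgD; apply: cvg_norm; apply: cvgB;
    by [exact: cvg_cst|apply: cvgD; [exact: cvg_cst|exact: partc]].
rewrite big1 ?mulr0 => [h|j _]; last by rewrite !subrr normr0 addr0.
apply/cvgrPdist_le => c c0; move/cvgr0_norm_le : h => /(_ c c0).
apply: filterS => i; apply: le_trans; apply: le_trans (ler_norm _).
by apply: (CP _ _ _ _ _ _ (XP e1 d1) (XP (e i) (d i))); rewrite lexx T0.
Qed.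

Lemma near0_small (c b : R) : 0 <= c -> 0 < b -> \forall e \near (0 : R)^'+, c * e <= b.
Proof.
move=> c0 b0; near=> h; have h0 : 0 < h by near: h; exact: nbhs_right_gt.
have h1 : h <= b / (c + 1) by apply: ltW; near: h; apply: nbhs_right_lt; rewrite divr_gt0// ltr_wpDl.
apply: (@le_trans _ _ ((c + 1) * h)); first by rewrite ler_wpM2r ?lerDl// ltW.
by rewrite mulrC -ler_pdivlMr// ltr_wpDl.
Unshelve. all: by end_near. Qed.

Lemma family_close c : 0 < c -> \forall e \near (0 : R)^'+, forall d, unit_cube q d ->
  forall t, 0 <= t <= T -> `|X e d t - x0 t| <= c.
Proof.
move=> c0; have [C C0 CP] := needle_trajectory_close.
have Cb : 0 <= C * bd by rewrite mulr_ge0.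
near=> e => d qd t tT; have e0 : 0 < e by near: e; exact: nbhs_right_gt.
have h : C * bd * e <= c by near: e; exact: near0_small.
have sa0 j : 0 <= sa e d j by rewrite mulr_ge0// ltW.
apply: (le_trans (CP _ _ sa0 (XP e d) t tT)); apply: le_trans h.
by rewrite total_sa -mulrA ler_wpM2l// mulrC ler_wpM2r ?a_bd// ltW.
Unshelve. all: by end_near. Qed.

Lemma family_direction c : 0 < c -> \forall e \near (0 : R)^'+, forall d, unit_cube q d ->
  `|e^-1 *: (X e d T - x0 T) - direction d| <= c.
Proof.
(* As the total length is at most [bd * e], precision [c / (bd + 1)] per unit length gives an error
   of at most [c * e]. *)
move=> c0; have c1 : 0 < c / (bd + 1) by rewrite divr_gt0// ltr_wpDl.
have /near0_right[d0 d00 d0P] := needle_expansion c1.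
have d02 : 0 < d0 / 2 by rewrite divr_gt0.
near=> e => d qd; have e0 : 0 < e by near: e; exact: nbhs_right_gt.
have h : bd * e <= d0 / 2 by near: e; exact: near0_small.
have sa0 j : 0 <= sa e d j by rewrite mulr_ge0// ltW.
have tot : total (sa e d) <= bd * e by rewrite total_sa mulrC ler_wpM2r ?a_bd// ltW.
have half : 0 < d0 / 2 < d0 by apply/andP; split; lra.
have := d0P _ half _ _ sa0 (le_trans tot h) (XP e d).
rewrite (_ : \sum_j sa e d j *: needle_vector j = e *: direction d); last first.
  by rewrite /direction scaler_sumr; apply: eq_bigr => j _; rewrite scalerA.
move=> h1; rewrite -(ler_pM2l e0) -[X in X * `|_|](gtr0_norm e0) -normrZ scalerBr scalerA.
rewrite divff ?lt0r_neq0// scale1r; apply: (le_trans h1).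
apply: (@le_trans _ _ (c / (bd + 1) * (bd * e))); first by rewrite ler_wpM2l// ltW.
rewrite mulrA mulrC ler_pM2l// mulrAC ler_pdivrMr ?ltr_wpDl//.
by rewrite ler_pM2l// lerDl.
Unshelve. all: by end_near. Qed.

(** Extended by its limit at [e = 0], the difference quotient is continuous on the product of
    [[0, 1]] and the cube. The compact image is the set of directions to which Hadamard
    differentiability will be applied. *)
Let quotient (z : R * 'rV[R]_q) : E :=
  if z.1 == 0 then direction z.2 else z.1^-1 *: (X z.1 z.2 T - x0 T).

Let quotient_compact : compact (quotient @` (`[0, 1]%classic `*` unit_cube q)).
Proof.
apply: continuous_compact; last first.
  by apply: compact_setX; [exact: segment_compact|exact: unit_cube_compact].
apply/subspace_continuousP => -[e1 d1] [/= e1I qd1].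
set F := within _ _; have FF : Filter F by exact: within_filter.
have Ff : z.1 @[z --> F] --> e1 by apply: cvg_within_filter; exact: cvg_fst.
have Fs : z.2 @[z --> F] --> d1 by apply: cvg_within_filter; exact: cvg_snd.
have FA : \forall z \near F, (`[0, 1]%classic `*` unit_cube q) z by exact: withinT.
suff : quotient z @[z --> F] --> quotient (e1, d1) by [].
rewrite {2}/quotient /=; have [e10|e10] := eqVneq e1 0.
  apply/cvgrPdist_le => c c0; have c2 : 0 < c / 2 by rewrite divr_gt0.
  have /near0_right[d0 d00 d0P] := family_direction c2.
  have Fd : direction z.2 @[z --> F] --> direction d1.
    by apply: (@cvg_comp _ _ _ snd direction _ (nbhs d1)) => //; exact: direction_continuous.
  have h1 : \forall z \near F, `|direction d1 - direction z.2| <= c / 2.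
    by move/cvgrPdist_le : Fd; apply.
  have h2 : \forall z \near F, `|e1 - z.1| < d0 by move/cvgrPdist_lt : Ff; apply.
  apply: filterS3 FA h1 h2 => -[e d] [/= eI qd] /= h1; rewrite e10 sub0r normrN => h2.
  rewrite /quotient /=; have [_|e_neq0] := eqVneq e 0; first by apply: (le_trans h1); lra.
  have e0 : 0 < e < d0.
    move: eI; rewrite in_itv /= => /andP[e0 _].
    by apply/andP; rewrite lt0r e_neq0 e0 -[X in X < d0]ger0_norm.
  rewrite -(subrKA (direction d)) (le_trans (ler_normD _ _))//.
  have := d0P e e0 d qd; rewrite [`|direction d - _|]distrC; lra.
apply: (@cvg_trans _ ((fun z => z.1^-1 *: (X z.1 z.2 T - x0 T)) @ F)).
  apply: near_eq_cvg.
  have : \forall z \near F, `|e1 - z.1| < `|e1| by move/cvgrPdist_lt : Ff; apply; rewrite normr_gt0.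
  apply: filterS => -[e d] /= he; rewrite /quotient /=.
  by case: eqVneq he => // ->; rewrite subr0 ltxx.
apply: cvgZ; first exact: cvgV.
by apply: cvgB; [exact: endpoint_cvg|exact: cvg_cst].
Qed.

Lemma hadamard_compact {V W : normedModType R} (g : V -> W) x (Dg : blin V W) (K : set V) :
  is_hadamard g x Dg -> compact K -> forall c, 0 < c ->
  \forall e \near (0 : R)^'+, forall h, K h -> `|e^-1 *: (g (x + e *: h) - g x) - Dg h| <= c.
Proof.
move=> hg cK c c0; have [K0|/set0P/negP/negPn/eqP K0] := pselect (K !=set0); last first.
  by apply: filterE => e h; rewrite K0.
have h0 : nbhs (0%:E : \bar R) [set y | (y <= c%:E)%E].
  apply: filterS (_ : nbhs (0 : R) [set y | y < c]); last exact: lt_nbhsl.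
  by move=> y /= /ltW; rewrite lee_fin.
have H : \forall e \near (0 : R)^'+,
    (ereal_sup [set `|e^-1 *: (g (x + e *: h) - g x) - Dg h|%:E | h in K] <= c%:E)%E.
  exact: hg K cK K0 _ h0.
apply: filterS H => e h1 h Kh; rewrite -lee_fin.
by apply: (le_trans _ h1); apply: ereal_sup_ubound; exists h.
Qed.

(** The direction [w] of the increment varies with both [e] and [d]. Uniformity on a compact set of
    directions allows it to be used in the difference quotient and then replaced by its limit. *)
Lemma family_derivative (g : E -> R^o) c : hadamard_differentiable g (x0 T) -> 0 < c ->
  \forall e \near (0 : R)^'+, forall d, unit_cube q d ->
  `|e^-1 * (g (X e d T) - g (x0 T)) - DH g (x0 T) (direction d)| <= c.
Proof.
move=> /(@xgetPex _ 0) hg c0; rewrite -/(DH g (x0 T)) in hg.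
set Dg := DH g (x0 T) in hg *.
have c2 : 0 < c / 2 by rewrite divr_gt0.
have n0 : 0 < c / 2 / (`|Dg| + 1) by rewrite divr_gt0// ltr_wpDl.
have H1 := hadamard_compact hg quotient_compact c2.
have H2 := family_direction n0.
near=> e => d qd; have e0 : 0 < e by near: e; exact: nbhs_right_gt.
have e1 : e <= 1 by near: e; exact: nbhs_right_le.
pose w := e^-1 *: (X e d T - x0 T).
have Kw : (quotient @` (`[0, 1]%classic `*` unit_cube q)) w.
  exists (e, d); first by split => //=; rewrite in_itv /= e1 ltW.
  by rewrite /quotient /= gt_eqF.
have XE : x0 T + e *: w = X e d T.
  by rewrite /w scalerA divff ?lt0r_neq0// scale1r subrKC.
have h1 : `|e^-1 *: (g (x0 T + e *: w) - g (x0 T)) - Dg w| <= c / 2.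
  by move: w Kw {XE}; near: e; apply: filterS H1 => e h w; exact: h.
have h2 : `|w - direction d| <= c / 2 / (`|Dg| + 1).
  by rewrite /w; move: d qd {w Kw XE h1}; near: e.
rewrite XE in h1.
have h3 : `|Dg w - Dg (direction d)| <= c / 2.
  rewrite -linearB; apply: (le_trans (blin_normP _ _)).
  apply: (@le_trans _ _ ((`|Dg| + 1) * `|w - direction d|)).
    by rewrite ler_wpM2r// lerDl.
  by rewrite mulrC -ler_pdivlMr// ltr_wpDl.
rewrite -(subrKA (Dg w)); apply: (le_trans (ler_normD _ _)).
by rewrite [leRHS](splitr c); apply: lerD.
Unshelve. all: by end_near. Qed.

End Family.
End Needles.

(** * The endpoint cone and the adjoint state *)

Definition kick s z : E := S T (Q s (f s (x0 s) z - f s (x0 s) (u0 s))).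

(** With an arbitrary finite index type, two combinations are added over the disjoint union of their
    indices. *)
Definition endpoint_cone : set E := [set v |
  exists (I : finType) (s : I -> R) (z : I -> Y) (a : I -> R),
  [/\ forall i, 0 <= s i < T, forall i, U (z i), forall i, 0 <= a i &
      v = \sum_i a i *: kick (s i) (z i)]].

Lemma endpoint_cone_convex : convex_cone endpoint_cone.
Proof.
split.
- by exists 'I_0, (fun=> 0), (fun=> 0), (fun=> 0); split => [[]|[]||]; rewrite ?big_ord0.
- move=> _ _ [I [s [z [a [sT zU a0 ->]]]]] [I' [s' [z' [a' [sT' zU' a0' ->]]]]].
  exists (I + I')%type; pose cat A (h : I -> A) h' (i : I + I') :=
    match i with inl i => h i | inr i => h' i end.
  exists (cat _ s s'), (cat _ z z'), (cat _ a a'); split; [by case|by case|by case|].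
  by rewrite big_sumType.
- move=> c _ c0 [I [s [z [a [sT zU a0 ->]]]]]; exists I, s, z, (fun i => c * a i).
  split => // [i|]; first by rewrite mulr_ge0.
  by rewrite scaler_sumr; apply: eq_bigr => i _; rewrite scalerA.
Qed.

Lemma endpoint_cone_kick s z : 0 <= s < T -> U z -> endpoint_cone (kick s z).
Proof.
move=> sT zU; exists 'I_1, (fun=> s), (fun=> z), (fun=> 1).
by split => //; rewrite big_ord1 scale1r.
Qed.

Section Adjoint.
Variable ell : dual E.
Hypothesis ell_cone : forall v, endpoint_cone v -> ell v <= 0.

(* [Q t] is the inverse of [S t]. *)
Definition adjoint t : dual E := blin_comp ell (blin_comp (S T) (Q t)).
Local Notation p := adjoint.
Local Notation H := (hamiltonian f).

Lemma adjoint_end : p T = ell.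
Proof. by rewrite /adjoint SQ ?lexx ?ltW//; exact: blinE. Qed.

Lemma adjoint_continuous : continuous p.
Proof.
move=> t; apply: (cvg_bilinear blin_comp_bilinear); first exact: cvg_cst.
by apply: (cvg_bilinear blin_comp_bilinear); [exact: cvg_cst|exact: Q_cont].
Qed.

Lemma adjoint_rderiv t : 0 <= t < T -> rderiv p t (- blin_comp (p t) (A t)).
Proof.
move=> tT; pose B (D1 D2 : blin E E) := blin_comp D1 D2.
have h1 := rderiv_bilinear blin_comp_bilinear (rderiv_cst (S T) t) (dQ tT).
have := rderiv_bilinear blin_comp_bilinear (rderiv_cst ell t) h1.
rewrite [X in rderiv _ _ X](_ : _ = - blin_comp (p t) (A t))//.
apply: blinE => v; rewrite /= /blin_comp_fun /=.
transitivity (0 + ell (0 + S T (- Q t (A t v)))) => //.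
by rewrite !add0r !linearN.
Qed.

Lemma adjoint_PC1 : PC1 T setT p /\ forall t, t \in `[0, T] ->
  ext_deriv T p t = - DF (fun xi => H t xi (u0 t) (p t) : R^o) (x0 t).
Proof.
have [u0U _ _] := u0_cadlag.
have cA : cadlag T setT (fun t => - blin_comp (p t) (A t)).
  apply: cadlagN; apply: (cadlag_bilinear blin_comp_bilinear); last exact: linearization_cadlag.
  by apply: continuous_cadlag => // t; exact: adjoint_continuous.
have AT : A r @[r --> T^'-] --> A T.
  apply: df_cvg => //; [by rewrite lexx T0|by apply: u0U; rewrite lexx T0| | |].
  - by apply: near_left_itv; rewrite T_gt0 lexx.
  - by apply: filterS (near_left_itv (_ : 0 < T <= T)) => [r /u0U//|]; rewrite T_gt0 lexx.
  - by apply: cvg_at_left_filter; exact: cvg_id.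
have [|||P dP] := rderiv_PC1 (G := setT) (D := D) T_gt0 adjoint_continuous _ cA _ _ adjoint_rderiv.
- by [].
- move=> t tT tD; apply: cvgN; apply: (cvg_bilinear blin_comp_bilinear).
    exact: adjoint_continuous.
  exact: linearization_continuous.
- apply: cvgN; apply: (cvg_bilinear blin_comp_bilinear) => //.
  by apply: cvg_at_left_filter; exact: adjoint_continuous.
split => // t tT; have tT' : 0 <= t <= T by move: tT; rewrite in_itv.
by rewrite dP// /hamiltonian DF_blin_comp//; apply: f_diff => //; exact: u0U.
Qed.

Lemma hamiltonian_cvg {I : Type} (F : set_system I) {FF : Filter F} (t : I -> R) (u : I -> Y) t1 u1 :
  0 <= t1 <= T -> U u1 -> (\forall i \near F, 0 <= t i <= T) -> (\forall i \near F, U (u i)) ->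
  t @ F --> t1 -> u @ F --> u1 ->
  H (t i) (x0 (t i)) (u i) (p (t i)) @[i --> F] --> H t1 (x0 t1) u1 (p t1).
Proof.
move=> t1T Uu1 tT Uu tt uu; apply: (cvg_bilinear blin_app_bilinear).
  by apply: continuous_cvg => //; exact: adjoint_continuous.
apply: f_cvg => //; first exact: x0_Omega.
by apply: continuous_cvg => //; exact: x0_cont.
Qed.

(** For [t < T] this is the inequality for a single kick. No needle is based at [T], where the
    inequality follows from left limits, [u0] being left continuous there. *)
Lemma maximum_principle t z : 0 <= t <= T -> U z ->
  H t (x0 t) z (p t) <= H t (x0 t) (u0 t) (p t).
Proof.
have [u0U _ _] := u0_cadlag => tT Uz.
have lt_case s : 0 <= s < T -> H s (x0 s) z (p s) <= H s (x0 s) (u0 s) (p s).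
  move=> sT; rewrite -subr_le0 /hamiltonian -linearB.
  exact: ell_cone (endpoint_cone_kick sT Uz).
have /andP[t0] := tT; rewrite le_eqVlt => /orP[/eqP tE|tT']; last by apply: lt_case; rewrite t0.
have TT : 0 < T <= T by rewrite T_gt0 lexx.
rewrite tE in tT *.
have cT : (r : R) @[r --> T^'-] --> T by apply: cvg_at_left_filter; exact: cvg_id.
have hz : H r (x0 r) z (p r) @[r --> T^'-] --> H T (x0 T) z (p T).
  apply: (hamiltonian_cvg (t := id) (u := fun=> z)) => //.
  - exact: near_left_itv.
  - by apply: filterE.
  - exact: cvg_cst.
have hu : H r (x0 r) (u0 r) (p r) @[r --> T^'-] --> H T (x0 T) (u0 T) (p T).
  apply: (hamiltonian_cvg (t := id) (u := u0)) => //.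
  - exact: u0U.
  - exact: near_left_itv.
  - by apply: filterS (near_left_itv TT) => r /u0U.
apply: (ler_cvg_to hz hu); near=> r; apply: lt_case; apply/andP; split.
  by near: r; exact: nbhs_left_ge.
by near: r; exact: nbhs_left_lt.
Unshelve. all: by end_near. Qed.

Lemma hamiltonian_continuous :
  {within `[0, T], continuous (fun t => H t (x0 t) (u0 t) (p t))}.
Proof.
have [u0U u0r u0l] := u0_cadlag; pose h t : R^o := H t (x0 t) (u0 t) (p t).
have right_cvg t : 0 <= t < T -> h r @[r --> t^'+] --> h t.
  move=> tT; have tT' : 0 <= t <= T by have /andP[-> /ltW] := tT.
  apply: (hamiltonian_cvg (t := id) (u := u0)) => //.
  - exact: u0U.
  - exact: near_right_itv.
  - by apply: filterS (near_right_itv tT) => r /u0U.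
  - by apply: cvg_at_right_filter; exact: cvg_id.
  - exact: u0r.
(* The left limit of [u0] is an admissible value at [t] and [u0 t] is one at [r < t]:
   the maximum principle gives both inequalities between [h t] and the left limit. *)
have left_cvg t : 0 < t <= T -> h r @[r --> t^'-] --> h t.
  move=> tT; have tT' : 0 <= t <= T by have /andP[/ltW -> ->] := tT.
  have [z Uz uz] := u0l t tT.
  have ct : (r : R) @[r --> t^'-] --> t by apply: cvg_at_left_filter; exact: cvg_id.
  have nU : \forall r \near t^'-, U (u0 r) by apply: filterS (near_left_itv tT) => r /u0U.
  have hz : h r @[r --> t^'-] --> (H t (x0 t) z (p t) : R^o).
    by apply: (hamiltonian_cvg (t := id) (u := u0)) => //; exact: near_left_itv.
  suff -> : h t = H t (x0 t) z (p t) by [].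
  apply/le_anti/andP; split; last exact: maximum_principle.
  have hu : H r (x0 r) (u0 t) (p r) @[r --> t^'-] --> h t.
    apply: (hamiltonian_cvg (t := id) (u := fun=> u0 t)) => //.
    - exact: u0U.
    - exact: near_left_itv.
    - by apply: filterE => r; exact: u0U.
    - exact: cvg_cst.
  apply: (ler_cvg_to hu hz); apply: filterS (near_left_itv tT) => r rT; apply: maximum_principle => //; exact: u0U.
apply/(continuous_within_itvP _ T_gt0); split.
- move=> t; rewrite in_itv /= => /andP[t0 tT]; apply/left_right_continuousP; split.
    by apply: left_cvg; rewrite t0 ltW.
  by apply: right_cvg; rewrite tT ltW.
- by apply: right_cvg; rewrite T_gt0 lexx.
- by apply: left_cvg; rewrite T_gt0 lexx.
Qed.

End Adjoint.

(** A single list of needles serves all the vectors, each having zero coefficients outside its own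
    block. Thus only the lengths of the needles will depend on the point of the cube. *)
Lemma endpoint_cone_family (K : finType) (v : K -> E) : (forall k, endpoint_cone (v k)) ->
  exists N (s : 'I_N -> R) (z : 'I_N -> Y) (c : K -> 'I_N -> R),
  [/\ forall j, 0 <= s j < T, forall j, U (z j), forall k j, 0 <= c k j &
      forall k, v k = \sum_j c k j *: kick (s j) (z j)].
Proof.
pose data := {I : finType & ((I -> R) * (I -> Y) * (I -> R))%type}.
pose P k (F : data) := [/\ forall i, 0 <= (projT2 F).1.1 i < T,
  forall i, U ((projT2 F).1.2 i), forall i, 0 <= (projT2 F).2 i &
  v k = \sum_i (projT2 F).2 i *: kick ((projT2 F).1.1 i) ((projT2 F).1.2 i)].
move=> Vv; have /choice[F FP] : forall k, exists F, P k F.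
  move=> k; have [I [s [z [a h]]]] := Vv k.
  by exists (existT _ I (s, z, a)).
pose I := {k : K & projT1 (F k)}.
pose s (i : I) := (projT2 (F (tag i))).1.1 (tagged i).
pose z (i : I) := (projT2 (F (tag i))).1.2 (tagged i).
pose c k (i : I) := if tag i == k then (projT2 (F (tag i))).2 (tagged i) else 0.
exists #|{: I}|, (s \o enum_val), (z \o enum_val), (fun k => c k \o enum_val); split.
- by move=> j; have [h _ _ _] := FP (tag (enum_val j)); exact: h.
- by move=> j; have [_ h _ _] := FP (tag (enum_val j)); exact: h.
- move=> k j; rewrite /c /=; case: ifP => // _.
  by have [_ _ h _] := FP (tag (enum_val j)); exact: h.
- move=> k; have [_ _ _ ->] := FP k.
  have -> : \sum_(j < #|{: I}|) (c k \o enum_val) j *: kick ((s \o enum_val) j) ((z \o enum_val) j) =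
      \sum_(i : I) c k i *: kick (s i) (z i).
    by rewrite [RHS](reindex (@enum_val I {: I}))//; exact/onW_bij/enum_val_bij.
  pose G k' (i : projT1 (F k')) := c k (Tagged (fun k => projT1 (F k)) i) *:
    kick (s (Tagged (fun k => projT1 (F k)) i)) (z (Tagged (fun k => projT1 (F k)) i)).
  transitivity (\sum_k' \sum_(i : projT1 (F k')) G k' i).
    rewrite (bigD1 k)//= [X in _ + X]big1 ?addr0 => [|k' kk'].
      by apply: eq_bigr => i _; rewrite /G /c /= eqxx.
    by apply: big1 => i _; rewrite /G /c /= (negbTE kk') scale0r.
  rewrite (sig_big_dep (fun=> true) (fun _ _ => true) G); apply: eq_bigr => -[k' i] _.
  by [].
Qed.

Lemma control_solution x u (D' : seq R) : continuous x -> (forall t, 0 <= t <= T -> Omega (x t)) ->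
  cadlag T U u -> (forall t, 0 < t < T -> t \notin D' -> {for t, continuous u}) ->
  u r @[r --> T^'-] --> u T -> (forall t, 0 <= t < T -> rderiv x t (f t (x t) (u t))) ->
  [/\ PC1 T Omega x, NPC0 T U u & forall t, t \in `[0, T] -> ext_deriv T x t = f t (x t) (u t)].
Proof.
move=> cx Ox cu uD uT dx; have [uU ur ul] := cu.
have TT : 0 < T <= T by rewrite T_gt0 lexx.
pose phi t := f t (x t) (u t).
have [|||P dP] := @rderiv_PC1 _ _ _ Omega x phi D' T_gt0 cx Ox _ _ _ dx.
- split=> // t tT.
    have tT' : 0 <= t <= T by have /andP[-> /ltW] := tT.
    apply: (@f_cvg _ _ _ id x u) => //; [exact: Ox|exact: uU|exact: near_right_itv| | | |exact: ur].
    + by apply: filterS (near_right_itv tT) => r /uU.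
    + by apply: cvg_at_right_filter; exact: cvg_id.
    + by apply: cvg_at_right_filter; exact: cx.
  have tT' : 0 <= t <= T by have /andP[/ltW -> ->] := tT.
  have [z Uz uz] := ul t tT; exists (f t (x t) z) => //.
  apply: (@f_cvg _ _ _ id x u) => //; [exact: Ox|exact: near_left_itv| | |].
  + by apply: filterS (near_left_itv tT) => r /uU.
  + by apply: cvg_at_left_filter; exact: cvg_id.
  + by apply: cvg_at_left_filter; exact: cx.
- move=> t tT tD; have tT' : 0 <= t <= T by have /andP[/ltW -> /ltW ->] := tT.
  have nt : \forall s \near t, 0 <= s <= T.
    by apply: filterS (near_itv tT) => s /andP[/ltW -> /ltW ->].
  apply: (@f_cvg _ _ _ id x u) => //; [exact: Ox|exact: uU| |exact: cx|exact: uD].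
  by apply: filterS nt => r /uU.
- apply: (@f_cvg _ _ _ id x u) => //.
  + by rewrite lexx T0.
  + by apply: Ox; rewrite lexx T0.
  + by apply: uU; rewrite lexx T0.
  + exact: near_left_itv.
  + by apply: filterS (near_left_itv TT) => r /uU.
  + by apply: cvg_at_left_filter; exact: cvg_id.
  + by apply: cvg_at_left_filter; exact: cx.
split => //; first exact: cadlag_NPC0 uD uT.
Qed.

Lemma tubes_exist N (z : 'I_N -> Y) : (forall j, U (z j)) ->
  exists2 r, 0 < r & exists L, forall t, 0 <= t <= T ->
    tube r L x0 u0 t /\ forall j, tube r L x0 (fun=> z j) t.
Proof.
move=> Uz; have sub v r r' L L' t : r <= r' -> L' <= L -> tube r' L' x0 v t -> tube r L x0 v t.
  move=> rr' LL' h xi xit; have [? hL] := h xi (lt_le_trans xit rr').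
  by split=> //; exact: le_trans LL'.
have ex v : cadlag T U v -> exists2 r, 0 < r & exists L, forall t, 0 <= t <= T -> tube r L x0 v t.
  by move=> cv; exact: (tube_exists x0_cont x0_Omega cv).
suff [r r0 [L LP]] : exists2 r, 0 < r & exists L, forall t, 0 <= t <= T ->
    tube r L x0 u0 t /\ forall j, j \in enum 'I_N -> tube r L x0 (fun=> z j) t.
  by exists r => //; exists L => t /LP[h1 h2]; split => // j; apply: h2; rewrite mem_enum.
elim: (enum 'I_N) => [|k js [r r0 [L LP]]].
  by have [r r0 [L LP]] := ex _ u0_cadlag; exists r => //; exists L => t tT; split => //; exact: LP.
have [|r' r'0 [L' LP']] := ex (fun=> z k).
  by split => // t tT; [exact: cvg_cst|exists (z k) => //; exact: cvg_cst].
exists (Num.min r r'); first by rewrite lt_min r0.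
exists (Num.max L L') => t tT; have [h1 h2] := LP t tT; split.
  by apply: sub h1; rewrite ?ge_min ?le_max lexx.
move=> i; rewrite inE => /orP[/eqP ->|/h2 h].
  by apply: sub (LP' t tT); rewrite ?ge_min ?le_max lexx orbT.
by apply: sub h; rewrite ?ge_min ?le_max lexx.
Qed.

(** Needle [j] gets the length [e] times the combination of the [c k j] with weights [kap k d]. It
    depends continuously on [d], and the total is at most [bd * e] on the cube, so the estimates
    hold uniformly in [d]. *)
Lemma needle_family q (K : finType) (kap : K -> 'rV[R]_q -> R) (v : K -> E) :
  (forall k, endpoint_cone (v k)) -> (forall k, continuous (kap k)) ->
  (forall k d, 0 <= kap k d) -> (forall k d, unit_cube q d -> kap k d <= 1) ->
  exists X : R -> 'rV[R]_q -> R -> E,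
  [/\ \forall e \near (0 : R)^'+, forall d, unit_cube q d -> X e d 0 = x0 0 /\
        exists u, [/\ PC1 T Omega (X e d), NPC0 T U u &
          forall t, t \in `[0, T] -> ext_deriv T (X e d) t = f t (X e d t) (u t)],
      forall e, continuous (fun d => X e d T),
      forall c, 0 < c -> \forall e \near (0 : R)^'+, forall d, unit_cube q d -> `|X e d T - x0 T| <= c &
      forall (g : E -> R^o) c, hadamard_differentiable g (x0 T) -> 0 < c ->
        \forall e \near (0 : R)^'+, forall d, unit_cube q d ->
        `|e^-1 * (g (X e d T) - g (x0 T)) - DH g (x0 T) (\sum_k kap k d *: v k)| <= c].
Proof.
move=> /endpoint_cone_family[N [s [z [c [sT zU c0 vE]]]]] ckap kap0 kap1.
have [r r0 [L tubes]] := tubes_exist zU.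
have tube_u0 t : 0 <= t <= T -> tube r L x0 u0 t by move=> /tubes[].
have tube_z j t : 0 <= t <= T -> tube r L x0 (fun=> z j) t by move=> /tubes[_]; exact.
pose a d j := \sum_k kap k d * c k j; pose bd := \sum_j \sum_k c k j.
have a_cont j : continuous (a ^~ j).
  move=> d; apply: (@cvg_sumr R R _ _ _ (nbhs_filter (d : 'rV[R]_q))) => k.
  by apply: cvgMl; exact: ckap.
have a_ge0 d j : 0 <= a d j by apply: sumr_ge0 => k _; rewrite mulr_ge0.
have bd_ge0 : 0 <= bd by apply: sumr_ge0 => j _; exact: sumr_ge0.
have a_bd d : unit_cube q d -> total (a d) <= bd.
  by move=> qd; apply: ler_sum => j _; apply: ler_sum => k _; rewrite ler_piMl// kap1.
pose sa e d := fun j => e * a d j.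
pose u e d := needle u0 z (needle_start s (sa e d)) (needle_end s (sa e d)).
have u_cadlag e d : cadlag T U (u e d) by exact: needle_cadlag.
have /choice[X' /= X'P] : forall w : R * 'rV[R]_q, exists x, trajectory r (u w.1 w.2) x.
  move=> w; apply: (trajectory_exists zU r0 tube_u0 tube_z) => //.
  exact: needle_mixed.
pose X e d := X' (e, d).
have XP e d : trajectory r (u e d) (X e d) by exact: X'P (e, d).
have near_x0 := family_close zU r0 tube_u0 tube_z a_ge0 bd_ge0 a_bd XP.
have TT : 0 <= T <= T by rewrite lexx T0.
exists X; split.
- have r2 : 0 < r / 2 by rewrite divr_gt0.
  (* All needles end before [T]; the new control equals [u0] near [T] and inherits its left
     continuity there. *)
  have fit : \forall e \near (0 : R)^'+, forall j, bd * e < T - s j.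
    apply: filter_forall => j; have Ts : 0 < (T - s j) / 2.
      by rewrite divr_gt0// subr_gt0; have /andP[] := sT j.
    by apply: filterS (near0_small bd_ge0 Ts) => e h; lra.
  near=> e => d qd; have e0 : 0 < e by near: e; exact: nbhs_right_gt.
  have close_t : forall t, 0 <= t <= T -> `|X e d t - x0 t| <= r / 2.
    by move: d qd; near: e; exact: near_x0 r2.
  have fit_e : forall j, bd * e < T - s j by near: e.
  have [cx x00 dx] := XP e d; split => //; exists (u e d).
  have sa0 j : 0 <= sa e d j by rewrite mulr_ge0// ltW.
  have tot : total (sa e d) <= bd * e.
    by rewrite /total -mulr_sumr mulrC ler_wpM2r ?a_bd// ltW.
  have end_lt j : needle_end s (sa e d) j < T.
    have := fit_e j; have /andP[_] := partial_itv j.+1 sa0.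
    rewrite /needle_end; lra.
  have late t : (forall j, needle_end s (sa e d) j <= t) -> u e d t = u0 t.
    by move=> h; apply: needle_out => j; rewrite andbC ltNge h.
  apply: (control_solution (D' := D ++ map (needle_start s (sa e d)) (enum 'I_N) ++
      map (needle_end s (sa e d)) (enum 'I_N))) => //.
  + move=> t tT; have [] := tube_u0 t tT (X e d t) => //.
    by apply: (le_lt_trans (close_t t tT)); rewrite ltr_pdivrMr// ltr_pMr// ltr1n.
  + move=> t tT; rewrite !mem_cat !negb_or => /and3P[tD tS tE].
    apply: needle_continuous => [j|j|]; last exact: u0_D.
    * by apply: contraNneq tS => ->; apply: map_f; rewrite mem_enum.
    * by apply: contraNneq tE => ->; apply: map_f; rewrite mem_enum.
  + rewrite late => [|j]; last exact: ltW.
    apply: (@cvg_trans _ (u0 t @[t --> T^'-])) => //; apply: near_eq_cvg.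
    have : \forall t \near T^'-, forall j, needle_end s (sa e d) j <= t.
      by apply: filter_forall => j; apply: nbhs_left_ge.
    by move=> H; apply: (filterS _ H) => t /late ->.
  + move=> t tT; rewrite -(@cutoff_id r r0); first exact: dx.
    by apply: close_t; have /andP[-> /ltW] := tT.
- move=> e d; apply: (endpoint_cvg zU r0 tube_u0 tube_z a_cont XP (F := nbhs d) (e := fun=> e) (d := id)) => //.
  exact: cvg_cst.
- by move=> b b0; apply: filterS (near_x0 b b0) => e h d qd; exact: h.
- move=> g b hg b0.
  have H := family_derivative zU r0 tube_u0 tube_z sT a_cont a_ge0 bd_ge0 a_bd XP hg b0.
  apply: (filterS _ H) => e h d qd; rewrite (_ : \sum_k _ = direction z s a d).
    exact: h.
  rewrite /direction /a; under [RHS]eq_bigr do rewrite scaler_suml.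
  rewrite exchange_big; apply: eq_bigr => k _; rewrite vE scaler_sumr.
  by apply: eq_bigr => j _; rewrite scalerA.
Unshelve. all: by end_near. Qed.

(** * The surjective case *)

Section Improvement.
Variables (l m q : nat) (g0 : 'I_l -> E -> R) (g : 'I_m -> E -> R) (h : 'I_q -> E -> R).
Local Notation diff_end k := (hadamard_differentiable (k : E -> R^o) (x0 T)).
Local Notation D_end k := (DH (k : E -> R^o) (x0 T)).
Hypothesis g0_diff : forall i, diff_end (g0 i).
Hypothesis g_diff : forall a, diff_end (g a).
Hypothesis h_diff : forall b, diff_end (h b).
Hypothesis h_cont : forall b, exists V : set E,
  [/\ nbhs (x0 T) V, V `<=` Omega & {within V, continuous (h b)}].
Hypothesis g_end : forall a, 0 <= g a (x0 T).
Hypothesis h_end : forall b, h b (x0 T) = 0.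

Lemma surjective_improvement : (0 < q)%N ->
  image_cone endpoint_cone (fun i => D_end (g0 i)) (fun a => D_end (g a))
    (fun b => D_end (h b)) (fun a => g a (x0 T) = 0) = setT ->
  exists x u, admissible T Omega U (x0 0) f g h x u /\
    forall i, g0 i (x0 T) < g0 i (x T).
Proof.
(* One vector improves the objectives and active inequalities whatever [d] is; for each equality,
   two more vectors also do so while moving that constraint by [+1] and by [-1]. *)
move=> q0 surj; pose K := ('I_1 + ('I_q + 'I_q))%type.
pose target (k : K) : 'I_l + 'I_m + 'I_q -> R^o := fun i => match i with
  | inr b => match k with inl _ => 0 | inr (inl b') => (b' == b)%:R
             | inr (inr b') => - (b' == b)%:R end
  | _ => 1 end.
have /choice[v vP] : forall k, exists v, endpoint_cone v /\
    [/\ forall i, 1 <= D_end (g0 i) v, forall a, g a (x0 T) = 0 -> 1 <= D_end (g a) v &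
        forall b, target k (inr b) = D_end (h b) v].
  move=> k; have [v Vv [h1 h2 h3]] : image_cone endpoint_cone (fun i => D_end (g0 i))
      (fun a => D_end (g a)) (fun b => D_end (h b)) (fun a => g a (x0 T) = 0) (target k).
    by rewrite surj.
  by exists v; split => //; split.
(* The nonnegative coefficients are the positive and negative parts of the coordinates of [d], whose
   difference is [d] itself. *)
pose kap (k : K) (d : 'rV[R]_q) : R := match k with inl _ => 1
  | inr (inl b) => (`|d ord0 b| + d ord0 b) / 2
  | inr (inr b) => (`|d ord0 b| - d ord0 b) / 2 end.
have kap_cont k : continuous (kap k).
  move=> d; have FF : Filter (nbhs (d : 'rV[R]_q)) by exact: nbhs_filter.
  have cb b : d' ord0 b @[d' --> d] --> d ord0 b by exact: coord_continuous.
  suff : kap k d' @[d' --> d] --> kap k d by [].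
  case: k => [i|[b|b]]; rewrite /kap; first by apply: cvg_cst.
    by apply: cvgM; [apply: cvgD; [apply: cvg_norm|]; exact: cb|exact: cvg_cst].
  by apply: cvgM; [apply: cvgB; [apply: cvg_norm|]; exact: cb|exact: cvg_cst].
have kap_ge0 k d : 0 <= kap k d.
  case: k => [i|[b|b]] //=; rewrite divr_ge0//.
    by rewrite -lerBlDr sub0r -normrN ler_norm.
  by rewrite subr_ge0 ler_norm.
have kap_le1 k d : unit_cube q d -> kap k d <= 1.
  move=> qd; case: k => [//|[b|b]]; rewrite /kap ler_pdivrMr// mul1r;
    have := qd b; rewrite in_itv /= -ler_norml.
    by have := ler_norm (d ord0 b); lra.
  by have := ler_norm (- d ord0 b); rewrite normrN; lra.
(* Along [w] the equality constraints vary like [d] although the coefficients [kap]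
   are nonnegative, and the other differentials stay above 1. *)
pose w d := \sum_k kap k d *: v k.
have wE (D' : dual E) d : D' (w d) = \sum_k kap k d * D' (v k).
  by rewrite /w linear_sum; apply: eq_bigr => k _; rewrite linearZ.
have w_h b d : D_end (h b) (w d) = d ord0 b.
  rewrite wE !big_sumType /= big_ord1.
  have vE k : D_end (h b) (v k) = target k (inr b) by have [_ [_ _ ->]] := vP k.
  rewrite vE /= mulr0 add0r (bigD1 b)//= big1 => [|b' bb']; last by rewrite vE /= (negbTE bb') mulr0.
  rewrite vE /= eqxx (bigD1 b)//= big1 => [|b' bb']; last by rewrite vE /= (negbTE bb') oppr0 mulr0.
  by rewrite vE /= eqxx -[nat_of_bool true]/1%N mulr1n; field.
have w_ge1 (D' : dual E) d : (forall k, 1 <= D' (v k)) -> 1 <= D' (w d).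
  move=> D1; rewrite wE big_sumType /= big_ord1 mul1r.
  apply: (le_trans (D1 (inl ord0))); rewrite lerDl; apply: sumr_ge0 => k _.
  by rewrite mulr_ge0 ?(kap_ge0 (inr k))// (le_trans ler01).
(* A bound on [w d] uniform over the cube: it controls the inactive inequalities, whose variation is
   of order [e]. *)
pose M := \sum_k `|v k|; have M0 : 0 <= M by exact: sumr_ge0.
have w_bd (D' : dual E) d : unit_cube q d -> - (`|D'| * M) <= D' (w d).
  move=> qd; have wM : `|w d| <= M.
    apply: (le_trans (ler_norm_sum _ _ _)); apply: ler_sum => k _.
    by rewrite normrZ ger0_norm// ler_piMl// kap_le1.
  have : `|D' (w d)| <= `|D'| * M by apply: (le_trans (blin_normP _ _)); rewrite ler_wpM2l.
  by rewrite ler_norml => /andP[].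
have [X [X_sol X_cont X_near X_der]] := needle_family (fun k => (vP k).1) kap_cont kap_ge0 kap_le1.
have hlf : 0 < 1 / 2 :> R by rewrite divr_gt0.
have /choice[V VP] := h_cont.
have X_V : \forall e \near (0 : R)^'+, forall b d, unit_cube q d -> V b (X e d T).
  apply: filter_forall => b; have [/nbhs_ballP[r /= r0 rV] _ _] := VP b.
  have r2 : 0 < r / 2 by rewrite divr_gt0.
  apply: (filterS _ (X_near _ r2)) => e H d qd; apply: rV.
  by rewrite -ball_normE /= distrC (le_lt_trans (H d qd))// ltr_pdivrMr// ltr_pMr// ltr1n.
have X_g0 : \forall e \near (0 : R)^'+, forall i d, unit_cube q d ->
    `|e^-1 * (g0 i (X e d T) - g0 i (x0 T)) - D_end (g0 i) (w d)| <= 1 / 2.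
  by apply: filter_forall => i; exact: X_der (g0_diff i) hlf.
have X_g : \forall e \near (0 : R)^'+, forall a d, unit_cube q d ->
    `|e^-1 * (g a (X e d T) - g a (x0 T)) - D_end (g a) (w d)| <= 1 / 2.
  by apply: filter_forall => a; exact: X_der (g_diff a) hlf.
have X_h : \forall e \near (0 : R)^'+, forall b d, unit_cube q d ->
    `|e^-1 * (h b (X e d T) - h b (x0 T)) - D_end (h b) (w d)| <= 1 / 2.
  by apply: filter_forall => b; exact: X_der (h_diff b) hlf.
(* Inactive inequalities start with a positive margin, which exceeds their variation for small
   [e]. *)
have slack : \forall e \near (0 : R)^'+, forall a, 0 < g a (x0 T) ->
    (`|D_end (g a)| * M + 1 / 2) * e <= g a (x0 T).
  apply: filter_forall => a; have [ga|ga] := ltP 0 (g a (x0 T)); last by apply: filterE.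
  have c0 : 0 <= `|D_end (g a)| * M + 1 / 2 by rewrite addr_ge0 ?mulr_ge0// ltW.
  by apply: (filterS _ (near0_small c0 ga)).
near (0 : R)^'+ => e; have e0 : 0 < e by near: e; exact: nbhs_right_gt.
have sol_e d : unit_cube q d -> X e d 0 = x0 0 /\ exists u, [/\ PC1 T Omega (X e d), NPC0 T U u &
    forall t, t \in `[0, T] -> ext_deriv T (X e d) t = f t (X e d t) (u t)].
  by move: d; near: e; exact: X_sol.
have V_e b d : unit_cube q d -> V b (X e d T) by move: b d; near: e; exact: X_V.
have g0_e i d : unit_cube q d ->
    `|e^-1 * (g0 i (X e d T) - g0 i (x0 T)) - D_end (g0 i) (w d)| <= 1 / 2.
  by move: i d; near: e; exact: X_g0.
have g_e a d : unit_cube q d ->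
    `|e^-1 * (g a (X e d T) - g a (x0 T)) - D_end (g a) (w d)| <= 1 / 2.
  by move: a d; near: e; exact: X_g.
have h_e b d : unit_cube q d ->
    `|e^-1 * (h b (X e d T) - h b (x0 T)) - D_end (h b) (w d)| <= 1 / 2.
  by move: b d; near: e; exact: X_h.
have slack_e a : 0 < g a (x0 T) -> (`|D_end (g a)| * M + 1 / 2) * e <= g a (x0 T).
  by move: a; near: e; exact: slack.
have low (k : E -> R) d c : `|e^-1 * (k (X e d T) - k (x0 T)) - D_end k (w d)| <= 1 / 2 ->
    c <= D_end k (w d) -> (c - 1 / 2) * e <= k (X e d T) - k (x0 T).
  by move=> h1 h2; rewrite -ler_pdivlMr// mulrC; move: h1; rewrite ler_norml => /andP[h1 _]; lra.
(* Divided by [e], the equality constraints are within [1 / 2] of the coordinates of [d], so on the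
   faces of the cube they have the signs that [poincare_miranda] requires. *)
pose phi b d : R := e^-1 * h b (X e d T).
have phiE b d : unit_cube q d -> `|phi b d - d ord0 b| <= 1 / 2.
  by move=> qd; have := h_e b d qd; rewrite h_end subr0 w_h.
have phi_cont b : {within unit_cube q, continuous (phi b)}.
  apply/subspace_continuousP => d1 qd1; set F := within _ _.
  have FF : Filter F by exact: within_filter.
  suff : phi b d @[d --> F] --> phi b d1 by [].
  apply: cvgM; first exact: cvg_cst.
  have [_ _ hV] := VP b; apply: (within_continuous_cvg hV); first exact: V_e.
    by apply: (filterS _ (withinT (unit_cube q) (nbhs_filter d1))) => d qd; exact: V_e.
  by apply: cvg_within_filter; exact: X_cont.
have [b d qd db|b d qd db|d qd phi0] := poincare_miranda q0 phi_cont.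
- by have := phiE b d qd; rewrite db ler_norml => /andP[]; lra.
- by have := phiE b d qd; rewrite db ler_norml => /andP[]; lra.
have [X0 [u [XPC1 uNPC0 Xd]]] := sol_e d qd.
exists (X e d), u; split; last first.
  move=> i; have D1 : 1 <= D_end (g0 i) (w d).
    by apply: w_ge1 => k; have [_ [h1 _ _]] := vP k.
  have := low _ _ _ (g0_e i d qd) D1; rewrite -subr_gt0; apply: lt_le_trans.
  by rewrite mulr_gt0//; lra.
split => // [a|b]; last first.
  by have /eqP := phi0 b; rewrite mulf_eq0 invr_eq0 gt_eqF//= => /eqP.
have [ga|ga] := ltP 0 (g a (x0 T)).
  have := low _ _ _ (g_e a d qd) (w_bd _ d qd); have := slack_e a ga; lra.
have {}ga : g a (x0 T) = 0 by apply/le_anti; rewrite ga g_end.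
have D1 : 1 <= D_end (g a) (w d) by apply: w_ge1 => k; have [_ [_ h2 _]] := vP k; exact: h2.
have := low _ _ _ (g_e a d qd) D1; rewrite ga subr0; apply: le_trans.
by rewrite mulr_ge0 ?ltW//; lra.
Unshelve. all: by end_near. Qed.

End Improvement.
End Dynamics.

(** * Vanishing of the adjoint state *)

Lemma adjoint_vanish {R : realType} {E F : normedModType R} T (A : R -> blin E E)
    (p : R -> blin E F) t1 : 0 <= t1 <= T -> cadlag T setT A -> continuous p ->
  (forall t, 0 <= t < T -> rderiv p t (- blin_comp (p t) (A t))) -> p t1 = 0 -> p T = 0.
Proof.
move=> /andP[t0 tT] cA cp dp p0; have T0 : 0 <= T := le_trans t0 tT.
have [L L0 AL] := cadlag_bounded T0 cA.
have := @gronwall _ _ p (fun=> 0) L t1 T L0 tT.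
rewrite p0 normr0 subrr addr0 mulr0 => h; apply/eqP; rewrite -normr_le0; apply: h.
- by move=> t _; exact: cp.
- by move=> t _; exact: cvg_cst.
- move=> t /andP[t1t tT'].
  exists (- blin_comp (p t) (A t)), 0; split => //.
  + by apply: dp; rewrite tT' (le_trans t0).
  + exact: dini_ge_nondecreasing.
  + rewrite normrN addr0; apply: blin_norm_le => [|v]; first by rewrite mulr_ge0.
    apply: (le_trans (blin_normP (p t) (A t v))).
    rewrite [L * _]mulrC -mulrA ler_wpM2l//.
    apply: (le_trans (blin_normP (A t) v)); rewrite ler_wpM2r// AL//.
    by rewrite (le_trans t0 t1t) ltW.
Qed.

(** Since [U] is a neighbourhood of [u], every direction [v] is allowed, and maximality makes the
    directional derivative of [p] composed with [F] nonpositive. By surjectivity [p] is nonpositive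
    everywhere, hence zero. *)
Lemma surjective_stationary {R : realType} {Y E : normedModType R} (F : Y -> E) u (U : set Y)
    (p : dual E) : nbhs u U -> gateaux_differentiable F u ->
  (forall y, exists v, DG F u v = y) -> (forall z, U z -> p (F z) <= p (F u)) -> p = 0.
Proof.
move=> nU /(@xgetPex _ 0); rewrite -/(DG F u) => gF surj pmax.
have le0 y : p y <= 0.
  have [v <-] := surj y.
  have lim : p (t^-1 *: (F (u + t *: v) - F u)) @[t --> (0 : R)^'+] --> p (DG F u v).
    by apply: continuous_cvg; [exact: blin_continuous|exact: gF].
  apply: (cvgr_to_le lim).
  have ut : u + t *: v @[t --> (0 : R)^'+] --> u.
    rewrite -[X in _ --> X]addr0 -(scale0r v); apply: cvgD; first exact: cvg_cst.
    by apply: cvgZl; apply: cvg_at_right_filter; exact: cvg_id.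
  have nU' : \forall t \near (0 : R)^'+, U (u + t *: v) by exact: ut.
  near=> t; have t0 : 0 < t by near: t; exact: nbhs_right_gt.
  rewrite linearZ linearB; apply: mulr_ge0_le0; first by rewrite invr_ge0 ltW.
  by rewrite subr_le0; apply: pmax; near: t.
apply: blinE => y; apply/le_anti; rewrite le0 /=.
by have := le0 (- y); rewrite linearN oppr_le0.
Unshelve. all: by end_near. Qed.

(** * Multipliers for the optimal pair *)

Section Pontryagin.
Context (R : realType) (E : completeNormedModType R)
    (Y : normedModType R) (l m q : nat)
    (hl : (0 < l)%N) (hq : (0 < q)%N) (T : R) (hT : 0 < T)
    (Omega : set E) (hOmega : open Omega) (U : set Y) (xi0 : E)
    (f : R -> E -> Y -> E)
    (g0 : 'I_l -> E -> R) (g : 'I_m -> E -> R) (h : 'I_q -> E -> R)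
    (x0 : R -> E) (u0 : R -> Y)
    (hopt : pareto_optimal T Omega U xi0 f g0 g h x0 u0)
    (ha_cont : {within `[0, T] `*` Omega `*` U,
        continuous (fun z : R * E * Y => f z.1.1 z.1.2 z.2)})
    (ha_gateaux : forall t xi zeta, t \in `[0, T] -> Omega xi -> U zeta ->
        gateaux_differentiable (fun xi' => f t xi' zeta) xi)
    (ha_frechet : forall t zeta, t \in `[0, T] -> U zeta ->
        differentiable (fun xi => f t xi zeta) (x0 t))
    (ha_frechet_cont : {within `[0, T] `*` U,
        continuous (fun z : R * Y => DF (fun xi => f z.1 xi z.2) (x0 z.1))})
    (hb : forall (K : set E) (M : set Y),
        K !=set0 -> compact K -> K `<=` Omega ->
        M !=set0 -> compact M -> M `<=` U ->
        (ereal_sup [set `|DG (fun xi => f z.1.1 xi z.2) z.1.2|%:E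
                   | z in (`[0%R, T] `*` K `*` M : set (R * E * Y))]
          < +oo)%E)
    (hc0 : forall i, hadamard_differentiable (g0 i : E -> R^o) (x0 T))
    (hc : forall a, hadamard_differentiable (g a : E -> R^o) (x0 T))
    (hd_cont : forall b, exists V : set E,
        [/\ nbhs (x0 T) V, V `<=` Omega & {within V, continuous (h b)}])
    (hd : forall b, hadamard_differentiable (h b : E -> R^o) (x0 T)).

Let T0 : 0 <= T. Proof. exact: ltW. Qed.
(** The optimal state is known only on [[0, T]], whereas the results on the dynamics take a path
    continuous on the line; [xb] is such an extension. *)
Let xb := x0 \o clamp T.
Let xbE t : 0 <= t <= T -> xb t = x0 t.
Proof. by move=> tT; rewrite /xb /= clamp_id. Qed.
Let xb_cont : continuous xb.
Proof. by have [[[[cx _ _] _] _ _ _ _] _] := hopt; exact: clamp_path. Qed.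
Let xb_Omega t : 0 <= t <= T -> Omega (xb t).
Proof. by have [[[[_ Ox _] _] _ _ _ _] _] := hopt => tT; rewrite xbE//; exact: Ox. Qed.
Let u0_cadlag : cadlag T U u0.
Proof. by have [[[_ /(NPC0_cadlag hT)[]]]] := hopt. Qed.
Let u0_T : u0 r @[r --> T^'-] --> u0 T.
Proof. by have [[[_ []]]] := hopt. Qed.
Let xb_diff t zeta : t \in `[0, T] -> U zeta -> differentiable (fun xi => f t xi zeta) (xb t).
Proof. by move=> tT; rewrite xbE//; exact: ha_frechet. Qed.
Let xb_df_cont : {within `[0, T] `*` U,
  continuous (fun z : R * Y => DF (fun xi => f z.1 xi z.2) (xb z.1))}.
Proof.
apply: (subspace_eq_continuous _ ha_frechet_cont) => -[t z]; rewrite inE /= => -[tT _].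
by rewrite /from_subspace /= xbE.
Qed.
Let xb_sol t : 0 <= t < T -> rderiv xb t (f t (xb t) (u0 t)).
Proof.
have [[[xPC _] xd _ _ _] _] := hopt => tT.
have tT' : 0 <= t <= T by have /andP[-> /ltW] := tT.
by have := PC1_rderiv xPC tT; rewrite xd ?xbE// in_itv.
Qed.
Let xbT : xb T = x0 T. Proof. by rewrite xbE// T0 lexx. Qed.
Local Notation A := (linearization f xb u0).
Let A_cadlag : cadlag T setT A := linearization_cadlag u0_cadlag xb_df_cont.

Lemma pontryagin_exists : exists (theta : {ffun 'I_l -> R}) (lambda : {ffun 'I_m -> R})
    (mu : {ffun 'I_q -> R}) (p : R -> dual E),
  PC1 T setT p /\ pontryagin T U f g0 g h x0 u0 theta lambda mu p.
Proof.
have [[[_ /(NPC0_cadlag hT)[_ [D u0_D]]] _ x00 g_end h_end] best] := hopt.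
have [S [Q [S_cont Q_cont dS dQ SQ]]] := resolvent_exists T0 A_cadlag.
pose act a := g a (x0 T) = 0.
pose V := endpoint_cone T U f xb u0 S Q.
have cV : convex_cone V by exact: endpoint_cone_convex.
have [surj|nsurj] := pselect (image_cone V (fun i => DH (g0 i : E -> R^o) (x0 T))
    (fun a => DH (g a : E -> R^o) (x0 T)) (fun b => DH (h b : E -> R^o) (x0 T)) act = setT).
  exfalso; apply: best; move: surj; rewrite /act -xbT => surj.
  have [||||||x [u [xu xg]]] := surjective_improvement T0 hOmega ha_cont ha_gateaux hb xb_cont xb_Omega
    u0_cadlag u0_D xb_diff xb_df_cont hT u0_T xb_sol S_cont dS SQ (g0 := g0) (g := g) (h := h)
    _ _ _ _ _ _ hq surj; rewrite ?xbT//.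
  exists x, u; split.
  - by move: xu; rewrite xbE ?lexx ?T0// x00.
  - by move=> i; rewrite -xbT ltW.
  (* All objectives improve strictly; as there is at least one, Pareto optimality is
     contradicted. *)
  - by exists (Ordinal hl); rewrite -xbT.
have [th [la [mu [nz [th0 la0] la_act ellV]]]] := cone_multipliers cV nsurj.
set ell := (_ + _ + _) in ellV.
pose p := adjoint T S Q ell.
exists th, la, mu, p.
have [pPC dp] := adjoint_PC1 T0 u0_cadlag u0_D xb_diff xb_df_cont hT u0_T S Q_cont dQ ell.
split; first exact: pPC.
split; [exact: nz|by split| | |].
- move=> a; have [ga|ga] := pselect (act a); first by rewrite ga mulr0.
  by rewrite la_act// mul0r.
- by rewrite [RHS](adjoint_end hT SQ ell).
split.
- by move=> t tT; have -> := dp t tT; rewrite (xbE tT).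
- move=> t z tT Uz; have := maximum_principle hOmega ha_cont xb_cont xb_Omega u0_cadlag hT
    u0_T Q_cont ellV tT Uz.
  by rewrite xbE.
- have := hamiltonian_continuous hOmega ha_cont xb_cont xb_Omega u0_cadlag hT
    u0_T Q_cont ellV.
  apply: subspace_eq_continuous => t; rewrite inE /= => tT.
  by rewrite /from_subspace /= xbE.
Qed.

Lemma pontryagin_normal
    (he : forall (c : 'I_m -> R) (d : 'I_q -> R),
        (forall a, 0 <= c a) ->
        (forall a, c a * g a (x0 T) = 0) ->
        \sum_a c a *: DH (g a : E -> R^o) (x0 T)
          + \sum_b d b *: DH (h b : E -> R^o) (x0 T) = 0 ->
        (forall a, c a = 0) /\ (forall b, d b = 0))
    (hf : exists t, [/\ t \in `[0, T], nbhs (u0 t) U,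
        gateaux_differentiable (f t (x0 t)) (u0 t) &
        forall y : E, exists v : Y, DG (f t (x0 t)) (u0 t) v = y])
    (theta : {ffun 'I_l -> R}) (lambda : {ffun 'I_m -> R})
    (mu : {ffun 'I_q -> R}) (p : R -> dual E) :
  PC1 T setT p -> pontryagin T U f g0 g h x0 u0 theta lambda mu p -> theta <> 0.
Proof.
move=> pPC [nz [_ la0] slack tc [ae mp _]] th0.
have [t1 [t1T nU gf surj]] := hf; have [u0U _ _] := u0_cadlag.
have p1 : p t1 = 0.
  by apply: (surjective_stationary nU gf surj) => z Uz; exact: mp.
have pT : p T = 0.
  have clT : clamp T T = T by rewrite clamp_id// T0 lexx.
  have t1T' : 0 <= t1 <= T by move: t1T; rewrite in_itv.
  have := @adjoint_vanish _ _ _ T A (p \o clamp T) t1 t1T' A_cadlag.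
  rewrite /= clT clamp_id//; apply => //.
    by have [cp _ _] := pPC; exact: clamp_path.
  move=> t tT; have tT' : 0 <= t <= T by have /andP[-> /ltW] := tT.
  have AE : A t = DF (fun xi => f t xi (u0 t)) (x0 t) by rewrite /linearization (xbE tT').
  have := PC1_rderiv pPC tT; rewrite ae ?in_itv// /hamiltonian DF_blin_comp.
    by rewrite -AE (clamp_id tT').
  by apply: ha_frechet; [rewrite in_itv|exact: u0U].
move: tc; rewrite pT th0 big1 ?add0r => [tc|i _]; last by rewrite ffunE scale0r.
have [la_0 mu_0] := he _ _ la0 slack tc.
apply: nz; rewrite th0; congr (_, _, _); apply/ffunP => i; rewrite !ffunE; [exact: la_0|exact: mu_0].
Qed.

End Pontryagin.

Theorem corollary4p5 (R : realType) (E : completeNormedModType R)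
    (Y : normedModType R) (l m q : nat)
    (hl : (0 < l)%N) (hm : (0 < m)%N) (hq : (0 < q)%N)
    (T : R) (hT : 0 < T)
    (Omega : set E) (hOmega : open Omega) (U : set Y)
    (xi0 : E) (hxi0 : Omega xi0)
    (f : R -> E -> Y -> E)
    (g0 : 'I_l -> E -> R) (g : 'I_m -> E -> R) (h : 'I_q -> E -> R)
    (x0 : R -> E) (u0 : R -> Y)
    (hopt : pareto_optimal T Omega U xi0 f g0 g h x0 u0)
    (ha_cont : {within `[0, T] `*` Omega `*` U,
        continuous (fun z : R * E * Y => f z.1.1 z.1.2 z.2)})
    (ha_gateaux : forall t xi zeta, t \in `[0, T] -> Omega xi -> U zeta ->
        gateaux_differentiable (fun xi' => f t xi' zeta) xi)
    (ha_frechet : forall t zeta, t \in `[0, T] -> U zeta ->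
        differentiable (fun xi => f t xi zeta) (x0 t))
    (ha_frechet_cont : {within `[0, T] `*` U,
        continuous (fun z : R * Y => DF (fun xi => f z.1 xi z.2) (x0 z.1))})
    (hb : forall (K : set E) (M : set Y),
        K !=set0 -> compact K -> K `<=` Omega ->
        M !=set0 -> compact M -> M `<=` U ->
        (ereal_sup [set `|DG (fun xi => f z.1.1 xi z.2) z.1.2|%:E
                   | z in (`[0%R, T] `*` K `*` M : set (R * E * Y))]
          < +oo)%E)
    (hc0 : forall i, hadamard_differentiable (g0 i : E -> R^o) (x0 T))
    (hc : forall a, hadamard_differentiable (g a : E -> R^o) (x0 T))
    (hd_cont : forall b, exists V : set E,
        [/\ nbhs (x0 T) V, V `<=` Omega & {within V, continuous (h b)}])
    (hd : forall b, hadamard_differentiable (h b : E -> R^o) (x0 T))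
    (he : forall (c : 'I_m -> R) (d : 'I_q -> R),
        (forall a, 0 <= c a) ->
        (forall a, c a * g a (x0 T) = 0) ->
        \sum_a c a *: DH (g a : E -> R^o) (x0 T)
          + \sum_b d b *: DH (h b : E -> R^o) (x0 T) = 0 ->
        (forall a, c a = 0) /\ (forall b, d b = 0))
    (hf : exists t, [/\ t \in `[0, T], nbhs (u0 t) U,
        gateaux_differentiable (f t (x0 t)) (u0 t) &
        forall y : E, exists v : Y, DG (f t (x0 t)) (u0 t) v = y]) :
  (exists (theta : {ffun 'I_l -> R}) (lambda : {ffun 'I_m -> R})
      (mu : {ffun 'I_q -> R}) (p : R -> dual E),
    PC1 T setT p /\ pontryagin T U f g0 g h x0 u0 theta lambda mu p) /\
  (forall (theta : {ffun 'I_l -> R}) (lambda : {ffun 'I_m -> R})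
      (mu : {ffun 'I_q -> R}) (p : R -> dual E),
    PC1 T setT p -> pontryagin T U f g0 g h x0 u0 theta lambda mu p ->
    theta <> 0).
Proof.
split.
  exact: (pontryagin_exists hl hq hT hOmega hopt ha_cont ha_gateaux ha_frechet ha_frechet_cont hb
    hc0 hc hd_cont hd).
move=> theta lambda mu p.
exact: (pontryagin_normal hT hopt ha_frechet ha_frechet_cont he hf).
Qed.
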